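(* Let $R(t)\equiv R$ be the unique formal power series in $t$ with constant term $0$ satisfying $$t=\sum_{n\ge 0}\frac{1}{n+1}\binom{2n}{n}\binom{3n}{n} R^{n+1}.$$ Then the generating function $Q(t,1)$ of quartic rooted planar Eulerian orientations, counted by vertices, is $$Q(t,1)=\frac{1}{3t^2}\left(t-3t^2-R(t)\right)=4t+35t^2+402t^3+\cdots .$$
   Context: A planar map is a connected graph (loops and multiple edges allowed) embedded in the sphere without edge crossings, considered up to orientation-preserving homeomorphism. It is rooted if one edge (the root edge) is distinguished and given a direction. Only maps with at least one edge are counted. A map is quartic if every vertex has degree $4$. An Eulerian orientation of a planar map is an orientation of all its edges such that every vertex has equal in-degree and out-degree (a loop contributes one to each). A rooted planar Eulerian orientation is a rooted planar map equipped with an Eulerian orientation in which the root edge is oriented canonically, i.e. its orientation in the Eulerian orientation agrees with its root direction. (Equivalently: a planar Eulerian orientation with one marked edge.) $Q(t,1)=\sum_{n\ge1}q_nt^n$, where $q_n$ is the number of quartic rooted planar Eulerian orientations with $n$ vertices. *)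

(* Defs.v *)
From HB Require Import structures.
From mathcomp Require Import all_boot all_order all_fingroup all_algebra.
From mathcomp Require Import boolp.

Set Implicit Arguments.
Unset Strict Implicit.
Unset Printing Implicit Defensive.

Import GRing.Theory.

(* A map on an oriented surface is encoded by two permutations of its set D
   of darts (half-edges): [s] sends a dart to the next one in counterclockwise
   order around its vertex, and [a] exchanges the two darts of each edge.
   Vertices, edges and faces are the cycles of [s], [a] and [a * s].  Loops and
   multiple edges are allowed; a loop contributes two darts to its vertex. *)
Definition pairing (D : finType) (a : {perm D}) : bool :=
  [forall x, (a x != x) && (a (a x) == x)].

Definition map_connected (D : finType) (s a : {perm D}) : bool :=
  [forall x, forall y, connect [rel u v | (v == s u) || (v == a u)] x y].

(* Euler's formula: for a connected map, this says that the surface is the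
   sphere. *)
Definition genus0 (D : finType) (s a : {perm D}) : bool :=
  #|porbits s| + #|porbits (a * s)%g| == #|porbits a| + 2.

Definition planar_map (D : finType) (s a : {perm D}) : bool :=
  [&& pairing a, map_connected s a & genus0 s a].

Definition quartic (D : finType) (s : {perm D}) : bool :=
  [forall v in porbits s, #|v| == 4].

(* An orientation of the edges is given by the set [O] of the darts at the
   tails of the edges. *)
Definition orientation (D : finType) (a : {perm D}) (O : {set D}) : bool :=
  [forall x, (a x \in O) == (x \notin O)].

Definition eulerian (D : finType) (s : {perm D}) (O : {set D}) : bool :=
  [forall v in porbits s, #|v :&: O| == #|v :\: O|].

(* The root dart is the initial half-edge of the directed root edge. *)
Definition rooted_oriented (D : finType) : finType :=
  ({perm D} * {perm D} * {set D} * D)%type.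

Definition vrot D (m : rooted_oriented D) : {perm D} := m.1.1.1.
Definition eflip D (m : rooted_oriented D) : {perm D} := m.1.1.2.
Definition tails D (m : rooted_oriented D) : {set D} := m.1.2.
Definition root_dart D (m : rooted_oriented D) : D := m.2.

Definition planar_eulerian_orientation D (m : rooted_oriented D) : bool :=
  [&& planar_map (vrot m) (eflip m), orientation (eflip m) (tails m),
      eulerian (vrot m) (tails m) & root_dart m \in tails m].

(* Orientation-preserving homeomorphisms correspond to relabelings of the darts
   that commute with both permutations. *)
Definition isomorphic D (m1 m2 : rooted_oriented D) : bool :=
  [exists f : {perm D},
     [&& [forall x, f (vrot m1 x) == vrot m2 (f x)],
         [forall x, f (eflip m1 x) == eflip m2 (f x)],
         [forall x, (f x \in tails m2) == (x \in tails m1)]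
       & f (root_dart m1) == root_dart m2]].

(* q_n: a quartic map with n vertices has exactly 4n darts, so that every
   isomorphism class is represented on 'I_(4 * n). *)
Definition quartic_peo_count (n : nat) : nat :=
  #|equivalence_partition (@isomorphic 'I_(4 * n))
      [set m : rooted_oriented 'I_(4 * n) |
         [&& planar_eulerian_orientation m, quartic (vrot m)
           & #|porbits (vrot m)| == n]]|.

Local Open Scope ring_scope.

(* The ring of formal power series in t over rat. *)
Record fps := Fps { coefs : nat -> rat }.

Lemma fpsP (f g : fps) : (forall n, coefs f n = coefs g n) <-> f = g.
Proof.
split=> [|-> //]; case: f g => [f] [g] /= fg.
by congr Fps; apply/funext.
Qed.

HB.instance Definition _ := gen_eqMixin fps.
HB.instance Definition _ := gen_choiceMixin fps.

Definition fps_const (c : rat) : fps := Fps (fun n => if n == 0%N then c else 0).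
Definition fps_add (f g : fps) : fps := Fps (fun n => coefs f n + coefs g n).
Definition fps_opp (f : fps) : fps := Fps (fun n => - coefs f n).
Definition fps_mul (f g : fps) : fps :=
  Fps (fun n => \sum_(i < n.+1) coefs f i * coefs g (n - i)%N).
Definition fps_scale (c : rat) (f : fps) : fps := Fps (fun n => c * coefs f n).

Lemma fps_addA : associative fps_add.
Proof. by move=> f g h; apply/fpsP => n /=; rewrite addrA. Qed.
Lemma fps_addC : commutative fps_add.
Proof. by move=> f g; apply/fpsP => n /=; rewrite addrC. Qed.
Lemma fps_add0 : left_id (fps_const 0) fps_add.
Proof. by move=> f; apply/fpsP => n /=; rewrite if_same add0r. Qed.
Lemma fps_addN : left_inverse (fps_const 0) fps_opp fps_add.
Proof. by move=> f; apply/fpsP => n /=; rewrite if_same addNr. Qed.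

HB.instance Definition _ :=
  GRing.isZmodule.Build fps fps_addA fps_addC fps_add0 fps_addN.

Definition fps_trunc (N : nat) (f : fps) : {poly rat} := \poly_(i < N) coefs f i.

Lemma coef_fps_mul N f g n : (n < N)%N ->
  coefs (fps_mul f g) n = (fps_trunc N f * fps_trunc N g)`_n.
Proof.
move=> nN; rewrite coefM /=; apply: eq_bigr => i _.
have iN : (i < N)%N by rewrite (leq_trans _ nN) // ltnS -ltnS.
by rewrite !coef_poly iN (leq_ltn_trans (leq_subr _ _) nN).
Qed.

Lemma coefM_eq (p q p' q' : {poly rat}) n :
  (forall i, (i <= n)%N -> p`_i = p'`_i) ->
  (forall i, (i <= n)%N -> q`_i = q'`_i) -> (p * q)`_n = (p' * q')`_n.
Proof.
move=> pp qq; rewrite !coefM; apply: eq_bigr => i _.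
by rewrite pp ?qq ?leq_subr // -ltnS.
Qed.

Lemma coef_trunc_mul N f g i : (i < N)%N ->
  (fps_trunc N (fps_mul f g))`_i = (fps_trunc N f * fps_trunc N g)`_i.
Proof. by move=> iN; rewrite coef_poly iN (coef_fps_mul _ _ iN). Qed.

Lemma fps_mulA : associative fps_mul.
Proof.
move=> f g h; apply/fpsP => n.
rewrite !(coef_fps_mul _ _ (ltnSn n)).
transitivity ((fps_trunc n.+1 f * (fps_trunc n.+1 g * fps_trunc n.+1 h))`_n).
  by apply: coefM_eq => // i ile; rewrite coef_trunc_mul.
by rewrite mulrA; apply: coefM_eq => // i ile; rewrite coef_trunc_mul.
Qed.

Lemma fps_mulC : commutative fps_mul.
Proof.
move=> f g; apply/fpsP => n.
by rewrite !(coef_fps_mul _ _ (ltnSn n)) mulrC.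
Qed.

Lemma fps_mul1 : left_id (fps_const 1) fps_mul.
Proof.
move=> f; apply/fpsP => n /=.
rewrite big_ord_recl /= mul1r subn0 big1 ?addr0 // => i _.
by rewrite mul0r.
Qed.

Lemma fps_mulDl : left_distributive fps_mul fps_add.
Proof.
move=> f g h; apply/fpsP => n /=.
by rewrite -big_split; apply: eq_bigr => i _; rewrite mulrDl.
Qed.

Lemma fps_1neq0 : fps_const 1 != 0.
Proof. by apply/eqP => /fpsP/(_ 0%N). Qed.

HB.instance Definition _ :=
  GRing.Zmodule_isComNzRing.Build fps
    fps_mulA fps_mulC fps_mul1 fps_mulDl fps_1neq0.

Lemma fps_scaleA a b f : fps_scale a (fps_scale b f) = fps_scale (a * b) f.
Proof. by apply/fpsP => n /=; rewrite mulrA. Qed.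
Lemma fps_scale1 : left_id 1 fps_scale.
Proof. by move=> f; apply/fpsP => n /=; rewrite mul1r. Qed.
Lemma fps_scaleDr : right_distributive fps_scale +%R.
Proof. by move=> c f g; apply/fpsP => n /=; rewrite mulrDr. Qed.
Lemma fps_scaleDl f : {morph fps_scale^~ f : a b / a + b}.
Proof. by move=> a b; apply/fpsP => n /=; rewrite mulrDl. Qed.

HB.instance Definition _ :=
  GRing.Zmodule_isLmodule.Build rat fps
    fps_scaleA fps_scale1 fps_scaleDr fps_scaleDl.

Definition fps_t : fps := Fps (fun n => if n == 1%N then 1 else 0).

(* The series of formal power series [\sum_(n >= 0) F n] converges to [S] in the
   t-adic topology: each coefficient of the partial sums is eventually constant. *)
Definition fps_series_to (F : nat -> fps) (S : fps) : Prop :=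
  forall k, exists N, forall M, (N <= M)%N ->
    coefs (\sum_(n < M) F n) k = coefs S k.

Definition R_equation (R : fps) : Prop :=
  coefs R 0 = 0 /\
  fps_series_to
    (fun n => (n.+1%:R^-1 * 'C(2 * n, n)%:R * 'C(3 * n, n)%:R) *: R ^+ n.+1)
    fps_t.

Definition Q_series : fps :=
  Fps (fun n => if n == 0%N then 0 else (quartic_peo_count n)%:R).

(* Main.v *)
(* Replace the root of a quartic Eulerian orientation by a boundary vertex labelled by a cyclic
   word of ingoing and outgoing darts, and peel one boundary dart at a time: either its edge ends
   on the boundary, which cuts the map in two because Euler's inequality forbids handles, or its
   other end lies on a quartic vertex, which is absorbed into the boundary.  This recursion
   determines a family of series indexed by boundary words.

   Quartic vertices split into pairs of cubic vertices joined by an undirected edge.  With weights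
   built from [zeta], a root of [zeta ^+ 2 = zeta - 1], the cubic recursion is still invariant under
   rotation of the boundary word, and it restricts to the quartic one on words without undirected
   edges.  Words with at most two directed letters then give a closed system for series in one
   catalytic variable [u].  For arguments [u], [(1 - zeta)(1 - u)] and [1 - zeta u] these series
   satisfy quadratic relations, and a suitable difference [eta] of two of them, with
   [v = zeta (1 - u)], makes [eta (u - eta) (v + eta)] a rational function of [u] without poles.
   Its value at infinity is [t - 3 t^2 (1 + Q(t))], which is therefore [R]; solving for [eta] by
   Lagrange inversion and taking residues at [u = 0] gives the equation of [R]. *)

From HB Require Import structures.
Require Import Defs.
From mathcomp Require Import all_boot all_order all_fingroup all_algebra algC.
From mathcomp Require Import boolp zify ring lra.
Set Implicit Arguments.
Unset Strict Implicit.
Unset Printing Implicit Defensive.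

Import GRing.Theory.

(** * Euler's inequality *)

(** The root [zeta] is a primitive sixth root of unity, so that [zeta] and [1 - zeta] have sum 1 and
    product 1. The two ways of opening an alternating quartic vertex into cubic ones weigh [zeta]
    and [1 - zeta], the only way of opening a non-alternating one weighs [zeta * (1 - zeta)]; hence
    each quartic vertex counts once. Peeling cuts maps into pieces, yet planarity must stay visible.
    It is stated as equality in an inequality valid for all pairs of permutations, with one term per
    boundary cycle, which controls connectedness and genus of all pieces at once. Isomorphism
    classes stay out of the recursion: darts are labelled, and a rooted connected map has no
    automorphism, so that passing to classes divides by a factorial. Nothing is expanded as a
    Laurent series in [u]. Each power of the vertex variable has a rational function of [u] as
    coefficient; poles, value at infinity and residue are statements about fractions of polynomials,
    and constancy follows from a version of Liouville's theorem. *)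

Section Euler.
Local Open Scope nat_scope.
Variable D : finType.
Implicit Types (s t a : {perm D}) (C S : {set D}).

Definition stable s C := {in C, forall z, s z \in C}.

(** [S] meets every orbit of the group generated by [s] and [t], that is, every connected component
    of the map. *)
Definition covers s t S :=
  forall C, S \subset C -> stable s C -> stable t C -> C = setT.

Lemma stableP s C : stable s C -> forall z, (s z \in C) = (z \in C).
Proof.
move=> sC z; have inj := @perm_inj _ s.
have sub : s @: C \subset C by apply/subsetP => _ /imsetP [w wC ->]; exact: sC.
have /eqP E : s @: C == C by rewrite eqEcard sub (card_imset _ inj) leqnn.
by rewrite -{1}E (mem_imset _ _ inj).
Qed.

Lemma stable_porbit s C x : stable s C -> x \in C -> porbit s x \subset C.
Proof.
move=> sC xC; apply/subsetP => _ /porbitP [i ->].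
elim: i => [|i IH]; first by rewrite perm1.
by rewrite expgSr permM; apply: sC.
Qed.

Lemma stable_tperm x y C : (x \in C) = (y \in C) -> stable (tperm x y) C.
Proof. by move=> xy z zC; case: tpermP => [E|E|//]; rewrite ?xy -?E // -?xy -?E. Qed.

Lemma stableM s t C : stable s C -> stable t C -> stable (s * t)%g C.
Proof. by move=> sC tC z zC; rewrite permM; apply/tC/sC. Qed.

Lemma porbit_step s w z : (s z \in porbit s w) = (z \in porbit s w).
Proof. by have := porbit_perm s 1 z; rewrite expg1 -!eq_porbit_mem => ->. Qed.

Lemma covers1 s S : covers s 1 S -> #|porbits s| <= #|S|.
Proof.
move=> cov; pose C := [set z | [exists w in S, z \in porbit s w]].
have E : C = setT.
  apply: cov => [|z|z]; last by rewrite perm1.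
    by apply/subsetP => z zS; rewrite inE; apply/existsP; exists z; rewrite zS porbit_id.
  rewrite !inE => /existsP [w /andP [wS zw]]; apply/existsP; exists w; rewrite wS /=.
  by rewrite porbit_step.
apply: (@leq_trans #|porbit s @: S|); last exact: leq_imset_card.
apply/subset_leq_card/subsetP => _ /imsetP [z _ ->].
have : z \in C by rewrite E.
rewrite inE => /existsP [w /andP [wS zw]]; apply/imsetP; exists w => //.
by apply/eqP; rewrite eq_porbit_mem.
Qed.

Lemma stable_tpermM x y s C :
  (x \in C) = (y \in C) -> stable (tperm x y * s)%g C -> stable s C.
Proof.
move=> xy sC; have -> : s = (tperm x y * (tperm x y * s))%g by rewrite mulgA tperm2 mul1g.
exact: stableM (stable_tperm xy) sC.
Qed.

Lemma stable_Mtperm x y s C :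
  (x \in C) = (y \in C) -> stable (s * tperm x y)%g C -> stable s C.
Proof.
move=> xy sC; have -> : s = (s * tperm x y * tperm x y)%g by rewrite -mulgA tperm2 mulg1.
exact: stableM sC (stable_tperm xy).
Qed.

Lemma porbits_split s x y : x != y -> x \in porbit s y ->
  #|porbits (tperm x y * s)%g| = #|porbits s|.+1.
Proof. by move=> xy xs; have := porbits_mul_tperm s x y; rewrite xs xy /= addn0 addn1. Qed.

Lemma porbits_merge s x y : x \notin porbit s y ->
  #|porbits (tperm x y * s)%g|.+1 = #|porbits s| /\ x \in porbit (tperm x y * s)%g y.
Proof.
move=> xs; have xy : x != y by apply: contraNneq xs => ->; exact: porbit_id.
have := porbits_mul_tperm s x y; have := porbits_mul_tperm (tperm x y * s)%g x y.
rewrite /= mulgA tperm2 mul1g xs xy /= addn1; case: (x \in _) => /=; lia.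
Qed.

Lemma leq_porbits s : #|porbits s| <= #|D|.
Proof. exact: leq_imset_card. Qed.

(* Removing a transposition [(x y)] from [t] joins two cycles of [s], or splits one; in the second
   case the covering may be lost, but adding [x] or [y] to [S] restores it. *)
Lemma euler_leq s t S : covers s t S ->
  #|porbits s| + #|porbits t| + #|porbits (t * s)%g| <= #|D| + #|S|.*2.
Proof.
have [n] := ubnP (#|D| - #|porbits t|); elim: n s t S => // n IH s t S.
have [->|/eqP t1] := eqVneq t 1%g.
  move=> _ /covers1 cS.
  rewrite mul1g; suff : #|porbits (1 : {perm D})%g| <= #|D| by lia.
  by exact: leq_porbits.
have [x tx] : exists x, t x != x.
  apply/existsP; apply: contra_notT t1; rewrite negb_exists => /forallP h.
  by apply/permP => x; rewrite perm1; apply/eqP; have := h x; rewrite negbK.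
move=> lt cov; pose y := t x; pose s' := (tperm x y * s)%g; pose t' := (t * tperm x y)%g.
have xy : x != y by rewrite eq_sym.
have ts' : (t' * s' = t * s)%g by rewrite /t' /s' mulgA -(mulgA t) tperm2 mulg1.
have ct : #|porbits t'| = #|porbits t|.+1.
  rewrite -(porbitsV t') -(porbitsV t) /t' invMg tpermV porbits_split // porbitV.
  by rewrite -porbit_step porbit_sym -/y porbit_id.
have : #|porbits t'| <= #|D| by exact: leq_porbits.
rewrite ct => ltD.
have {}IH S' : covers s' t' S' ->
    #|porbits s'| + #|porbits t|.+1 + #|porbits (t * s)%g| <= #|D| + #|S'|.*2.
  by rewrite -ct -ts'; apply: IH; rewrite ct; lia.
have cov' C : (x \in C) = (y \in C) -> S \subset C -> stable s' C -> stable t' C -> C = setT.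
  move=> xyC SC /(stable_tpermM xyC) sC /(stable_Mtperm xyC) tC; exact: cov.
have [xs|xs] := boolP (x \in porbit s y); last first.
  have [cs xs'] := porbits_merge xs.
  have := IH S; rewrite -cs -/s'; suff h : covers s' t' S by move=> /(_ h); lia.
  move=> C SC sC tC; apply: cov' => //.
  by apply/idP/idP => h; apply: (subsetP (stable_porbit sC h)); rewrite // porbit_sym.
suff [z cz] : exists z, covers s' t' (z |: S).
  have := IH _ cz; rewrite porbits_split // cardsU1; case: (z \in S) => /=; lia.
(* If neither [x] nor [y] helps, there are proper stable sets containing [S], one with [x] but not
   [y], the other with [y] but not [x]. Their intersection contains neither point, so it is stable
   under the old permutations as well, against [cov]. *)
apply: contrapT => nz.
have ncov z : exists C, [/\ z |: S \subset C, stable s' C, stable t' C & C != setT].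
  apply: contrapT => h; apply: nz; exists z => C SC sC tC.
  by apply/eqP; apply: contraT => CT; case: h; exists C.
have [C1 [C1S s1 t1' n1]] := ncov x; have [C2 [C2S s2 t2 n2]] := ncov y.
have xC1 : x \in C1 by apply: (subsetP C1S); rewrite setU11.
have yC2 : y \in C2 by apply: (subsetP C2S); rewrite setU11.
have SC1 : S \subset C1 by apply: subset_trans (subsetUr _ _) C1S.
have SC2 : S \subset C2 by apply: subset_trans (subsetUr _ _) C2S.
have yC1 : y \notin C1.
  by apply: contra n1 => yC1; apply/eqP/cov' => //; rewrite xC1 yC1.
have xC2 : x \notin C2.
  by apply: contra n2 => xC2; apply/eqP/cov' => //; rewrite xC2 yC2.
have : C1 :&: C2 = setT.
  apply: cov'; first by rewrite !inE (negPf yC1) (negPf xC2) andbF.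
  - by rewrite subsetI SC1.
  - by move=> z; rewrite !inE => /andP [/s1 -> /s2 ->].
  - by move=> z; rewrite !inE => /andP [/t1' -> /t2 ->].
by move/setP/(_ x); rewrite !inE xC1 (negPf xC2).
Qed.
End Euler.

(** * Peeling a map *)

Section Peeling.
Local Open Scope nat_scope.
Variable D : finType.
Implicit Types (s t a : {perm D}) (C S O P Q Z : {set D}) (L : seq (seq D)) (l : seq D).

Lemma path_tperm s x y z l w : x \notin z :: l -> y \notin z :: l ->
  path (frel (tperm x y * s)%g) z (rcons l w) = path (frel s) z (rcons l w).
Proof.
elim: l z => [|z' l IH] z; rewrite in_cons negb_or => /andP [xz xl];
  rewrite in_cons negb_or => /andP [yz yl] /=; rewrite permM tpermD // 1?eq_sym //.
by rewrite IH.
Qed.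

Lemma path_tperml s x y l w : x \notin l -> y \notin l ->
  path (frel (tperm x y * s)%g) x (rcons l w) = path (frel s) y (rcons l w).
Proof. by case: l => [|z l] xl yl /=; rewrite permM tpermL // path_tperm. Qed.

Lemma path_tpermr s x y l w : x \notin l -> y \notin l ->
  path (frel (tperm x y * s)%g) y (rcons l w) = path (frel s) x (rcons l w).
Proof. by move=> xl yl; rewrite tpermC path_tperml. Qed.

Lemma fcycle_tperm s x y l : x \notin l -> y \notin l ->
  fcycle (tperm x y * s)%g l = fcycle s l.
Proof. by case: l => // z l xl yl; rewrite /= path_tperm. Qed.

Lemma fcycle_split s x y l1 l2 : uniq (x :: l1 ++ y :: l2) ->
  fcycle s (x :: l1 ++ y :: l2) =
  fcycle (tperm x y * s)%g (x :: l2) && fcycle (tperm x y * s)%g (y :: l1).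
Proof.
have -> : uniq (x :: l1 ++ y :: l2) = uniq ([:: x; y] ++ l1 ++ l2).
  by apply: perm_uniq; rewrite /= perm_cons -cat1s perm_catCA.
rewrite /= !inE !mem_cat !negb_or => /and3P [/and3P [xy xl1 xl2] /andP [yl1 yl2] _].
rewrite [LHS]/= rcons_cat cat_path rcons_cons /=.
rewrite [RHS]/= path_tperml // path_tpermr // (rcons_path _ _ l1).
by rewrite andbA andbC.
Qed.

(* [L] lists the vertices of arbitrary degree, [P] their outgoing darts, and the darts in [Z] are
   dead, i.e. belong to no edge; the other vertices are quartic and balanced.  Together,
   [config_covers] and [config_euler] force one planar component for each cycle of [L]. *)
Record config L Z P (m : {perm D} * {perm D} * {set D}) : Prop := Config {
  config_cycle : all (fcycle m.1.1) L;
  config_vertex : forall x, x \notin flatten L ->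
    #|porbit m.1.1 x| = 4 /\ #|porbit m.1.1 x :&: m.2| = 2;
  config_invol : involutive m.1.2;
  config_dead : forall x, (m.1.2 x == x) = (x \in Z);
  config_orient : forall x, x \notin Z -> (m.1.2 x \in m.2) = (x \notin m.2);
  config_sign : forall x, x \in flatten L -> (x \in m.2) = (x \in P);
  config_covers : covers m.1.1 m.1.2 [set x in flatten L];
  config_euler : #|porbits m.1.1| + #|porbits m.1.2| + #|porbits (m.1.2 * m.1.1)%g|
     = #|D| + (size L).*2 }.

(* Kills [x] and [y = a x], and splits or merges their vertices so that the face permutation
   [a * s] does not change. *)
Definition peel x y (m : {perm D} * {perm D} * {set D}) :=
  ((tperm x y * m.1.1)%g, (m.1.2 * tperm x y)%g, m.2).

Lemma peelK x y : involutive (peel x y).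
Proof. by case=> [[s a] O]; rewrite /peel /= mulgA tperm2 mul1g -mulgA tperm2 mulg1. Qed.

Lemma fcycle_mem s l : fcycle s l -> {in l, forall z, s z \in l}.
Proof.
move=> sl z zl; have [i p E] := rot_to zl; rewrite -(mem_rot i) E.
move: sl; rewrite -(rot_cycle i) E.
by case: p {E} => [|z' p] /= /andP [/eqP ->]; rewrite !inE eqxx ?orbT.
Qed.

Lemma fcycle_porbit s l x : fcycle s l -> x \in l -> porbit s x =i l.
Proof.
move=> sl xl z; apply/idP/idP => [|zl].
  have sS : stable s [set w in l] by move=> w; rewrite !inE => /(fcycle_mem sl).
  have xS : x \in [set w in l] by rewrite inE.
  by move=> /(subsetP (stable_porbit sS xS)); rewrite inE.
have [i p E] := rot_to xl; move: zl; rewrite -(mem_rot i) E => zp.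
move: sl; rewrite -(rot_cycle i) E => /fpathP [n En].
have : z \in traject s x n.+1.
  by rewrite trajectS -En in_cons mem_rcons in_cons; move: zp; rewrite inE orbA orbb.
by case/trajectP => j _ ->; rewrite -permX mem_porbit.
Qed.

Lemma stable_flatten s L : all (fcycle s) L -> stable s [set z in flatten L].
Proof.
move=> /allP sL z; rewrite !inE => /flattenP [l lL zl].
by apply/flattenP; exists l => //; apply: fcycle_mem zl; apply: sL.
Qed.

Lemma eq_porbit s t C x : stable s C -> x \in C -> {in C, s =1 t} ->
  porbit s x = porbit t x.
Proof.
move=> sC xC st; apply/setP => z.
suff E i : (s ^+ i)%g x = (t ^+ i)%g x /\ (s ^+ i)%g x \in C.
  by apply/porbitP/porbitP => [] [i ->]; exists i; case: (E i).
elim: i => [|i [E1 E2]]; first by rewrite !perm1.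
by rewrite !expgSr !permM; split; [rewrite -E1 st | exact: sC].
Qed.

Lemma stableC s C : stable s C -> stable s (~: C).
Proof. by move=> sC z; rewrite !inE (stableP sC). Qed.

Lemma porbit_tperm s x y L z : all (fcycle s) L -> x \in flatten L -> y \in flatten L ->
  z \notin flatten L -> porbit (tperm x y * s)%g z = porbit s z.
Proof.
move=> /stable_flatten/stableC sL xL yL zL; symmetry.
apply: (eq_porbit sL); first by rewrite !inE.
by move=> w; rewrite !inE permM => wL; rewrite tpermD //; apply: contraNneq wL => <-.
Qed.

Lemma porbits_splitr a x y : x != y -> x \in porbit a y ->
  #|porbits (a * tperm x y)%g| = #|porbits a|.+1.
Proof.
move=> xy xa; rewrite -(porbitsV (a * _)%g) -(porbitsV a) invMg tpermV porbits_split //.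
by rewrite porbitV.
Qed.

Definition pairing_off Z a := involutive a /\ forall z, (a z == z) = (z \in Z).
Definition orient_off Z a O := forall z, z \notin Z -> (a z \in O) = (z \notin O).

Lemma pairing_peel Z a x y : x \notin Z -> y \notin Z -> x != y ->
  (pairing_off Z a /\ a x = y) <-> pairing_off (x |: (y |: Z)) (a * tperm x y)%g.
Proof.
move=> xZ yZ xy; split=> [[[aK aZ] ax]|[aK aZ]].
  have ay : a y = x by rewrite -ax aK.
  have aD z : z != x -> z != y -> (a * tperm x y)%g z = a z.
    move=> zx zy; rewrite permM tpermD //.
      by apply: contraNneq zy => E; rewrite -ax E aK.
    by apply: contraNneq zx => E; rewrite -ay E aK.
  have a'x : (a * tperm x y)%g x = x by rewrite permM ax tpermR.
  have a'y : (a * tperm x y)%g y = y by rewrite permM ay tpermL.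
  split=> z.
    have [->|zx] := eqVneq z x; first by rewrite !a'x.
    have [->|zy] := eqVneq z y; first by rewrite !a'y.
    rewrite (aD z) // aD ?aK //.
      by rewrite -[X in _ != X]ay (inj_eq perm_inj).
    by rewrite -[X in _ != X]ax (inj_eq perm_inj).
  rewrite !inE; have [->|zx] := eqVneq z x; first by rewrite a'x eqxx.
  have [->|zy] := eqVneq z y; first by rewrite a'y eqxx.
  by rewrite aD // aZ.
have a'x : a x = y.
  by apply: (@perm_inj _ (tperm x y)); rewrite -permM tpermR; apply/eqP; rewrite aZ !inE eqxx.
have a'y : a y = x.
  by apply: (@perm_inj _ (tperm x y)); rewrite -permM tpermL; apply/eqP; rewrite aZ !inE eqxx orbT.
have aD z : z != x -> z != y -> (a * tperm x y)%g z = a z.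
  move=> zx zy; rewrite permM tpermD //.
    by rewrite -a'y (inj_eq perm_inj) eq_sym.
  by rewrite -a'x (inj_eq perm_inj) eq_sym.
do 2!split=> //.
  move=> z; have [->|zx] := eqVneq z x; first by rewrite a'x.
  have [->|zy] := eqVneq z y; first by rewrite a'y.
  have := aK z; rewrite (aD z) // aD //.
    by rewrite -[X in _ != X]a'y (inj_eq perm_inj).
  by rewrite -[X in _ != X]a'x (inj_eq perm_inj).
move=> z; have [->|zx] := eqVneq z x; first by rewrite a'x eq_sym (negPf xy) (negPf xZ).
have [->|zy] := eqVneq z y; first by rewrite a'y (negPf xy) (negPf yZ).
by rewrite -aD // aZ !inE (negPf zx) (negPf zy).
Qed.

Lemma orient_peel Z a O x y : x \notin Z -> y \notin Z -> involutive a -> a x = y ->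
  orient_off Z a O <->
  ((y \in O) = (x \notin O) /\ orient_off (x |: (y |: Z)) (a * tperm x y)%g O).
Proof.
move=> xZ yZ aK ax; have ay : a y = x by rewrite -ax aK.
have aD z : z != x -> z != y -> (a * tperm x y)%g z = a z.
  move=> zx zy; rewrite permM tpermD //.
    by apply: contraNneq zy => E; rewrite -ax E aK.
  by apply: contraNneq zx => E; rewrite -ay E aK.
split=> [h|[yO h] z zZ].
  split=> [|z]; first by rewrite -ax h.
  by rewrite !inE !negb_or => /and3P [zx zy zZ]; rewrite aD // h.
have [->|zx] := eqVneq z x; first by rewrite ax.
have [->|zy] := eqVneq z y; first by rewrite ay yO negbK.
by rewrite -aD // h // !inE !negb_or zx zy.
Qed.

Lemma fcycle_split_all s x y l1 l2 L : uniq (flatten ((x :: l1 ++ y :: l2) :: L)) ->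
  all (fcycle s) ((x :: l1 ++ y :: l2) :: L) =
  all (fcycle (tperm x y * s)%g) ((x :: l2) :: (y :: l1) :: L).
Proof.
rewrite -[flatten _]/((x :: l1 ++ y :: l2) ++ flatten L) cat_uniq => /and3P [ul /hasPn dis _].
set t := (tperm x y * s)%g.
rewrite -[LHS]/(fcycle s (x :: l1 ++ y :: l2) && all (fcycle s) L).
rewrite -[RHS]/(fcycle t (x :: l2) && (fcycle t (y :: l1) && all (fcycle t) L)).
rewrite (fcycle_split _ ul) -andbA -/t; congr [&& _, _ & _].
apply: eq_in_all => l lL; rewrite /t fcycle_tperm //; apply/negP => zl.
  by have /dis : x \in flatten L; [apply/flattenP; exists l | rewrite /= mem_head].
have /dis : y \in flatten L; [by apply/flattenP; exists l | rewrite /=].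
by rewrite inE mem_cat mem_head !orbT.
Qed.

(** Killing the edge adds one cycle to [s] and one to [a] and leaves the faces alone, while [L]
    gains one cycle: both sides of the Euler equality grow by two. *)
Lemma config_split x y l1 l2 L Z P m : uniq (flatten ((x :: l1 ++ y :: l2) :: L)) ->
  x \notin Z -> y \notin Z -> (y \in P) = (x \notin P) ->
  (config ((x :: l1 ++ y :: l2) :: L) Z P m /\ m.1.2 x = y) <->
  config ((x :: l2) :: (y :: l1) :: L) (x |: (y |: Z)) P (peel x y m).
Proof.
case: m => [[s a] O] uL xZ yZ yP.
set L1 := (_ :: L) in uL *; set L2 := [:: _, _ & L].
have mL : flatten L2 =i flatten L1.
  move=> z; rewrite /L1 /L2 /= !(inE, mem_cat).
  by case: (z == x); case: (z == y); case: (z \in l1); case: (z \in l2) => /=;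
    rewrite ?orbT ?orbF.
have xL : x \in flatten L1 by rewrite mem_head.
have yL : y \in flatten L1 by rewrite /L1 /= !(inE, mem_cat) eqxx !orbT.
have BL : [set z in flatten L2] = [set z in flatten L1] by apply/setP => z; rewrite 2!in_set mL.
have xy : x != y.
  by apply: contraTneq uL => E; rewrite /L1 E /= !(inE, mem_cat) eqxx !orbT.
have cyc : all (fcycle s) L1 = all (fcycle (tperm x y * s)%g) L2 by apply: fcycle_split_all.
have cov : covers s a [set z in flatten L1] <->
    covers (tperm x y * s)%g (a * tperm x y)%g [set z in flatten L1].
  split=> cov C BC sC aC; have xyC : (x \in C) = (y \in C)
    by rewrite !(subsetP BC) // inE.
    by apply: cov => //; [exact: stable_tpermM sC | exact: stable_Mtperm aC].
  apply: cov => //; first exact: stableM (stable_tperm xyC) sC.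
  exact: stableM aC (stable_tperm xyC).
have vert : all (fcycle s) L1 -> forall z, z \notin flatten L1 ->
   porbit (tperm x y * s)%g z = porbit s z by move=> sL z; apply: porbit_tperm.
have Eul : all (fcycle s) L1 -> a x = y -> involutive a ->
    #|porbits (tperm x y * s)%g| = #|porbits s|.+1 /\
    #|porbits (a * tperm x y)%g| = #|porbits a|.+1.
  move=> /andP [sl _] ax aK; split.
    apply: porbits_split => //; rewrite (fcycle_porbit sl) ?mem_head //.
    by rewrite !(inE, mem_cat) eqxx !orbT.
  by apply: porbits_splitr => //; rewrite -ax porbit_sym porbit_step porbit_id.
have aa : (a * tperm x y * (tperm x y * s) = a * s)%g.
  by rewrite mulgA -(mulgA a) tperm2 mulg1.
split=> [[c /= ax]|c].
  case: c => /= c1 c2 c3 c4 c5 c6 c7 c8.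
  have [a3 a4] : pairing_off (x |: (y |: Z)) (a * tperm x y)%g.
    by apply/pairing_peel; do ?split.
  have [_ a5] := (orient_peel O xZ yZ c3 ax).1 c5.
  have [e1 e2] := Eul c1 ax c3.
  split=> //.
  - by rewrite -cyc.
  - by move=> z; rewrite mL => zL /=; rewrite vert //; apply: c2.
  - by move=> z; rewrite mL => zL; rewrite c6.
  - by rewrite BL; exact/cov.
  - by move: c8; rewrite /= e1 e2 aa !doubleS !addnS !addSn => ->.
case: c => /= c1 c2 c3 c4 c5 c6 c7 c8.
have sL : all (fcycle s) L1 by rewrite cyc.
have [[a3 a4] ax] : pairing_off Z a /\ a x = y by apply/pairing_peel.
have [e1 e2] := Eul sL ax a3.
split=> //; split=> //=.
- by move=> z zL; rewrite -vert //; apply: c2; rewrite mL.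
- by apply/(orient_peel O xZ yZ a3 ax); split=> //; rewrite !c6 ?mL.
- by move=> z zL; rewrite c6 ?mL.
- by apply/cov; rewrite -BL.
- by move: c8; rewrite /= e1 e2 aa !doubleS !addnS !addSn => - [->].
Qed.

Lemma config_sameside L Z P m x : config L Z P m -> x \in flatten L -> x \notin Z ->
  m.1.2 x \in flatten L -> (m.1.2 x \in P) = (x \notin P).
Proof.
case: m => [[s a] O] [/= _ _ _ _ c5 c6 _ _] xL xZ yL.
by rewrite -!c6 // c5.
Qed.

(* Otherwise the remaining boundary cycles would already cover the map, against
   the Euler inequality. *)
Lemma config_samecycle l L Z P m x : uniq (flatten (l :: L)) -> all (fun l => l != [::]) (l :: L) ->
  config (l :: L) Z P m -> x \in l -> m.1.2 x \notin flatten L.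
Proof.
case: m => [[s a] O] uL nL [/= /andP [sl sL] _ _ _ _ _ c7 c8] xl; apply/negP => yL.
have [l' l'L yl'] := flattenP yL.
pose hd (l : seq D) := head x l.
(* One dart for each cycle except [l'], whose darts are reached from [l] through the edge of [x]. *)
pose S := [set z in [seq hd l'' | l'' <- l :: rem l' L]].
have nl'L : all (fun l => l != [::]) (l :: rem l' L).
  move: nL => /= /andP [-> /allP nL] /=; apply/allP => l'' /mem_rem; exact: nL.
have inC C l'' : fcycle s l'' -> stable s C -> forall z, z \in l'' -> z \in C -> {subset l'' <= C}.
  move=> sl'' sC z zl zC w; rewrite -(fcycle_porbit sl'' zl).
  exact: (subsetP (stable_porbit sC zC)).
have cov : covers s a S.
  move=> C SC sC aC; apply: c7 => //.
  have sub l'' : l'' \in l :: rem l' L -> fcycle s l'' -> {subset l'' <= C}.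
    move=> h sl''; have nl'' := allP nl'L _ h.
    have z0 : hd l'' \in l'' by case: (l'') nl'' => //= z p _; rewrite mem_head.
    apply: (inC _ _ sl'' sC _ z0); apply: (subsetP SC).
    by rewrite inE; apply/mapP; exists l''.
  have lC : {subset l <= C} by apply: sub; rewrite ?mem_head.
  have yC : a x \in C by apply/aC/lC.
  have l'C : {subset l' <= C} := inC _ _ (allP sL _ l'L) sC _ yl' yC.
  apply/subsetP => z; rewrite inE mem_cat => /orP [/lC //|/flattenP [l'' l''L zl'']].
  move: (l''L); rewrite (perm_mem (perm_to_rem l'L)) inE => /orP [/eqP E|h].
    by apply: l'C; rewrite -E.
  by apply: (sub l'') => //; [rewrite inE h orbT | exact: (allP sL)].
have := euler_leq cov; rewrite c8 leqNgt ltn_add2l ltn_double => /negP; apply.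
apply: leq_ltn_trans (_ : _ <= size (l :: rem l' L)) _.
  rewrite -(size_map hd); apply: leq_trans (card_size _); apply: subset_leq_card.
  by apply/subsetP => z; rewrite inE.
by rewrite /= size_rem // ltnS; case: (L) l'L => //= *; rewrite ltnSn.
Qed.

Lemma config_eq L L' Z P m : (forall s, all (fcycle s) L = all (fcycle s) L') ->
  flatten L =i flatten L' -> size L = size L' -> config L Z P m -> config L' Z P m.
Proof.
move=> EL E sL; have B : [set z in flatten L'] = [set z in flatten L].
  by apply/setP => z; rewrite 2!in_set E.
case=> c1 c2 c3 c4 c5 c6 c7 c8; split; rewrite -?EL -?sL ?B //.
- by move=> z; rewrite -E; apply: c2.
- by move=> z; rewrite -E; apply: c6.
Qed.

Lemma config_rot n l L Z P m : config (rot n l :: L) Z P m <-> config (l :: L) Z P m.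
Proof.
have E : flatten (rot n l :: L) =i flatten (l :: L).
  by move=> z; rewrite -[flatten (rot n l :: L)]/(rot n l ++ flatten L) mem_cat mem_rot -mem_cat.
by split; apply: config_eq => // s; rewrite /= rot_cycle.
Qed.

Lemma config_perm L L' Z P m : perm_eq L L' -> config L Z P m <-> config L' Z P m.
Proof.
suff h L1 L2 : perm_eq L1 L2 -> config L1 Z P m -> config L2 Z P m.
  by move=> LL'; split; apply: h; rewrite // perm_sym.
move=> LL'; apply: config_eq.
- by move=> s; rewrite (perm_all _ LL').
- exact/perm_mem/perm_flatten.
- exact: perm_size.
Qed.

Lemma porbit4 s y : #|porbit s y| = 4 -> fcycle s [:: y; s y; s (s y); s (s (s y))].
Proof. by move=> E; have := iter_porbit s y; rewrite E /= !eqxx => ->; rewrite eqxx. Qed.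

(** Absorbing the vertex of [y] removes one cycle of [s] and adds one to [a], so that the Euler
    equality persists with the same number of boundary cycles. The signs [Q] of the absorbed darts
    become boundary data. *)
Lemma config_merge x y y1 y2 y3 l L Z P Q m :
  let V := [:: y; y1; y2; y3] in
  uniq (V ++ flatten ((x :: l) :: L)) -> x \notin Z -> y \notin Z ->
  P \subset flatten ((x :: l) :: L) -> Q \subset V -> #|Q| = 2 ->
  (y \in Q) = (x \notin P) ->
  (config ((x :: l) :: L) Z P m /\
    [/\ m.1.2 x = y, m.1.1 y = y1, m.1.1 y1 = y2, m.1.1 y2 = y3 & m.2 :&: [set z in V] = Q])
  <-> config ((x :: [:: y1; y2; y3] ++ y :: l) :: L) (x |: (y |: Z)) (P :|: Q) (peel x y m).
Proof.
case: m => [[s a] O]; set L1 := (_ :: L); set L2 := (_ :: L).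
move=> V uL xZ yZ /subsetP PL /subsetP QV Q2 yP.
have mL : flatten L2 =i V ++ flatten L1.
  move=> z; rewrite /L1 /L2 /= !(inE, mem_cat).
  by case: (z == x); case: (z == y); case: (z == y1); case: (z == y2); case: (z == y3);
    rewrite //= ?orbT.
have [uV dVL uL1] := and3P (etrans (esym (cat_uniq _ _)) uL).
have VL z : z \in V -> z \notin flatten L1.
  by move=> zV; apply: contra dVL => zL; apply/hasP; exists z.
have LV z : z \in flatten L1 -> z \notin V by apply: contraTN => /VL.
have uL2 : uniq (flatten L2).
  rewrite -(@perm_uniq _ (V ++ flatten L1)) //; apply/seq.permP => p.
  by rewrite /L1 /L2 /= !count_cat /=; clear; lia.
have xL : x \in flatten L1 by rewrite mem_head.
have yV : y \in V by rewrite mem_head.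
have xL2 : x \in flatten L2 by rewrite mem_head.
have yL2 : y \in flatten L2 by rewrite mL mem_cat yV.
have xy : x != y by apply: contraTneq (VL _ yV) => <-; rewrite negbK.
pose t := (tperm x y * s)%g.
have tt : (tperm x y * t = s)%g by rewrite /t mulgA tperm2 mul1g.
have cyc : all (fcycle t) L2 = all (fcycle s) L1 && fcycle s V.
  rewrite (fcycle_split_all _ uL2) tt -[all _ L1]/(fcycle s (x :: l) && all (fcycle s) L).
  rewrite -[LHS]/(fcycle s (x :: l) && (fcycle s V && all (fcycle s) L)).
  by rewrite -andbA [X in _ = _ && X]andbC.
have aa : (a * tperm x y * t = a * s)%g by rewrite mulgA -(mulgA a) tperm2 mulg1.
have stV : fcycle s V -> forall C, stable s C -> y \in C -> {subset V <= C}.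
  move=> sV C sC yC z; rewrite -(fcycle_porbit sV yV).
  exact: (subsetP (stable_porbit sC yC)).
have cov : fcycle s V -> a x = y -> covers s a [set z in flatten L1] <->
    covers t (a * tperm x y)%g [set z in flatten L2].
  move=> sV ax; split=> cov C /subsetP BC sC aC.
    have xyC : (x \in C) = (y \in C) by rewrite !BC // inE.
    apply: cov; [|exact: stable_tpermM sC | exact: stable_Mtperm aC].
    by apply/subsetP => z; rewrite inE => zL; apply: BC; rewrite inE mL mem_cat zL orbT.
  have xC : x \in C by apply: BC; rewrite inE.
  have yC : y \in C by rewrite -ax; apply: aC.
  have xyC : (x \in C) = (y \in C) by rewrite xC yC.
  apply: cov; [|exact: stableM (stable_tperm xyC) sC | exact: stableM aC (stable_tperm xyC)].
  apply/subsetP => z; rewrite inE mL mem_cat => /orP [/(stV sV _ sC yC) //|zL].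
  by apply: BC; rewrite inE.
have vert : all (fcycle t) L2 -> forall z, z \notin flatten L2 -> porbit s z = porbit t z.
  by move=> tL z zL; rewrite -tt; apply: porbit_tperm zL.
have Eul : all (fcycle s) L1 -> fcycle s V -> a x = y -> involutive a ->
    #|porbits s| = #|porbits t|.+1 /\
    #|porbits (a * tperm x y)%g| = #|porbits a|.+1.
  move=> sL sV ax aK; split.
    have xs : x \notin porbit s y by rewrite (fcycle_porbit sV yV) LV.
    by have [-> _] := porbits_merge xs.
  by apply: porbits_splitr => //; rewrite -ax porbit_sym porbit_step porbit_id.
have sz : size L1 = size L2 by [].
have PQ z : z \in V -> (z \in P :|: Q) = (z \in Q).
  by move=> zV; rewrite inE; case: (boolP (z \in P)) => // /PL zL; case/negP: (VL _ zV).
have PQ' z : z \in flatten L1 -> (z \in P :|: Q) = (z \in P).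
  by move=> zL; rewrite inE; case: (boolP (z \in Q)) => [/QV zV|]; [case/negP: (VL _ zV)|rewrite orbF].
split=> [[c [/= ax sy sy1 sy2 OV]]|c].
  case: c => /= c1 c2 c3 c4 c5 c6 c7 c8.
  have OQ z : z \in V -> (z \in O) = (z \in Q) by move=> zV; rewrite -OV in_setI in_set zV andbT.
  have sV : fcycle s V.
    have [o4 _] := c2 _ (VL _ yV); have := porbit4 o4.
    by rewrite sy sy1 sy2.
  have [a3 a4] : pairing_off (x |: (y |: Z)) (a * tperm x y)%g.
    by apply/pairing_peel; do ?split.
  have [_ a5] := (orient_peel O xZ yZ c3 ax).1 c5.
  have [e1 e2] := Eul c1 sV ax c3.
  have tL2 : all (fcycle t) L2 by rewrite cyc sV andbT.
  split=> //.
  - move=> z zL2 /=; rewrite -vert //; apply: c2.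
    by move: zL2; rewrite mL mem_cat negb_or => /andP [].
  - move=> z; rewrite mL mem_cat => /orP [zV|zL]; first by rewrite PQ // -OQ.
    by rewrite PQ' // -c6.
  - exact/cov.
  - by move: c8; rewrite /= -/t e1 e2 aa !addnS !addSn.
case: c => /= c1 c2 c3 c4 c5 c6 c7 c8.
have /andP [sL sV] : all (fcycle s) L1 && fcycle s V by rewrite -cyc.
have [[a3 a4] ax] : pairing_off Z a /\ a x = y by apply/pairing_peel.
have [e1 e2] := Eul sL sV ax a3.
have OQ z : z \in V -> (z \in O) = (z \in Q).
  by move=> zV; rewrite -PQ //; apply: c6; rewrite -/(flatten L2) mL mem_cat zV.
have OP z : z \in flatten L1 -> (z \in O) = (z \in P).
  by move=> zL; rewrite -PQ' //; apply: c6; rewrite -/(flatten L2) mL mem_cat zL orbT.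
have OV : O :&: [set z in V] = Q.
  apply/setP => z; rewrite in_setI in_set; case: (boolP (z \in V)) => zV; first by rewrite OQ ?andbT.
  by rewrite andbF; apply/esym/negbTE; apply: contra zV => /QV.
split; last first.
  by move: sV => /= /and5P [/eqP -> /eqP -> /eqP ->].
split=> //=.
- move=> z zL; case: (boolP (z \in V)) => zV; last first.
    have zL2 : z \notin flatten L2 by rewrite mL mem_cat negb_or zV.
    by rewrite (vert c1 z zL2); apply: c2.
  have -> : porbit s z = [set w in V].
    by apply/setP => w; rewrite (fcycle_porbit sV zV) in_set.
  by rewrite setIC OV Q2 cardsE; split=> //; exact: (card_uniqP uV).
- apply/(orient_peel O xZ yZ a3 ax); split=> //.
  by rewrite OQ // yP OP.
- exact/cov.
- by move: c8; rewrite /= -/t e1 e2 aa !addnS !addSn.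
Qed.

End Peeling.

(** * Formal power series *)

Local Open Scope ring_scope.

(** Unlike [fps], generic in the coefficients: algebraic numbers and rational functions of [u] are
    needed besides rational numbers. *)
Record series (R : Type) := Series { cf : nat -> R }.

Lemma seriesP (R : Type) (f g : series R) : (forall n, cf f n = cf g n) -> f = g.
Proof. by case: f g => [f] [g] /= fg; congr Series; apply/funext. Qed.

HB.instance Definition _ (R : Type) := gen_eqMixin (series R).
HB.instance Definition _ (R : Type) := gen_choiceMixin (series R).

Section SeriesRing.
Variable R : comNzRingType.
Implicit Types f g h : series R.

Definition serC (c : R) : series R := Series (fun n => if n == 0%N then c else 0).
Definition ser_add f g : series R := Series (fun n => cf f n + cf g n).
Definition ser_opp f : series R := Series (fun n => - cf f n).
Definition ser_mul f g : series R :=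
  Series (fun n => \sum_(i < n.+1) cf f i * cf g (n - i)%N).
Definition ser_poly N f : {poly R} := \poly_(i < N) cf f i.

Lemma ser_mul_poly N f g n : (n < N)%N ->
  cf (ser_mul f g) n = (ser_poly N f * ser_poly N g)`_n.
Proof.
move=> nN; rewrite coefM /=; apply: eq_bigr => i _.
by rewrite !coef_poly (leq_ltn_trans (leq_subr _ _) nN) (leq_trans (ltn_ord i)).
Qed.

Lemma coefM_eqn (p q p' q' : {poly R}) n :
  (forall i, (i <= n)%N -> p`_i = p'`_i) -> (forall i, (i <= n)%N -> q`_i = q'`_i) ->
  (p * q)`_n = (p' * q')`_n.
Proof.
move=> pp qq; rewrite !coefM; apply: eq_bigr => i _.
by rewrite pp ?qq ?leq_subr // -ltnS.
Qed.

Lemma ser_addA : associative ser_add.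
Proof. by move=> f g h; apply/seriesP => n /=; rewrite addrA. Qed.
Lemma ser_addC : commutative ser_add.
Proof. by move=> f g; apply/seriesP => n /=; rewrite addrC. Qed.
Lemma ser_add0 : left_id (serC 0) ser_add.
Proof. by move=> f; apply/seriesP => n /=; rewrite if_same add0r. Qed.
Lemma ser_addN : left_inverse (serC 0) ser_opp ser_add.
Proof. by move=> f; apply/seriesP => n /=; rewrite if_same addNr. Qed.

HB.instance Definition _ :=
  GRing.isZmodule.Build (series R) ser_addA ser_addC ser_add0 ser_addN.

Lemma ser_mulA : associative ser_mul.
Proof.
move=> f g h; apply/seriesP => n; rewrite !(ser_mul_poly _ _ (ltnSn n)).
transitivity ((ser_poly n.+1 f * (ser_poly n.+1 g * ser_poly n.+1 h))`_n).
  by apply: coefM_eqn => // i ile; rewrite coef_poly ltnS ile (@ser_mul_poly n.+1).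
by rewrite mulrA; apply: coefM_eqn => // i ile; rewrite coef_poly ltnS ile (@ser_mul_poly n.+1).
Qed.

Lemma ser_mulC : commutative ser_mul.
Proof. by move=> f g; apply/seriesP => n; rewrite !(ser_mul_poly _ _ (ltnSn n)) mulrC. Qed.

Lemma ser_mul1 : left_id (serC 1) ser_mul.
Proof.
move=> f; apply/seriesP => n /=.
by rewrite big_ord_recl /= mul1r subn0 big1 ?addr0 // => i _; rewrite mul0r.
Qed.

Lemma ser_mulDl : left_distributive ser_mul ser_add.
Proof.
by move=> f g h; apply/seriesP => n /=; rewrite -big_split; apply: eq_bigr => i _; rewrite mulrDl.
Qed.

Lemma ser_1neq0 : serC 1 != 0.
Proof. by apply/eqP => /(congr1 (fun f => cf f 0%N)) /= /eqP; rewrite oner_eq0. Qed.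

HB.instance Definition _ :=
  GRing.Zmodule_isComNzRing.Build (series R) ser_mulA ser_mulC ser_mul1 ser_mulDl ser_1neq0.

Lemma cfM f g n : cf (f * g) n = \sum_(i < n.+1) cf f i * cf g (n - i)%N.
Proof. by []. Qed.
Lemma cfD f g n : cf (f + g) n = cf f n + cf g n. Proof. by []. Qed.
Lemma cfN f n : cf (- f) n = - cf f n. Proof. by []. Qed.
Lemma cfB f g n : cf (f - g) n = cf f n - cf g n. Proof. by []. Qed.
Lemma cf0 n : cf (0 : series R) n = 0. Proof. by rewrite /= if_same. Qed.
Lemma cf1 n : cf (1 : series R) n = (n == 0%N)%:R. Proof. by rewrite /=; case: eqP. Qed.

Lemma cf_sum (I : Type) (r : seq I) (P : pred I) (F : I -> series R) n :
  cf (\sum_(i <- r | P i) F i) n = \sum_(i <- r | P i) cf (F i) n.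
Proof. by apply: (big_morph (fun f => cf f n)) => [f g|]; rewrite ?cf0. Qed.

Lemma cf_serCM c f n : cf (serC c * f) n = c * cf f n.
Proof. by rewrite cfM big_ord_recl /= subn0 big1 ?addr0 // => i _; rewrite mul0r. Qed.

Fact serC_additive : zmod_morphism serC.
Proof. by move=> a b; apply/seriesP => -[|n] //=; rewrite subr0. Qed.
HB.instance Definition _ := GRing.isZmodMorphism.Build R (series R) serC serC_additive.
Fact serC_monoid : monoid_morphism serC.
Proof.
split=> // a b; apply/seriesP => n; rewrite cf_serCM /=.
by case: (n == 0%N); rewrite ?mulr0.
Qed.

HB.instance Definition _ := GRing.isMonoidMorphism.Build R (series R) serC serC_monoid.

Definition serX : series R := Series (fun n => (n == 1%N)%:R).

Lemma cf_serXM f n : cf (serX * f) n = if n is m.+1 then cf f m else 0.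
Proof.
case: n => [|n]; first by rewrite cfM big_ord1 /= mul0r.
rewrite cfM !big_ord_recl /= mul0r add0r mul1r subn1 /= big1 ?addr0 // => i _.
by rewrite mul0r.
Qed.

Lemma cf_serXnM k f n : cf (serX ^+ k * f) n = if (n < k)%N then 0 else cf f (n - k)%N.
Proof.
elim: k n => [|k IH] n; first by rewrite expr0 mul1r subn0.
by rewrite exprS -mulrA cf_serXM; case: n => [|n] //; rewrite IH.
Qed.

Definition vanish k f := forall i, (i < k)%N -> cf f i = 0.

Lemma vanishM k l f g : vanish k f -> vanish l g -> vanish (k + l) (f * g).
Proof.
move=> fk gl i ilt; rewrite cfM big1 // => j _.
have [jk|kj] := ltnP j k; first by rewrite fk ?mul0r.
by rewrite gl ?mulr0 //; have := ltn_ord j; lia.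
Qed.

Lemma vanishMr k f g : vanish k g -> vanish k (f * g).
Proof. exact: (@vanishM 0). Qed.

Lemma vanishX k f n : vanish k f -> vanish (k * n) (f ^+ n).
Proof.
move=> fk; elim: n => [|n IH]; first by rewrite muln0.
by rewrite exprS mulnS; apply: vanishM.
Qed.

Lemma vanish_eq0 f : (forall k, vanish k f) -> f = 0.
Proof. by move=> fv; apply/seriesP => n; rewrite cf0 (fv n.+1). Qed.

(* [\sum_n g n * y ^+ n], meaningful when [y] has no constant term *)
Definition sumpow (y : series R) (g : nat -> series R) : series R :=
  Series (fun e => cf (\sum_(n < e.+1) g n * y ^+ n) e).

Lemma cf_sumpow y (g : nat -> series R) e :
  cf (sumpow y g) e = \sum_(n < e.+1) cf (g n * y ^+ n) e.
Proof. by rewrite -cf_sum. Qed.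

Lemma sumpowE y (g : nat -> series R) e N : vanish 1 y -> (e < N)%N ->
  cf (sumpow y g) e = cf (\sum_(n < N) g n * y ^+ n) e.
Proof.
move=> y1 eN; rewrite [LHS]/= !cf_sum -!(big_mkord xpredT (fun n => cf (g n * y ^+ n) e)).
rewrite [RHS](big_cat_nat (leq0n _) eN) [X in _ = _ X]big_nat_cond [X in _ = _ X]big1 ?[RHS]addr0 // => n.
rewrite andbT => /andP [en _]; have := vanishMr (g n) (vanishX y1 (n := n)).
by apply; rewrite mul1n.
Qed.

Lemma sumpowS y (g : nat -> series R) : vanish 1 y -> sumpow y g = g 0%N + y * sumpow y (g \o succn).
Proof.
move=> y1; apply/seriesP => e; rewrite (@sumpowE _ _ _ e.+2) // big_ord_recl expr0 mulr1 !cfD.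
congr (_ + _); rewrite cf_sum !cfM.
have -> : \sum_(i < e.+1) cf (g (lift ord0 i) * y ^+ lift ord0 i) e
   = cf (y * \sum_(i < e.+1) g i.+1 * y ^+ i) e.
  rewrite mulr_sumr cf_sum; apply: eq_bigr => i _; congr cf.
  by rewrite /= exprS mulrCA.
rewrite cfM; apply: eq_bigr => i _; congr (_ * _).
by rewrite (@sumpowE _ _ _ e.+1) // ltnS leq_subr.
Qed.

Lemma sumpowD y (g h : nat -> series R) : sumpow y (fun n => g n + h n) = sumpow y g + sumpow y h.
Proof.
apply/seriesP => e; rewrite cfD /sumpow ![cf (Series _) _]/= -cfD -big_split /=.
by rewrite (eq_bigr _ (fun n _ => mulrDl _ _ _)).
Qed.

Lemma sumpowM y c (g : nat -> series R) : vanish 1 y -> sumpow y (fun n => c * g n) = c * sumpow y g.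
Proof.
move=> y1; apply/seriesP => e; rewrite (@sumpowE _ _ _ e.+1) //.
rewrite (eq_bigr _ (fun n _ => esym (mulrA _ _ _))) -mulr_sumr !cfM.
apply: eq_bigr => i _; congr (_ * _).
by rewrite (@sumpowE _ _ _ e.+1) // ltnS leq_subr.
Qed.

Lemma eq_sumpow y (g h : nat -> series R) : g =1 h -> sumpow y g = sumpow y h.
Proof. by move=> gh; congr sumpow; apply/funext. Qed.

End SeriesRing.

Section SeriesMap.
Variables (R S : comNzRingType) (phi : {rmorphism R -> S}).

Definition ser_map (f : series R) : series S := Series (fun n => phi (cf f n)).

Fact ser_map_additive : zmod_morphism ser_map.
Proof. by move=> f g; apply/seriesP => n /=; rewrite rmorphB. Qed.
HB.instance Definition _ :=
  GRing.isZmodMorphism.Build (series R) (series S) ser_map ser_map_additive.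
Fact ser_map_monoid : monoid_morphism ser_map.
Proof.
split=> [|f g]; apply/seriesP => n /=; first by case: (n == 0%N); rewrite ?rmorph1 ?rmorph0.
by rewrite rmorph_sum; apply: eq_bigr => i _; rewrite rmorphM.
Qed.

HB.instance Definition _ :=
  GRing.isMonoidMorphism.Build (series R) (series S) ser_map ser_map_monoid.

Lemma ser_mapX : ser_map (serX R) = serX S.
Proof. by apply/seriesP => n /=; rewrite rmorph_nat. Qed.

Lemma ser_mapC c : ser_map (serC c) = serC (phi c).
Proof. by apply/seriesP => n /=; case: (n == 0%N); rewrite ?rmorph0. Qed.
End SeriesMap.

Arguments cf : simpl never.

(** * Counting labelled maps *)

Fixpoint splits (T : eqType) (x : T) (w : seq T) : seq (seq T * seq T) :=
  if w is b :: w' then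
    (if b == x then [:: ([::], w')] else [::]) ++ [seq (b :: p.1, p.2) | p <- splits x w']
  else [::].

(** When an edge leaves the boundary at a dart of sign [b], it ends at a dart of sign [~~ b]; these
    are the possible signs of the three other darts of a balanced quartic vertex, counterclockwise
    after that one. *)
Definition thirds (b : bool) : seq (seq bool) :=
  [:: [:: b; b; ~~ b]; [:: b; ~~ b; b]; [:: ~~ b; b; b]].

Section CountTools.
Local Open Scope nat_scope.

Lemma card_fibers (T : finType) (S : eqType) (A : {set T}) (k : T -> S) (r : seq S) :
  uniq r -> {in A, forall m, k m \in r} ->
  #|A| = \sum_(q <- r) #|[set m in A | k m == q]|.
Proof.
move=> ur kr; rewrite -sum1_card.
have -> : \sum_(i in A) 1 = \sum_(i in A) \sum_(q <- r | k i == q) 1.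
  apply: eq_bigr => m mA; rewrite -big_filter.
  by rewrite (@eq_filter _ _ (pred1 (k m))) ?filter_pred1_uniq ?kr ?big_seq1 // => q; rewrite eq_sym.
rewrite (exchange_big_dep xpredT) //=; apply: eq_bigr => q _.
by rewrite -sum1_card; apply: eq_bigl => m; rewrite inE.
Qed.

Fixpoint decompositions (T : Type) (l : seq T) : seq (seq T * T * seq T) :=
  if l is y :: l' then ([::], y, l') :: [seq (y :: d.1.1, d.1.2, d.2) | d <- decompositions l']
  else [::].

Lemma decompositionsP (T : eqType) (l : seq T) d :
  d \in decompositions l -> l = d.1.1 ++ d.1.2 :: d.2.
Proof.
elim: l d => //= y l IH d; rewrite inE => /orP [/eqP -> //|/mapP [e /IH -> ->] //].
Qed.

Lemma map_decompositions (T : Type) (l : seq T) : [seq d.1.2 | d <- decompositions l] = l.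
Proof. by elim: l => //= y l IH; rewrite -map_comp /comp /= IH. Qed.
End CountTools.

Section Count.
Variable D : finType.
Implicit Types (s t a : {perm D}) (C S O P Q Z : {set D}) (L : seq (seq D)) (l : seq D).

Definition configs L Z P := [set m | `[< config L Z P m >]].
(** Peeled darts stay in the cycle [l] as dead darts, so the boundary word must skip them. *)
Definition word P Z l := [seq z \in P | z <- l & z \notin Z].

(** Passes from darts, on which peeling acts, to words, on which [F] depends: positions that are
    dead or have the wrong sign drop out. *)
Lemma sum_splits (V : nmodType) Z P b l (G : seq bool -> seq bool -> V) :
  \sum_(d <- decompositions l | (d.1.2 \notin Z) && ((d.1.2 \in P) == b))
     G (word P Z d.1.1) (word P Z d.2)
  = \sum_(p <- splits b (word P Z l)) G p.1 p.2.
Proof.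
elim: l G => [|y l IH] G; first by rewrite !big_nil.
have wl l' : word P Z (y :: l') = if y \notin Z then (y \in P) :: word P Z l' else word P Z l'.
  by rewrite /word /=; case: ifP.
rewrite wl big_cons big_map /=; have [yZ|yZ] := boolP (y \in Z).
  by rewrite -(IH G); apply: eq_bigr => d _; rewrite wl yZ.
rewrite [splits _ _]/= big_cat big_map /= -(IH (fun u v => G (_ :: u) v)).
by case: ifP => _; rewrite ?big_seq1 ?big_nil ?add0r; [congr (_ + _)|];
  apply: eq_bigr => d _; rewrite wl yZ.
Qed.

Lemma word_mem Z P l : {subset l <= Z} -> word P Z l = [::].
Proof.
move=> lZ; rewrite /word (@eq_in_filter _ _ pred0) ?filter_pred0 // => z /lZ zZ.
by rewrite zZ.
Qed.

Lemma next_notin (T : eqType) (p : seq T) x : x \notin p -> next p x = x.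
Proof. by rewrite next_nth => /negbTE ->. Qed.

Lemma eq_fcycle (s t : D -> D) l : {in l, s =1 t} -> fcycle s l = fcycle t l.
Proof.
move=> st; apply: (@eq_in_cycle _ (mem l)); last exact/allP.
by move=> z w zl _ /=; rewrite st.
Qed.

Lemma fcycles_exist L : uniq (flatten L) -> exists s, all (fcycle s) L.
Proof.
move=> uL; suff [s []] : exists s, all (fcycle s) L /\ forall z, z \notin flatten L -> s z = z.
  by exists s.
elim: L uL => [|l L IH]; first by exists 1%g; split=> // z _; rewrite perm1.
rewrite /= cat_uniq => /and3P [ul /hasPn dis /IH [s [/allP sL s1]]].
pose t := perm (can_inj (prev_next ul)).
have tE z : t z = next l z by rewrite permE.
have tl z : z \in l -> t z \in l by move=> zl; rewrite tE mem_next.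
exists (t * s)%g; split=> [|z]; last first.
  by rewrite mem_cat negb_or => /andP [zl zL]; rewrite permM tE next_notin // s1.
apply/andP; split.
  rewrite -(@eq_fcycle t) => [|z zl].
    by rewrite (eq_fcycle (t := next l)) ?cycle_next // => z _.
  by rewrite permM s1 //; apply: contraL (tl _ zl) => /dis.
apply/allP => l' l'L; rewrite -(@eq_fcycle s) ?sL // => z zl'.
have zL : z \in flatten L by apply/flattenP; exists l'.
by rewrite permM tE next_notin //; exact: dis.
Qed.

Lemma card_porbits_cycles s L : all (fcycle s) L -> uniq (flatten L) ->
  all (fun l => l != [::]) L -> flatten L =i setT -> #|porbits s| = size L.
Proof.
move=> /allP sL uL /allP nL LT; rewrite -(size_map (fun l => [set z in l])).
have nonempty l : l \in L -> exists z, z \in l.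
  by move=> /nL; case: (l) => // z p _; exists z; rewrite mem_head.
have porbE l z : l \in L -> z \in l -> porbit s z = [set w in l].
  by move=> lL zl; apply/setP => w; rewrite (fcycle_porbit (sL _ lL) zl) inE.
have <- : #|[seq [set z in l] | l <- L]| = size [seq [set z in l] | l <- L].
  apply/card_uniqP; elim: L uL nonempty {sL nL LT porbE} => //= l L IH.
  rewrite cat_uniq => /and3P [_ /hasPn dis uL] ne; apply/andP; split; last first.
    by apply: IH => // l' l'L; apply: ne; rewrite inE l'L orbT.
  apply/mapP => - [l' l'L /setP E].
  have [z zl] := ne l (mem_head _ _); move: (E z); rewrite !inE zl => zl'.
  have /dis : z \in flatten L by apply/flattenP; exists l'.
  by rewrite /= zl.
apply: eq_card => C; apply/imsetP/mapP => [[z _ ->]|[l lL ->]].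
  have : z \in flatten L by rewrite LT inE.
  by case/flattenP => l lL zl; exists l => //; apply: porbE.
by have [z zl] := nonempty l lL; exists z => //; rewrite (porbE l).
Qed.

Lemma configs_dead L Z P : flatten L =i Z -> flatten L =i setT -> uniq (flatten L) ->
  all (fun l => l != [::]) L -> P \subset flatten L -> #|configs L Z P| = 1%N.
Proof.
move=> LZ LT uL nL /subsetP PL.
have [s sL] := fcycles_exist uL.
suff -> : configs L Z P = [set (s, 1%g, P)] by rewrite cards1.
apply/setP => - [[s' a] O]; rewrite !inE; apply/asboolP/eqP => [c|[-> -> ->]]; last first.
  split=> //=.
  - by move=> x; rewrite LT inE.
  - by move=> x; rewrite !perm1.
  - by move=> x; rewrite perm1 eqxx -LZ LT inE.
  - by move=> x; rewrite -LZ LT inE.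
  - move=> C /subsetP BC _ _; apply/setP => z.
    by rewrite (BC z) inE // LT inE.
  - rewrite mul1g (card_porbits_cycles sL) //.
    suff -> : #|porbits (1 : {perm D})%g| = #|D| by rewrite -addnn addnAC addnC.
    rewrite /porbits card_imset // => x y /setP /(_ x); rewrite porbit_id.
    by case/esym/porbitP => i; rewrite expg1n perm1.
case: c => /= c1 _ _ c4 _ c6 _ _; congr (_, _, _).
- apply/permP => z; have /flattenP [l lL zl] : z \in flatten L by rewrite LT inE.
  have := next_cycle (allP c1 l lL) zl; have := next_cycle (allP sL l lL) zl.
  by move=> /= /eqP -> /eqP ->.
- by apply/permP => z; rewrite perm1; apply/eqP; rewrite c4 -LZ LT inE.
- by apply/setP => z; rewrite c6 // LT inE.
Qed.

(** No edge leaves a boundary whose darts are all dead. The boundary is then stable under both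
    permutations, and by the covering condition it is everything. *)
Lemma configs_deadN L Z P : flatten L =i Z -> [set z in flatten L] != setT ->
  configs L Z P = set0.
Proof.
move=> LZ nT; apply/setP => m; rewrite !inE; apply/asboolP => - [c1 _ _ c4 _ _ c7 _].
case/eqP: nT; apply: c7; [exact: subxx | exact: stable_flatten |].
move=> z; rewrite !inE => zL; suff /eqP -> : m.1.2 z == z by [].
by rewrite c4 -LZ.
Qed.

Lemma card_involutive (T : finType) (f : T -> T) (A B : {set T}) : involutive f ->
  (forall m, m \in A <-> f m \in B) -> #|A| = #|B|.
Proof.
move=> fK AB; rewrite -(card_preimset B (inv_inj fK)); apply: eq_card => m.
by rewrite [RHS]inE; apply/idP/idP => /AB.
Qed.

Lemma card_split x y l1 l2 L Z P : uniq (flatten ((x :: l1 ++ y :: l2) :: L)) ->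
  x \notin Z -> y \notin Z -> (y \in P) = (x \notin P) ->
  #|[set m in configs ((x :: l1 ++ y :: l2) :: L) Z P | m.1.2 x == y]|
  = #|configs ((x :: l2) :: (y :: l1) :: L) (x |: (y |: Z)) P|.
Proof.
move=> uL xZ yZ yP; apply: (card_involutive (@peelK _ x y)) => m.
rewrite !inE; split.
  case/andP => /asboolP c /eqP ax; apply/asboolP.
  by apply/(config_split m uL xZ yZ yP).
by move=> /asboolP /(config_split m uL xZ yZ yP) [c ->]; rewrite eqxx andbT; apply/asboolP.
Qed.

Definition vertex_key x (m : {perm D} * {perm D} * {set D}) :=
  let y := m.1.2 x in let s := m.1.1 in [:: y; s y; s (s y); s (s (s y))].

Lemma mem_maskE (T : eqType) (V : seq T) (p : seq bool) : uniq V -> size p = size V ->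
  [seq z \in mask p V | z <- V] = p.
Proof.
elim: V p => [|z V IH] [|b p] //= /andP [zV uV] [sp]; congr (_ :: _).
  by case: b; rewrite ?mem_head //; apply/negbTE; apply: contra zV => /mem_mask.
rewrite -[RHS](IH p) //; apply/eq_in_map => w wV; case: b => //.
by rewrite inE; case: eqVneq => [E|//]; rewrite -E wV in zV.
Qed.

Lemma signsE O (V : seq D) (p : seq bool) : uniq V -> size p = size V ->
  [seq z \in O | z <- V] = p <-> O :&: [set z in V] = [set z in mask p V].
Proof.
move=> uV sp; split=> E.
  by apply/setP => z; rewrite -E in_setI !in_set -filter_mask mem_filter.
rewrite -[RHS](mem_maskE uV sp); apply/eq_in_map => z zV.
by move/setP/(_ z): E; rewrite in_setI !in_set zV andbT.
Qed.

Lemma card_merge x (t : seq D) (q : seq bool) l L Z P :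
  uniq (t ++ flatten ((x :: l) :: L)) -> size t = 4 ->
  x \notin Z -> Z \subset flatten ((x :: l) :: L) -> P \subset flatten ((x :: l) :: L) ->
  q \in thirds (x \in P) ->
  #|[set m in configs ((x :: l) :: L) Z P |
      (vertex_key x m == t) && ([seq z \in m.2 | z <- t] == (x \notin P) :: q)]|
  = #|configs ((x :: behead t ++ head x t :: l) :: L) (x |: (head x t |: Z))
        (P :|: [set z in mask ((x \notin P) :: q) t])|.
Proof.
case: t => [|y [|y1 [|y2 [|y3 [|]]]]] // uL _ xZ /subsetP ZL PL qx; rewrite [head _ _]/= [behead _]/=.
set V := [:: y; _; _; _] in uL *; set Q := [set z in mask _ V].
have [uV /hasPn dVL _] := and3P (etrans (esym (cat_uniq _ _)) uL).
have yZ : y \notin Z.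
  by apply/negP => /ZL /dVL; rewrite /= mem_head.
have QV : Q \subset V by apply/subsetP => z; rewrite inE => /mem_mask.
have sq : size ((x \notin P) :: q) = size V.
  by move: qx; rewrite !inE => /or3P [] /eqP ->.
have Q2 : #|Q| = 2%N.
  rewrite cardsE (card_uniqP (mask_uniq uV _)) size_mask //.
  by move: qx; rewrite !inE => /or3P [] /eqP ->; case: (x \in P).
have VQ (O : {set D}) := signsE O uV sq.
have yQ : (y \in Q) = (x \notin P).
  have /VQ : Q :&: [set z in V] = Q.
    by apply/setIidPl/subsetP => z zQ; rewrite inE (subsetP QV).
  by case.
apply: (card_involutive (@peelK _ x y)) => m.
rewrite !inE; split.
  case/and3P => /asboolP c /eqP [ax sy sy1 sy2] /eqP/VQ OV; apply/asboolP.
  apply/(config_merge m uL xZ yZ PL QV Q2 yQ).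
  by move: sy sy1 sy2; rewrite ax => sy; rewrite sy => sy1; rewrite sy1 => sy2.
move=> /asboolP /(config_merge m uL xZ yZ PL QV Q2 yQ) [c [ax sy sy1 sy2 /VQ E]].
by apply/and3P; split; [apply/asboolP | rewrite /vertex_key ax sy sy1 sy2 | apply/eqP].
Qed.

End Count.

(* Counts planar maps with a boundary word by vertices, a vertex having weight [serX ^+ 2]. *)
Record boundary_series (K : comNzRingType) (F : seq bool -> series K) : Prop := BoundarySeries {
  boundary_nil : F [::] = 1;
  boundary_cons : forall b w, F (b :: w) =
    \sum_(p <- splits (~~ b) w) F p.1 * F p.2
    + serX K ^+ 2 * \sum_(q <- thirds b) F (q ++ w);
  boundary_rot : forall u v, F (u ++ v) = F (v ++ u) }.

(** Labelling the darts of [n.+1] vertices amounts to choosing the four darts of one vertex in order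
    and labelling the others. *)
Lemma ffact_fact4 n : ((4 * n.+1) ^_ 4 * (4 * n)`! = (4 * n.+1)`!)%N.
Proof. by rewrite -(@ffact_fact (4 * n.+1) 4) mulnS ?addKn // leq_addr. Qed.

(** * The peeling recursion for labelled configurations *)

Section Count.
Variables (D : finType) (K : comNzRingType) (F : seq bool -> series K).
Hypothesis bF : boundary_series F.
Implicit Types (s a : {perm D}) (C S O P Q Z : {set D}) (L : seq (seq D)) (l : seq D).

Lemma eq_word P Z P' Z' l : {in l, forall z, (z \in Z') = (z \in Z)} ->
  {in l, forall z, (z \in P') = (z \in P)} -> word P' Z' l = word P Z l.
Proof.
move=> ZZ PP; rewrite /word (@eq_in_filter _ _ [pred z | z \notin Z]) => [|z zl].
  by apply/eq_in_map => z; rewrite mem_filter => /andP [_ /PP].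
by rewrite /= ZZ.
Qed.

Definition boundary_prod L Z P := \prod_(l <- L) F (word P Z l).

Lemma eq_boundary_prod P Z P' Z' L :
  {in flatten L, forall z, (z \in Z') = (z \in Z)} ->
  {in flatten L, forall z, (z \in P') = (z \in P)} ->
  boundary_prod L Z' P' = boundary_prod L Z P.
Proof.
move=> ZZ PP; apply: eq_big_seq => l lL; congr F.
by apply: eq_word => z zl; [apply: ZZ | apply: PP]; apply/flattenP; exists l.
Qed.

(** Relabelling the [4 * n] darts off the boundary acts freely, as each component has a boundary
    dart; hence the factorial. Treating several boundary cycles at once avoids distributing the
    labels among the pieces when a cycle is cut. *)
Definition count_spec L Z P n :=
  #|configs L Z P|%:R = (4 * n)`!%:R * cf (boundary_prod L Z P) (2 * n) :> K.

Lemma cards_split x l L Z P n : uniq (flatten ((x :: l) :: L)) -> x \notin Z ->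
  Z \subset flatten ((x :: l) :: L) -> P \subset flatten ((x :: l) :: L) ->
  all (fun l => l != [::]) ((x :: l) :: L) ->
  (forall y l1 l2, l = l1 ++ y :: l2 -> y \notin Z ->
    count_spec ((x :: l2) :: (y :: l1) :: L) (x |: (y |: Z)) P n) ->
  #|[set m in configs ((x :: l) :: L) Z P | m.1.2 x \in l]|%:R = (4 * n)`!%:R *
    cf (\sum_(p <- splits (x \notin P) (word P Z l)) F p.1 * F p.2 * boundary_prod L Z P) (2 * n).
Proof.
move=> uL xZ ZL PL nL IH.
have uxl : uniq (x :: l) by move: uL; rewrite -[flatten _]/((x :: l) ++ flatten L) cat_uniq => /andP [].
have [xl ul] := andP uxl.
rewrite (@card_fibers _ _ _ (fun m : {perm D} * {perm D} * {set D} => m.1.2 x) l ul); last by move=> m; rewrite inE => /andP [].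
rewrite -{1}(map_decompositions l) big_map natr_sum.
rewrite -(sum_splits _ _ _ _ (fun u v => F u * F v * boundary_prod L Z P)).
rewrite cf_sum mulr_sumr [RHS]big_mkcond /=; apply: eq_big_seq => d /decompositionsP dl.
set y := d.1.2 in dl *; set l1 := d.1.1 in dl *; set l2 := d.2 in dl *.
have yl : y \in l by rewrite dl mem_cat mem_head orbT.
have -> : [set m in [set m0 in configs ((x :: l) :: L) Z P | m0.1.2 x \in l] | m.1.2 x == y]
  = [set m in configs ((x :: l) :: L) Z P | m.1.2 x == y].
  apply/setP => m; rewrite !inE -andbA; congr andb; apply/andP/idP => [[] //|/eqP E].
  by rewrite E yl.
have inL z : z \in x :: l -> z \in flatten ((x :: l) :: L).
  by move=> h; rewrite -[flatten _]/((x :: l) ++ flatten L) mem_cat h.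
have xL : x \in flatten ((x :: l) :: L) by rewrite inL ?mem_head.
have yL : y \in flatten ((x :: l) :: L) by rewrite inL // inE yl orbT.
case: ifP => [/andP [yZ /eqP yP]|].
  move: (uL); rewrite {1}dl => uL'; rewrite dl card_split // (IH _ _ _ dl yZ) //.
  congr (_ * cf _ _); rewrite /boundary_prod 2!big_cons.
  have w0 z l' : z \in x |: (y |: Z) -> word P (x |: (y |: Z)) (z :: l') = word P (x |: (y |: Z)) l'.
    by move=> h; rewrite /word /= h.
  have dis z : z \in l1 \/ z \in l2 \/ z \in flatten L -> (z \in x |: (y |: Z)) = (z \in Z).
    move: uL'; rewrite -[flatten _]/((x :: l1 ++ y :: l2) ++ flatten L) /= -!catA cat_cons => uL'.
    have : uniq ([:: x; y] ++ l1 ++ l2 ++ flatten L).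
      by rewrite -(@perm_uniq _ (x :: l1 ++ y :: l2 ++ flatten L)) //= perm_cons -cat1s perm_catCA.
    rewrite cat_uniq => /and3P [_ /hasPn h _] hz.
    have /h : z \in l1 ++ l2 ++ flatten L by rewrite !mem_cat; case: hz => [->|[->|->]]; rewrite ?orbT.
    by rewrite /= !inE negb_or => /andP [/negPf -> /negPf ->].
  rewrite !w0 ?inE ?eqxx ?orbT // mulrA [X in X * _]mulrC; congr (_ * _ * _).
  - by congr F; apply: eq_word => // z zl; apply: dis; left.
  - by congr F; apply: eq_word => // z zl; apply: dis; right; left.
  - by apply: eq_boundary_prod => // z zl; apply: dis; right; right.
move=> h; rewrite (_ : [set m in _ | _] = set0) ?cards0 //.
apply/setP => m; rewrite !inE; apply/negP => /andP [/asboolP c /eqP ax].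
have yZ : y \notin Z.
  case: c => _ _ aK aZ _ _ _ _; rewrite -aZ -ax aK ax; apply: contraTneq yl => <-.
  by [].
move: h; rewrite yZ /= -ax (config_sameside c xL xZ) ?ax ?yL //.
by rewrite eqxx.
Qed.

Lemma vertex_keyP x l L Z P m : config ((x :: l) :: L) Z P m -> x \notin Z ->
  m.1.2 x \notin flatten ((x :: l) :: L) ->
  let t := vertex_key x m in
  [/\ uniq t, {in t, forall z, z \notin flatten ((x :: l) :: L)} &
     exists2 q, q \in thirds (x \in P) & [seq z \in m.2 | z <- t] = (x \notin P) :: q].
Proof.
case: m => [[s a] O] c xZ yL t.
case: c => /= c1 c2 c3 c4 c5 c6 c7 c8.
have [o4 o2] := c2 _ yL.
have ft : fcycle s t := porbit4 o4.
have tP : porbit s (a x) =i t by apply: fcycle_porbit ft _; rewrite mem_head.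
have ut : uniq t by apply/card_uniqP; rewrite -(eq_card tP) o4.
split=> //.
  have /stableC sL := stable_flatten (L := (x :: l) :: L) c1.
  have yC : a x \in ~: [set z in flatten ((x :: l) :: L)] by rewrite !inE.
  by move=> z; rewrite -tP => /(subsetP (stable_porbit sL yC)); rewrite in_setC in_set.
have cO : count (mem O) t = 2%N.
  rewrite -o2 -size_filter -(card_uniqP (filter_uniq _ ut)); apply: eq_card => z.
  by rewrite mem_filter in_setI tP andbC.
have yO : (a x \in O) = (x \notin P) by rewrite c5 // c6 // mem_head.
exists [seq z \in O | z <- behead t]; last by rewrite /t /= yO.
move: cO; rewrite /t /= yO.
by case: (x \in P); case: (s (a x) \in O); case: (s (s (a x)) \in O);
  case: (s (s (s (a x))) \in O).
Qed.

Lemma cards_merge x l L Z P n : uniq (flatten ((x :: l) :: L)) -> x \notin Z ->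
  Z \subset flatten ((x :: l) :: L) -> P \subset flatten ((x :: l) :: L) ->
  #|D| = (size (flatten ((x :: l) :: L)) + 4 * n)%N ->
  (forall y y1 y2 y3 q, let V := [:: y; y1; y2; y3] in
    uniq (V ++ flatten ((x :: l) :: L)) -> (0 < n)%N ->
    count_spec ((x :: [:: y1; y2; y3] ++ y :: l) :: L) (x |: (y |: Z))
      (P :|: [set z in mask ((x \notin P) :: q) V]) n.-1) ->
  #|[set m in configs ((x :: l) :: L) Z P | m.1.2 x \notin flatten ((x :: l) :: L)]|%:R =
  (4 * n)`!%:R *
    cf (serX K ^+ 2 * (\sum_(q <- thirds (x \in P)) F (q ++ word P Z l) * boundary_prod L Z P))
      (2 * n).
Proof.
move=> uL xZ ZL PL cD IH; set L1 := (x :: l) :: L in uL ZL PL cD IH *.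
pose U := ~: [set z in flatten L1].
pose ts := [seq tval t | t <- enum [set t : 4.-tuple D | all [in U] t & uniq t]].
pose key (m : {perm D} * {perm D} * {set D}) :=
  (vertex_key x m, [seq z \in m.2 | z <- vertex_key x m]).
pose r := [seq (t, (x \notin P) :: q) | t <- ts, q <- thirds (x \in P)].
have uts : uniq ts by rewrite map_inj_uniq ?enum_uniq //; exact: val_inj.
have uth : uniq (thirds (x \in P)) by case: (x \in P).
have ur : uniq r by apply: allpairs_uniq => // - [t1 q1] [t2 q2] _ _ [-> ->].
have cU : #|U| = (4 * n)%N.
  by rewrite cardsCs setCK cardsE (card_uniqP uL) cD addKn.
have ints t : t \in ts = [&& size t == 4%N, all [in U] t & uniq t].
  apply/mapP/and3P => [[t']|[st ta ut]].
    by rewrite mem_enum inE => /andP [? ?] ->; rewrite size_tuple.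
  by exists (Tuple st); rewrite // mem_enum inE; apply/andP.
have szts : size ts = ((4 * n) ^_ 4)%N by rewrite size_map -cardE card_uniq_tuples cU.
rewrite (@card_fibers _ _ _ key r ur); last first.
  move=> m; rewrite inE => /andP []; rewrite inE => /asboolP c yL.
  have [ut tL [q qt tq]] := vertex_keyP c xZ yL.
  apply/allpairsP; exists (vertex_key x m, q); rewrite /key tq; split=> //.
  rewrite ints; apply/and3P; split=> //; apply/allP => z /tL.
  by rewrite in_setC in_set.
rewrite natr_sum /r big_allpairs_dep.
have fiber t q : t \in ts -> q \in thirds (x \in P) ->
   #|[set m in [set m0 in configs L1 Z P | m0.1.2 x \notin flatten L1] |
       key m == (t, (x \notin P) :: q)]|%:R =
   (4 * n.-1)`!%:R * cf (F (q ++ word P Z l) * boundary_prod L Z P) (2 * n.-1) :> K.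
  rewrite ints => /and3P [/eqP st /allP tU ut] qth.
  have tL z : z \in t -> z \notin flatten L1 by move=> /tU; rewrite in_setC in_set.
  have utL : uniq (t ++ flatten L1).
    by rewrite cat_uniq ut uL andbT andTb; apply/hasPn => z; apply: contraL => /tL.
  have -> : [set m in [set m0 in configs L1 Z P | m0.1.2 x \notin flatten L1] |
       key m == (t, (x \notin P) :: q)] =
     [set m in configs L1 Z P |
      (vertex_key x m == t) && ([seq z \in m.2 | z <- t] == (x \notin P) :: q)].
    apply/setP => m; rewrite !in_set -andbA xpair_eqE; congr andb.
    have [E|] := eqVneq (vertex_key x m) t; last by rewrite andbF.
    have -> : m.1.2 x \notin flatten L1 by apply: tL; rewrite -E mem_head.
    by rewrite E.
  have n0 : (0 < n)%N.
    have : (0 < #|U|)%N.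
      case: (t) st tU => // z t' _ /(_ z (mem_head _ _)) zU; apply/card_gt0P; by exists z.
    by rewrite cU muln_gt0.
  rewrite card_merge //.
  case: t st tU ut tL utL => [|y [|y1 [|y2 [|y3 [|]]]]] // _ tU ut tL utL.
  rewrite [head _ _]/= [behead _]/= (IH _ _ _ _ _ utL n0).
  congr (_ * cf _ _); rewrite /boundary_prod big_cons.
  set V := [:: y; y1; y2; y3] in utL tL ut tU *.
  set Z' := (x |: (y |: Z)); set P' := (P :|: _).
  have xL : x \in flatten L1 by rewrite mem_head.
  have VZ z : z \in V -> (z \in Z) = false.
    by move=> /tL; apply: contraNF => /(subsetP ZL).
  have VP z : z \in V -> (z \in P) = false.
    by move=> /tL; apply: contraNF => /(subsetP PL).
  have [uxl dis _] := and3P (etrans (esym (cat_uniq (x :: l) (flatten L))) uL).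
  have [xl _] := andP uxl.
  have LV z : z \in flatten L1 -> z \notin V by apply: contraTN => /tL.
  have outZ z : z \in l \/ z \in flatten L -> (z \in Z') = (z \in Z).
    move=> zl; rewrite /Z' !in_setU !in_set1.
    have zL : z \in flatten L1.
      rewrite -[flatten _]/((x :: l) ++ flatten L) mem_cat inE.
      by case: zl => ->; rewrite ?orbT.
    have -> : (z == x) = false.
      apply/negP => /eqP E; case: zl; rewrite E; first by rewrite (negPf xl).
      by move=> xL'; case/negP: dis; apply/hasP; exists x => //; rewrite mem_head.
    by have -> : (z == y) = false by apply/negP => /eqP E; have := LV _ zL; rewrite E mem_head.
  have outP z : z \in flatten L1 -> (z \in P') = (z \in P).
    move=> /LV zV; rewrite /P' in_setU in_set; case: (boolP (z \in mask _ V)) => [/mem_mask|].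
      by rewrite (negPf zV).
    by rewrite orbF.
  have outP2 z : z \in l \/ z \in flatten L -> (z \in P') = (z \in P).
    move=> zl; apply: outP; rewrite -[flatten _]/((x :: l) ++ flatten L) mem_cat inE.
    by case: zl => ->; rewrite ?orbT.
  congr (_ * _); last by apply: eq_boundary_prod => z zl; [apply: outZ|apply: outP2]; right.
  have wl : word P' Z' l = word P Z l.
    by apply: eq_word => z zl; [apply: outZ | apply: outP2]; left.
  congr F; rewrite -wl /word.
  have VZ' z : z \in [:: y1; y2; y3] -> (z \in Z') = false.
    move=> zV; have zV' : z \in V by rewrite inE zV orbT.
    rewrite /Z' !in_setU !in_set1 (VZ _ zV').
    have -> : (z == x) = false by apply/negP => /eqP E; have := LV _ xL; rewrite -E zV'.
    have -> // : (z == y) = false.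
    by apply/negP => /eqP E; move: ut; rewrite /= -E zV.
  have VP' : [seq z \in P' | z <- V] = (x \notin P) :: q.
    rewrite -[RHS](@mem_maskE _ V _ ut); last first.
      by move: qth; rewrite !inE => /or3P [] /eqP ->.
    by apply/eq_in_map => z zV; rewrite /P' in_setU in_set VP.
  have xZ' : x \in Z' by rewrite !inE eqxx.
  have yZ' : y \in Z' by rewrite !inE eqxx orbT.
  rewrite /= xZ' yZ' (VZ' y1) ?(VZ' y2) ?(VZ' y3) ?in_cons ?eqxx ?orbT //=.
  by move: VP' => /= [_ <-].
rewrite (eq_big_seq (fun=> \sum_(q <- thirds (x \in P))
   (4 * n.-1)`!%:R * cf (F (q ++ word P Z l) * boundary_prod L Z P) (2 * n.-1))); last first.
  by move=> t tts; apply: eq_big_seq => q qth; apply: fiber.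
(* Each of the [(4 * n) ^_ 4] ordered choices of the absorbed darts contributes the same amount. *)
rewrite big_const_seq count_predT szts iter_addr_0 -mulr_sumr -cf_sum -mulr_suml.
rewrite cf_serXnM; case: n {cD IH cU szts fiber} => [|n]; first by rewrite mulr0n mulr0.
rewrite -[X in X = _]mulr_natl mulrA -natrM.
have -> : (2 * n.+1 < 2)%N = false by rewrite mulnS.
have -> : (2 * n.+1 - 2 = 2 * n)%N by rewrite mulnS addKn.
by rewrite -pred_Sn ffact_fact4 mulr_suml.
Qed.

Lemma configs_eq L L' Z P : (forall m, config L Z P m <-> config L' Z P m) ->
  configs L Z P = configs L' Z P.
Proof. by move=> h; apply/setP => m; rewrite !inE; apply/asboolP/asboolP => /h. Qed.

(** Induction on [4 * n] plus the number of live boundary darts. A split kills two darts; a merge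
    trades one vertex for four new boundary darts, and kills two. Either way the measure drops by
    two. *)
Lemma count_configs n L Z P : uniq (flatten L) -> all (fun l => l != [::]) L ->
  Z \subset flatten L -> P \subset flatten L -> #|D| = (size (flatten L) + 4 * n)%N ->
  count_spec L Z P n.
Proof.
have [N] := ubnP (4 * n + (size (flatten L) - #|Z|)).
elim: N n L Z P => // N IH n L Z P ltN uL nL ZL PL cD.
have cZ : (#|Z| <= size (flatten L))%N.
  by rewrite -(card_uniqP uL); apply: subset_leq_card.
have [dead|] := boolP (all [in Z] (flatten L)).
  have LZ : flatten L =i Z.
    by move=> z; apply/idP/idP; [exact: (allP dead) | exact: (subsetP ZL)].
  have cL : #|[set z in flatten L]| = size (flatten L) by rewrite cardsE (card_uniqP uL).
  have p1 : boundary_prod L Z P = 1.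
    rewrite /boundary_prod big1_seq // => l /andP [_ lL].
    rewrite word_mem ?(boundary_nil bF) // => z zl; rewrite -LZ.
    by apply/flattenP; exists l.
  rewrite /count_spec p1 cf1.
  have [n0|n0] := posnP n.
    rewrite n0 muln0 fact0 mulr1 configs_dead //.
    have : [set z in flatten L] == setT.
      by rewrite eqEcard subsetT cardsT cL cD n0 muln0 addn0 leqnn.
    by move=> /eqP/setP E z; have := E z; rewrite !inE.
  rewrite configs_deadN ?cards0 //.
    by case: (n) n0 => // n' _; rewrite mulr0.
  apply/eqP => /(congr1 (fun A : {set D} => #|A|)); rewrite cardsT cL cD.
  by move: n0; clear; lia.
move=> /allPn [x xfL xZ].
have [l lL xl] := flattenP xfL.
have [i l' E] := rot_to xl.
pose L' := (x :: l') :: rem l L.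
have pL : perm_eq L (l :: rem l L) := perm_to_rem lL.
have cL' m : config L Z P m <-> config L' Z P m.
  by rewrite (config_perm _ _ _ pL) /L' -E config_rot.
have pf : perm_eq (flatten L) (flatten L').
  apply: perm_trans (perm_flatten pL) _.
  by rewrite /L' -E; apply: perm_cat => //; rewrite perm_sym perm_rot.
have prodE : boundary_prod L Z P = boundary_prod L' Z P.
  rewrite /boundary_prod (perm_big _ pL) /L' -E !big_cons; congr (_ * _).
  rewrite /word /rot filter_cat map_cat (boundary_rot bF) -map_cat -filter_cat.
  by rewrite cat_take_drop.
have {}uL : uniq (flatten L') by rewrite -(perm_uniq pf).
have {}nL : all (fun l => l != [::]) L'.
  by move: nL; rewrite (perm_all _ pL) /= => /andP [_].
have {}ZL : Z \subset flatten L'.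
  by apply/subsetP => z zZ; rewrite -(perm_mem pf) (subsetP ZL).
have {}PL : P \subset flatten L'.
  by apply/subsetP => z zZ; rewrite -(perm_mem pf) (subsetP PL).
rewrite (perm_size pf) in ltN cD cZ.
rewrite /count_spec (configs_eq cL') prodE; move: prodE cL' => _ _.
have xL' : x \in flatten L' by rewrite mem_head.
have subs (Y : {set D}) (M : seq D) : Y \subset flatten L' -> {subset flatten L' <= M} -> Y \subset M.
  by move=> YL LM; apply/subsetP => z /(subsetP YL) /LM.
have A := @cards_split x l' (rem l L) Z P n uL xZ ZL PL nL _.
have B := @cards_merge x l' (rem l L) Z P n uL xZ ZL PL cD _.
pose S := configs L' Z P.
(* The partner of [x] is on the same cycle or off the boundary: [config_samecycle] excludes the
   other cycles, and [x] is not its own partner, being alive. *)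
have cS : #|S| = (#|[set m in S | m.1.2 x \in l']| + #|[set m in S | m.1.2 x \notin flatten L']|)%N.
  rewrite -(cardsID [set m : {perm D} * {perm D} * {set D} | m.1.2 x \in l'] S); congr (_ + _)%N; apply: eq_card => m.
    by rewrite !inE.
  rewrite in_setD /S !in_set andbC; case: asboolP => [c|//]; rewrite !andTb.
  rewrite -[flatten _]/((x :: l') ++ flatten (rem l L)) mem_cat in_cons.
  rewrite (negPf (config_samecycle uL nL c (mem_head _ _))) orbF.
  by case: c => _ _ _ -> _ _ _ _; rewrite (negPf xZ).
have cardZ y : y \in flatten L' -> y != x -> y \notin Z ->
    #|x |: (y |: Z)| = #|Z|.+2 /\ (#|Z|.+2 <= size (flatten L'))%N.
  move=> yL yx yZ; have E2 : #|x |: (y |: Z)| = #|Z|.+2.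
    by rewrite !cardsU1 !inE yZ (negPf xZ) orbF eq_sym yx.
  split=> //; rewrite -E2 -(card_uniqP uL); apply: subset_leq_card.
  by apply/subsetP => z; rewrite !inE => /or3P [/eqP ->|/eqP ->|/(subsetP ZL)].
have ZL' y (M : seq D) : y \in flatten L' -> {subset flatten L' <= M} ->
    x |: (y |: Z) \subset M.
  move=> yL LM; apply/subsetP => z; rewrite !inE => /or3P [/eqP ->|/eqP ->|/(subsetP ZL)];
    exact: LM.
rewrite cS natrD A ?B.
- rewrite -mulrDr -cfD /boundary_prod [X in _ = _ * cf X _]big_cons.
  have -> : word P Z (x :: l') = (x \in P) :: word P Z l' by rewrite /word /= xZ.
  rewrite (boundary_cons bF) mulrDl mulr_suml.
  by rewrite -mulrA (mulr_suml (thirds _)).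
- move=> y y1 y2 y3 q V uV n0.
  have pV : perm_eq (flatten ((x :: [:: y1; y2; y3] ++ y :: l') :: rem l L)) (V ++ flatten L').
    by apply/seq.permP => p; rewrite /L' /= !count_cat /=; clear; lia.
  have yL : y \notin flatten L'.
    by move: uV; rewrite cat_uniq => /and3P [_ /hasPn h _]; apply/negP => /h; rewrite mem_head.
  have sz : size (flatten ((x :: [:: y1; y2; y3] ++ y :: l') :: rem l L)) =
      (4 + size (flatten L'))%N by rewrite (perm_size pV) size_cat.
  have mV := perm_mem pV.
  have yZ : y \notin Z by apply: contra yL => /(subsetP ZL).
  have yx : y != x by apply: contraNneq yL => ->.
  have cZ' : #|x |: (y |: Z)| = #|Z|.+2 by rewrite !cardsU1 !inE yZ (negPf xZ) orbF eq_sym yx.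
  apply: IH.
  + rewrite sz cZ'; move: ltN n0 cZ; clear; lia.
  + by rewrite (perm_uniq pV).
  + exact: nL.
  + apply/subsetP => z; rewrite mV mem_cat !in_setU1 => /or3P [/eqP ->|/eqP ->|/(subsetP ZL) ->].
    * by rewrite xL' orbT.
    * by rewrite mem_head.
    * by rewrite orbT.
  + apply/subsetP => z; rewrite mV mem_cat in_setU in_set.
    by case/orP => [/(subsetP PL) -> | /mem_mask ->]; rewrite ?orbT.
  + by rewrite sz cD; move: n0; clear; lia.
- move=> y l1 l2 El yZ.
  have pV : perm_eq (flatten ((x :: l2) :: (y :: l1) :: rem l L)) (flatten L').
    by apply/seq.permP => p; rewrite /L' El /= !count_cat /= count_cat; clear; lia.
  have yl : y \in l' by rewrite El mem_cat mem_head orbT.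
  have yL : y \in flatten L'.
    by rewrite -[flatten _]/((x :: l') ++ flatten (rem l L)) mem_cat in_cons yl orbT.
  have yx : y != x.
    move: uL; rewrite -[flatten _]/((x :: l') ++ flatten (rem l L)) cat_uniq.
    by case/andP => /andP [xl' _] _; apply: contraNneq xl' => <-.
  have [cZ1 cZ2] := cardZ y yL yx yZ.
  have mV := perm_mem pV.
  apply: IH.
  + rewrite (perm_size pV) cZ1; move: ltN cZ2; clear; lia.
  + by rewrite (perm_uniq pV).
  + exact: nL.
  + by apply: ZL' => // z; rewrite mV.
  + by apply: subs => // z; rewrite mV.
  + by rewrite (perm_size pV).
Qed.

End Count.

(** * Rooted maps up to isomorphism *)

Section Relabel.
Variable D : finType.
Implicit Types (s a f : {perm D}) (C O : {set D}) (m : rooted_oriented D).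
Local Open Scope nat_scope.

(** The counted maps, with their properties put in the form of the fields of [config]. *)
Definition quartic_peo m : Prop :=
  [/\ forall x, eflip m x != x /\ eflip m (eflip m x) = x,
      covers (vrot m) (eflip m) [set root_dart m],
      #|porbits (vrot m)| + #|porbits (eflip m)| + #|porbits (eflip m * vrot m)%g| = #|D| + 2,
      forall x, #|porbit (vrot m) x| = 4 /\ #|porbit (vrot m) x :&: tails m| = 2 &
      (forall x, (eflip m x \in tails m) = (x \notin tails m)) /\ root_dart m \in tails m].

Lemma card_uniform_porbits s k : (forall x, #|porbit s x| = k) -> #|D| = #|porbits s| * k.
Proof.
move=> sk; rewrite -cardsT (@card_fibers _ _ [set: D] (porbit s) (enum (porbits s))).
- rewrite (eq_big_seq (fun=> k)) => [|v]; first by rewrite big_const_seq count_predT iter_addn_0 -cardE mulnC.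
  rewrite mem_enum => /imsetP [x _ ->]; rewrite -(sk x); apply: eq_card => z.
  by rewrite !inE eq_porbit_mem.
- exact: enum_uniq.
- by move=> x _; rewrite mem_enum imset_f.
Qed.

Lemma card_porbit_pairing a : (forall x, a x != x /\ a (a x) = x) -> forall x, #|porbit a x| = 2.
Proof.
move=> ha x; have [ax aax] := ha x.
have -> : porbit a x = [set z in [:: x; a x]].
  apply/setP => z; rewrite inE; apply: fcycle_porbit; last by rewrite mem_head.
  by rewrite /= eqxx aax eqxx.
by rewrite cardsE (card_uniqP _) //= inE eq_sym ax.
Qed.

Lemma covers_connected s a r : covers s a [set r] <-> map_connected s a.
Proof.
set e := [rel u v | (v == s u) || (v == a u)]; split=> [cov|/forallP con C].
  apply/forallP => x; apply/forallP => y; pose C := [set z | connect e x z].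
  have st (t : {perm D}) : (forall z, e z (t z)) -> stable t C.
    by move=> et z; rewrite !in_set => xz; apply: connect_trans xz _; apply: connect1; exact: et.
  have sC : stable s C by apply: st => z; rewrite /= eqxx.
  have aC : stable a C by apply: st => z; rewrite /= eqxx orbT.
  have [rC|rC] := boolP (r \in C).
    have /setP/(_ y) : C = setT by apply: cov; rewrite ?sub1set.
    by rewrite !in_set.
  (* When the root is not reachable from [x], the complement of the reachable set is stable and
     contains the root, but it misses [x]. *)
  have /setP/(_ x) : ~: C = setT.
    by apply: cov; rewrite ?sub1set ?in_setC //; apply: stableC.
  by rewrite in_setC !in_set connect0.
rewrite sub1set => rC sC aC; apply/setP => y; rewrite inE.
have /connectP [p + ->] := forallP (con r) y.
elim: p r rC => //= z p IH r rC /andP [/orP [] /eqP -> ]; apply: IH; [exact: sC|exact: aC].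
Qed.

Lemma quartic_peoP n m : #|D| = 4 * n -> reflect (quartic_peo m)
  [&& planar_eulerian_orientation m, quartic (vrot m) & #|porbits (vrot m)| == n].
Proof.
move=> cD; apply: (iffP and3P) => [[/and4P [/and3P [/forallP pa con /eqP g0] /forallP or /forallP eu ro] /forallP q4 /eqP cn]|[pa con eu vt [or ro]]].
  have pa' x : eflip m x != x /\ eflip m (eflip m x) = x.
    by have /andP [-> /eqP ->] := pa x.
  have ca := card_uniform_porbits (card_porbit_pairing pa').
  split=> //.
  - exact/covers_connected.
  - by rewrite addnAC g0 ca; lia.
  - move=> x; have xs : porbit (vrot m) x \in porbits (vrot m) by rewrite imset_f.
    have /eqP o4 := implyP (q4 _) xs; have /eqP o2 := implyP (eu _) xs.
    by split=> //; have := cardsID (tails m) (porbit (vrot m) x); rewrite -o2 o4; lia.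
  - by split=> // x; apply/eqP.
have ca := card_uniform_porbits (card_porbit_pairing pa).
have cs : #|D| = #|porbits (vrot m)| * 4 by apply: card_uniform_porbits => x; case: (vt x).
split; last by apply/eqP; move: cs; rewrite cD; lia.
  apply/and4P; split=> //.
  - apply/and3P; split.
    + by apply/forallP => x; have [-> ->] := pa x; rewrite eqxx.
    + by apply/covers_connected; exact: con.
    + by apply/eqP; move: eu; rewrite ca; lia.
  - by apply/forallP => x; rewrite or.
  - apply/forallP => v; apply/implyP => /imsetP [x _ ->]; have [o4 o2] := vt x.
    by have := cardsID (tails m) (porbit (vrot m) x); rewrite o4 o2 => E; apply/eqP; lia.
by apply/forallP => v; apply/implyP => /imsetP [x _ ->]; have [-> _] := vt x.
Qed.

Definition relabel f m : rooted_oriented D :=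
  ((vrot m ^ f)%g, (eflip m ^ f)%g, f @: tails m, f (root_dart m)).

Lemma conjg_permE s f x : (s ^ f)%g (f x) = f (s x).
Proof. by rewrite conjgE !permM permK. Qed.

Lemma isomorphicP m1 m2 : reflect (exists f, m2 = relabel f m1) (isomorphic m1 m2).
Proof.
apply: (iffP existsP) => [[f /and4P [/forallP vf /forallP ef /forallP tf /eqP rf]]|[f ->]].
  exists f; case: m2 vf ef tf rf => [[[s a] O] r]; rewrite /relabel /vrot /eflip /tails /root_dart /=.
  move=> vf ef tf <-; congr (_, _, _, _).
  - by apply/permP => x; rewrite -(permKV f x) conjg_permE; apply/esym/eqP/vf.
  - by apply/permP => x; rewrite -(permKV f x) conjg_permE; apply/esym/eqP/ef.
  - by apply/setP => x; rewrite -(permKV f x) (mem_imset _ _ perm_inj); apply/eqP/tf.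
exists f; apply/and4P; split=> //; apply/forallP => x.
- by rewrite conjg_permE.
- by rewrite conjg_permE.
- by rewrite (mem_imset _ _ perm_inj).
Qed.

Lemma porbit_conj s f x : porbit (s ^ f)%g (f x) = f @: porbit s x.
Proof.
apply/setP => z; rewrite -(permKV f z) (mem_imset _ _ perm_inj).
have E i : ((s ^ f) ^+ i)%g (f x) = f ((s ^+ i)%g x) by rewrite -conjXg conjg_permE.
apply/porbitP/porbitP => - [i]; rewrite ?E; last by move=> ->; exists i; rewrite E.
by move=> /perm_inj ->; exists i.
Qed.

Lemma card_porbits_conj s f : #|porbits (s ^ f)%g| = #|porbits s|.
Proof.
have inj : injective (fun v : {set D} => f @: v) by apply: imset_inj; exact: perm_inj.
rewrite -[RHS](card_imset _ inj); apply: eq_card => v; apply/imsetP/imsetP.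
  by case=> x _ ->; exists (porbit s (f^-1%g x)); rewrite ?imset_f // -porbit_conj permKV.
by case=> _ /imsetP [x _ ->] ->; exists (f x); rewrite // porbit_conj.
Qed.

Lemma quartic_peo_relabel f m : quartic_peo m -> quartic_peo (relabel f m).
Proof.
case=> pa con eu vt [or ro].
have sur x : exists y, x = f y by exists (f^-1%g x); rewrite permKV.
split; rewrite /relabel /vrot /eflip /tails /root_dart /=.
- by move=> x; have [y ->] := sur x; rewrite !conjg_permE (inj_eq perm_inj); have [-> ->] := pa y.
- move=> C; rewrite sub1set => rC sC aC.
  have stC s : stable (s ^ f)%g C -> stable s (f @^-1: C).
    by move=> st y; rewrite !inE => yC; rewrite -conjg_permE; apply: st.
  have /setP E : f @^-1: C = setT by apply: con; [rewrite sub1set inE | exact: stC | exact: stC].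
  by apply/setP => x; have [y ->] := sur x; have := E y; rewrite !inE.
- by rewrite -conjMg !card_porbits_conj.
- move=> x; have [y ->] := sur x; rewrite porbit_conj -imsetI; last by move=> ? ? _ _; apply: perm_inj.
  by rewrite !card_imset; try exact: perm_inj; exact: vt.
- split=> [x|]; last by rewrite imset_f.
  by have [y ->] := sur x; rewrite conjg_permE !(mem_imset _ _ perm_inj) or.
Qed.

(** Rooted connected maps are rigid: two relabelings with equal results agree at the root, and the
    set where they agree is stable under both permutations. *)
Lemma relabel_inj m : quartic_peo m -> injective (relabel^~ m).
Proof.
case=> _ con _ _ _ f g [sfg afg _ rfg].
have st s : (s ^ f = s ^ g)%g -> stable s [set z | f z == g z].
  by move=> E z; rewrite !inE => /eqP fg; rewrite -(conjg_permE s f) -(conjg_permE s g) E fg.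
have /setP E : [set z | f z == g z] = setT.
  by apply: con; [rewrite sub1set inE rfg | exact: st | exact: st].
by apply/permP => z; have := E z; rewrite !inE => /eqP.
Qed.

Lemma relabelM f g m : relabel g (relabel f m) = relabel (f * g)%g m.
Proof.
rewrite /relabel /vrot /eflip /tails /root_dart /= !conjgM permM -imset_comp.
by congr (_, _, _, _); apply: eq_imset => x; rewrite /= permM.
Qed.

Lemma relabel1 m : relabel 1%g m = m.
Proof.
case: m => [[[s a] O] r]; rewrite /relabel /vrot /eflip /tails /root_dart /= !conjg1 perm1.
by congr (_, _, _, _); rewrite -[RHS]imset_id; apply: eq_imset => x; rewrite perm1.
Qed.

(** Each class is an orbit of the group of all permutations of the darts, which acts freely. *)
Lemma card_isomorphism_classes (M : {set rooted_oriented D}) : (forall m, m \in M <-> quartic_peo m) ->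
  #|M| = #|equivalence_partition (@isomorphic D) M| * #|D|`!.
Proof.
move=> MP; apply: card_uniform_partition; last first.
  apply: equivalence_partitionP => x y z _ _ _; split.
    by apply/isomorphicP; exists 1%g; rewrite relabel1.
  move=> /isomorphicP [f ->]; apply/isomorphicP/isomorphicP => - [g ->].
    by exists (f^-1 * g)%g; rewrite relabelM mulgA mulgV mul1g.
  by exists (f * g)%g; rewrite relabelM.
move=> _ /imsetP [m mM ->]; have /MP qm := mM.
have <- : #|[set: {perm D}]| = #|D|`!.
  rewrite -(cardsT D) -card_perm; apply: eq_card => f.
  by rewrite inE; apply/esym/subsetP => x; rewrite inE.
rewrite -[RHS](card_imset _ (relabel_inj qm)); apply: eq_card => m'.
rewrite inE; apply/andP/imsetP => [[_ /isomorphicP [f ->]]|[f _ ->]].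
  by exists f.
split; first by apply/MP/quartic_peo_relabel.
by apply/isomorphicP; exists f.
Qed.

End Relabel.

(** * Rooted quartic maps as configurations with one boundary cycle *)

Section QuarticCount.
Variables (D : finType) (K : numFieldType) (F : seq bool -> series K).
Hypothesis bF : boundary_series F.
Implicit Types (m : rooted_oriented D).

Definition root_key m := let s := vrot m in let r := root_dart m in
  [:: r; s r; s (s r); s (s (s r))].

(** The root vertex is declared to be the boundary. Its darts are read from the root dart, whose
    sign is [true], so balance leaves [thirds false] for the others. *)
Lemma quartic_peo_config (c : {perm D} * {perm D} * {set D}) r (t : seq D) q :
  uniq t -> size t = 4%N -> q \in thirds false -> r = head r t ->
  [/\ quartic_peo (c, r), root_key (c, r) = t & [seq z \in c.2 | z <- t] = true :: q] <->
  config [:: t] set0 [set z in mask (true :: q) t] c.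
Proof.
case: t => [|r' [|r1 [|r2 [|r3 [|]]]]] // ut _ qth ->; rewrite [head _ _]/=; set t := [:: r'; r1; r2; r3] in ut *.
case: c => [[s a] O].
set Q := [set z in mask _ t].
have sq : size (true :: q) = size t by move: qth; rewrite !inE => /or3P [] /eqP ->.
have Q2 : #|Q| = 2%N.
  rewrite cardsE (card_uniqP (mask_uniq ut _)) size_mask //.
  by move: qth; rewrite !inE => /or3P [] /eqP ->.
have rt : r' \in t by rewrite mem_head.
have ft : flatten [:: t] = t by [].
rewrite /root_key /vrot /root_dart [_.1]/= [_.2]/=.
split=> [[[pa con eu vt [or ro]] E /(signsE _ ut sq) OQ]|[]].
  rewrite /vrot /eflip /tails /root_dart /= in pa con eu vt or ro.
  have st : fcycle s t by have [o4 _] := vt r'; have := porbit4 o4; rewrite E.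
  have OQ' x : x \in t -> (x \in O) = (x \in Q).
    by move=> xt; rewrite /Q -OQ in_setI in_set xt andbT.
  split=> /=.
  - by rewrite [X in X && _](st : _ = true).
  - by move=> x _; apply: vt.
  - by move=> x; case: (pa x).
  - by move=> x; have [/negPf -> _] := pa x; rewrite inE.
  - by move=> x _; apply: or.
  - exact: OQ'.
  - move=> C tC sC aC; apply: con => //; rewrite sub1set; apply: (subsetP tC).
    by rewrite in_set mem_head.
  - by rewrite eu.
rewrite ft /= => sc vt aK aZ or sg con eu.
have st : fcycle s t by move: sc; rewrite andbT.
have OQ : O :&: [set z in t] = Q.
  apply/setP => z; rewrite in_setI in_set; case: (boolP (z \in t)) => zt.
    by rewrite andbT; apply: sg.
  by rewrite andbF in_set; apply/esym/negbTE; apply: contra zt => /mem_mask.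
split; last 1 first.
- by apply/(signsE _ ut sq).
- split; rewrite /vrot /eflip /tails /root_dart /=.
  + by move=> x; rewrite aZ inE aK.
  + move=> C; rewrite sub1set => rC sC aC; apply: con => //.
    apply/subsetP => z; rewrite in_set -(fcycle_porbit st rt).
    exact: (subsetP (stable_porbit sC rC)).
  + by rewrite eu.
  + move=> x; have [xt|xt] := boolP (x \in t); last exact: vt.
    have -> : porbit s x = [set z in t].
      by apply/setP => z; rewrite (fcycle_porbit st xt) in_set.
    by rewrite setIC OQ Q2 cardsE; split=> //; exact: (card_uniqP ut).
  + split=> [x|]; first by apply: or; rewrite inE.
    by rewrite sg // in_set mem_head.
- by move: st => /= /and5P [/eqP -> /eqP -> /eqP ->].
Qed.

Lemma card_quartic_peo n (M : {set rooted_oriented D}) : #|D| = (4 * n.+1)%N ->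
  (forall m, m \in M <-> quartic_peo m) ->
  #|M|%:R = (4 * n.+1)`!%:R * \sum_(q <- thirds false) cf (F (true :: q)) (2 * n) :> K.
Proof.
move=> cD MP.
pose ts := [seq tval t | t <- enum [set t : 4.-tuple D | all predT t & uniq t]].
pose key m := (root_key m, [seq z \in tails m | z <- root_key m]).
pose r := [seq (t, true :: q) | t <- ts, q <- thirds false].
have uts : uniq ts by rewrite map_inj_uniq ?enum_uniq //; exact: val_inj.
have ur : uniq r by apply: allpairs_uniq => // - [t1 q1] [t2 q2] _ _ [-> ->].
have ints t : t \in ts = (size t == 4%N) && uniq t.
  apply/mapP/andP => [[t']|[st ut]].
    by rewrite mem_enum inE => /andP [? ?] ->; rewrite size_tuple.
  by exists (Tuple st); rewrite // mem_enum inE all_predT.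
have szts : size ts = ((4 * n.+1) ^_ 4)%N by rewrite size_map -cardE card_uniq_tuples cD.
rewrite (@card_fibers _ _ _ key r ur); last first.
  move=> m /MP [_ _ _ vt [_ ro]]; have [o4 o2] := vt (root_dart m).
  set t := root_key m; have ft : fcycle (vrot m) t := porbit4 o4.
  have tP : porbit (vrot m) (root_dart m) =i t by apply: fcycle_porbit ft _; rewrite mem_head.
  have ut : uniq t by apply/card_uniqP; rewrite -(eq_card tP) o4.
  have cO : count [in tails m] t = 2%N.
    rewrite -o2 -size_filter -(card_uniqP (filter_uniq _ ut)); apply: eq_card => z.
    by rewrite mem_filter in_setI tP andbC.
  apply/allpairsP; exists (t, [seq z \in tails m | z <- behead t]); split=> /=.
  - by rewrite ints ut.
  - move: cO; rewrite /t /= ro; set s := vrot m.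
    by case: (s _ \in tails m); case: (s (s _) \in tails m); case: (s (s (s _)) \in tails m).
  - by rewrite /key -/t /t /= ro.
have fiber t q : t \in ts -> q \in thirds false ->
   #|[set m in M | key m == (t, true :: q)]|%:R = (4 * n)`!%:R * cf (F (true :: q)) (2 * n) :> K.
  rewrite ints => /andP [/eqP st ut] qth.
  have [r0 r0t] : exists r0, r0 = head r0 t by case: (t) st => // r0; exists r0.
  set Q := [set z in mask (true :: q) t].
  have -> : [set m in M | key m == (t, true :: q)] = [set (c, r0) | c in configs [:: t] set0 Q].
    apply/setP => - [c rm]; rewrite in_set; apply/andP/imsetP => [[/MP qm]|[c' + E]].
      rewrite xpair_eqE => /andP [/eqP Et /eqP Eq].
      have Er : rm = r0 by rewrite r0t -Et.
      exists c; last by rewrite -Er.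
      rewrite inE; apply/asboolP; apply/(quartic_peo_config _ ut st qth r0t).
      by rewrite -Er; split=> //; rewrite -Et.
    rewrite E; move: c' {E} => c'.
    rewrite inE => /asboolP /(quartic_peo_config _ ut st qth r0t) [qc kc sc].
    by split; [apply/MP | rewrite /key kc /tails /= sc].
  rewrite card_imset => [|c1 c2 [] //].
  have cs : count_spec F [:: t] set0 Q n.
    have ft : flatten [:: t] = t by rewrite /= cats0.
    apply: count_configs; rewrite ?ft //.
    - by rewrite /= andbT; case: (t) st.
    - by apply/subsetP => z; rewrite inE.
    - by apply/subsetP => z; rewrite in_set => /mem_mask.
    - by rewrite st cD mulnS.
  rewrite cs /boundary_prod big_seq1; congr (_ * cf _ _); congr F.
  rewrite /word (@eq_filter _ _ predT) => [|z]; last by rewrite inE.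
  rewrite filter_predT -[RHS](@mem_maskE _ t (true :: q)) //; last first.
    by rewrite st; move: qth; rewrite !inE => /or3P [] /eqP ->.
  by apply: eq_map => z; rewrite in_set.
rewrite natr_sum /r big_allpairs_dep.
rewrite (eq_big_seq (fun=> \sum_(q <- thirds false) (4 * n)`!%:R * cf (F (true :: q)) (2 * n))); last first.
  by move=> t tts; apply: eq_big_seq => q qth; apply: fiber.
rewrite big_const_seq count_predT szts iter_addr_0 -mulr_sumr.
by rewrite -[X in X = _]mulr_natl mulrA -natrM ffact_fact4.
Qed.
End QuarticCount.

(** The word [[:: false; true]] is a vertex of degree two inserted in the root edge. Peeling its
    ingoing dart absorbs the root vertex, and a rotation puts the outgoing dart in the place of the
    root dart. *)
Lemma quartic_peo_countE (K : numFieldType) (F : seq bool -> series K) n :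
  boundary_series F ->
  (quartic_peo_count n.+1)%:R = cf (F [:: false; true]) (2 * n.+1) :> K.
Proof.
move=> bF; set D := 'I_(4 * n.+1).
have cD : #|D| = (4 * n.+1)%N by rewrite card_ord.
rewrite /quartic_peo_count; set M := [set m | _].
have MP m : m \in M <-> quartic_peo m.
  by rewrite inE; split=> [/(quartic_peoP m cD)|/(quartic_peoP m cD)].
have f0 : (4 * n.+1)`!%:R != 0 :> K by rewrite Num.Theory.pnatr_eq0 -lt0n fact_gt0.
apply: (mulfI f0); have := card_quartic_peo bF cD MP.
rewrite (card_isomorphism_classes MP) cD natrM mulrC => ->; congr (_ * _).
rewrite (boundary_cons bF) cfD cf_serXnM mulnS addKn /= big_seq1 !(boundary_nil bF) mulr1.
rewrite cf1 add0r cf_sum; apply: eq_bigr => q _.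
by rewrite -cat1s (boundary_rot bF).
Qed.

(** * The cubic recursion *)

Section Splits.
Variable T : eqType.
Implicit Types (x y : T) (w : seq T).

Lemma splitsP x w p : p \in splits x w -> w = p.1 ++ x :: p.2.
Proof.
elim: w p => //= b w IH p; rewrite mem_cat => /orP [|/mapP [r /IH -> -> //]].
by case: eqP => // ->; rewrite inE => /eqP ->.
Qed.

Lemma splits_cat x w w' : splits x (w ++ w') =
  [seq (p.1, p.2 ++ w') | p <- splits x w] ++ [seq (w ++ p.1, p.2) | p <- splits x w'].
Proof.
elim: w => [|b w IH] /=; first by rewrite (@eq_map _ _ _ id) ?map_id // => - [].
by rewrite IH !map_cat -!map_comp catA; case: ifP.
Qed.

(** Both sides run over the ways to mark an [x] and, further right, a [y] in [w]. *)
Lemma splits_assoc (V : nmodType) x y w (G : seq T -> seq T -> seq T -> V) :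
  \sum_(p <- splits x w) \sum_(r <- splits y p.2) G p.1 r.1 r.2 =
  \sum_(p <- splits y w) \sum_(r <- splits x p.1) G r.1 r.2 p.2.
Proof.
elim: w G => [|b w IH] G; first by rewrite !big_nil.
rewrite [splits x _]/= [splits y _]/= !big_cat !big_map /= (IH (fun u => G (b :: u))).
have -> : \sum_(p <- if b == y then [:: ([::], w)] else [::]) \sum_(r <- splits x p.1) G r.1 r.2 p.2 = 0.
  by case: ifP => _; rewrite ?big_nil // big_seq1 big_nil.
under [in RHS]eq_bigr => p _ do rewrite [splits x _]/= big_cat big_map /=.
rewrite add0r big_split /=; congr (_ + _).
case: ifP => _; last by rewrite big_nil big1 // => p _; rewrite big_nil.
by rewrite big_seq1; apply: eq_bigr => p _; rewrite big_seq1.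
Qed.

Lemma splits_notin x w : x \notin w -> splits x w = [::].
Proof.
by elim: w => //= b w IH; rewrite inE negb_or eq_sym => /andP [/negPf -> /IH ->].
Qed.

Lemma splits_map (T' : eqType) (g : T -> T') x w : injective g ->
  splits (g x) (map g w) = [seq (map g p.1, map g p.2) | p <- splits x w].
Proof.
move=> inj; elim: w => //= b w IH; rewrite (inj_eq inj) IH map_cat -!map_comp.
by congr (_ ++ _); case: ifP.
Qed.

End Splits.

Section Congruence.
Variable K : comNzRingType.
Implicit Types (f g h : series K).

Definition eqe e f g := forall i, (i <= e)%N -> cf f i = cf g i.

Lemma eqe_trans e g f h : eqe e f g -> eqe e g h -> eqe e f h.
Proof. by move=> fg gh i ie; rewrite fg // gh. Qed.
Lemma eqeD e f g f' g' : eqe e f f' -> eqe e g g' -> eqe e (f + g) (f' + g').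
Proof. by move=> ff gg i ie; rewrite !cfD ff // gg. Qed.
Lemma eqeM e f g f' g' : eqe e f f' -> eqe e g g' -> eqe e (f * g) (f' * g').
Proof.
move=> ff gg i ie; rewrite !cfM; apply: eq_bigr => j _.
rewrite ff ?gg //; first exact: leq_trans (leq_subr _ _) ie.
by apply: leq_trans ie; rewrite -ltnS.
Qed.

Lemma eqe_sum (I : eqType) e (r : seq I) (F G : I -> series K) :
  {in r, forall i, eqe e (F i) (G i)} -> eqe e (\sum_(i <- r) F i) (\sum_(i <- r) G i).
Proof. by move=> FG j je; rewrite !cf_sum; apply: eq_big_seq => i /FG; apply. Qed.
Lemma eqeX e f g : (forall e', e = e'.+1 -> eqe e' f g) -> eqe e (serX K * f) (serX K * g).
Proof.
move=> fg [|i] ie; rewrite !cf_serXM //.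
by case: e fg ie => // e fg ie; apply: (fg e).
Qed.
End Congruence.

(* [None] is the undirected edge; an alternating quartic vertex splits in two
   ways, a non-alternating one in a single way, along such an edge. *)
Notation letter := (option bool).

Definition dual (a : letter) : letter := omap negb a.

Section Cubic.
Variables (K : comNzRingType) (zeta : K).
Hypothesis zeta2 : zeta ^+ 2 = zeta - 1.
Local Notation theta := (1 - zeta).
Implicit Types (a b : letter) (w u v : seq letter).

Definition edge_weight a : K := if a is Some _ then 1 else theta.

(** Read counterclockwise, a cubic vertex with signs [false], [None], [true] weighs [zeta], and one
    with [false], [true], [None] weighs 1. The scalar listed is this weight times [edge_weight a],
    for the edge through which the vertex is entered; for [None] this gives [zeta * theta = 1] and
    [theta]. *)
Definition vertices a : seq (letter * letter * K) :=
  match a with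
  | None => [:: (Some true, Some false, 1); (Some false, Some true, theta)]
  | Some true => [:: (Some true, None, 1); (None, Some true, zeta)]
  | Some false => [:: (Some false, None, zeta); (None, Some false, 1)]
  end.

Definition peel_rhs (W : seq letter -> series K) a w : series K :=
  serC (edge_weight a) * \sum_(p <- splits (dual a) w) W p.1 * W p.2
  + serX K * \sum_(x <- vertices a) serC x.2 * W (x.1.1 :: x.1.2 :: w).

(* [k] is fuel: [peel_rhs] lowers [2 * e + size w] for the coefficient of order [e]. *)
Fixpoint Wf k w : series K :=
  if k is k'.+1 then if w is a :: w' then peel_rhs (Wf k') a w' else 1 else 0.

Definition W w : series K := Series (fun e => cf (Wf (2 * e + size w).+1 w) e).

Lemma eqe_peel e a w F G :
  (forall i u, (2 * i + size u < 2 * e + (size w).+1)%N -> cf (F u) i = cf (G u) i) ->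
  eqe e (peel_rhs F a w) (peel_rhs G a w).
Proof.
move=> FG; apply: eqeD; [apply: eqeM => // | apply: eqeX => e' Ee].
  apply: eqe_sum => p /splitsP wp; apply: eqeM => i ie; apply: FG;
    by rewrite wp size_cat /=; lia.
by apply: eqe_sum => x _; apply: eqeM => // i ie; apply: FG; rewrite /=; lia.
Qed.

Lemma Wf_stable k k' e w : (2 * e + size w < k)%N -> (2 * e + size w < k')%N ->
  cf (Wf k w) e = cf (Wf k' w) e.
Proof.
elim: k k' e w => // k IH [//|k'] e [|a w] //= ek ek'.
suff h : eqe e (peel_rhs (Wf k) a w) (peel_rhs (Wf k') a w) by exact: h.
by apply: eqe_peel => i u iu; apply: IH; lia.
Qed.

Lemma W_nil : W [::] = 1.
Proof. by apply/seriesP. Qed.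

Lemma W_cons a w : W (a :: w) = peel_rhs W a w.
Proof.
apply/seriesP => e; rewrite /W [LHS]/=.
suff h : eqe e (peel_rhs (Wf (2 * e + (size w).+1)) a w) (peel_rhs W a w) by exact: h.
by apply: eqe_peel => i u iu; apply: Wf_stable => //=; lia.
Qed.

Definition peel_rhs_last w a : series K :=
  serC (edge_weight a) * \sum_(p <- splits (dual a) w) W p.1 * W p.2
  + serX K * \sum_(x <- vertices a) serC x.2 * W (w ++ [:: x.1.1; x.1.2]).

(** Both sides describe one cubic vertex joined to the letters [a] and [b], whose third dart is
    passed to [G]. Its weight times both edge weights does not depend on the edge through which it
    is entered. *)
Lemma vertices_sym a b (G : letter -> series K) :
  \sum_(x <- vertices b) serC x.2 * (serC (edge_weight a) * (if x.1.2 == dual a then G x.1.1 else 0))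
  = \sum_(x <- vertices a) serC x.2 * (serC (edge_weight b) * (if x.1.1 == dual b then G x.1.2 else 0)).
Proof.
have z2 : (serC zeta) ^+ 2 = serC zeta - 1 by rewrite -rmorphXn zeta2 rmorphB rmorph1.
case: a b => [[]|] [[]|]; rewrite /= !big_cons !big_nil /= ?rmorphB ?rmorph1 ?mulr0 ?addr0 ?add0r ?mul1r ?mulr1 //.
all: ring: z2.
Qed.

Lemma dualK : involutive dual. Proof. by case=> [[]|]. Qed.

Lemma edge_weight_dual a : edge_weight (dual a) = edge_weight a. Proof. by case: a. Qed.

Lemma sum_lin (R : comNzRingType) (I : Type) (r : seq I) (F A B : I -> R) x y :
  \sum_(i <- r) F i * (x * A i + y * B i) =
  x * \sum_(i <- r) F i * A i + y * \sum_(i <- r) F i * B i.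
Proof. by rewrite !mulr_sumr -big_split; apply: eq_bigr => i _ /=; ring. Qed.

Lemma sum_splits_cons x b w : \sum_(p <- splits x (b :: w)) W p.1 * W p.2 =
  (if b == x then W w else 0) + \sum_(p <- splits x w) W (b :: p.1) * W p.2.
Proof.
rewrite [splits _ _]/= big_cat big_map; congr (_ + _).
by case: ifP => _; rewrite ?big_nil // big_seq1 W_nil mul1r.
Qed.

Lemma sum_splits_cat2 x p q w : \sum_(r <- splits x (w ++ [:: p; q])) W r.1 * W r.2 =
  (if q == x then W (rcons w p) else 0) + (if p == x then W w * W [:: q] else 0)
  + \sum_(r <- splits x w) W r.1 * W (r.2 ++ [:: p; q]).
Proof.
rewrite splits_cat big_cat !big_map addrC; congr (_ + _).
rewrite /= big_cat /= addrC; case: (p == x); case: (q == x);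
  by rewrite /= ?big_cons ?big_nil /= ?cats0 ?cats1 ?W_nil ?mulr1 ?addr0 ?add0r // addrC.
Qed.

Lemma peel_swap e a b w :
  (forall i u c, (2 * i + (size u).+1 < 2 * e + (size w).+2)%N ->
     cf (W (rcons u c)) i = cf (peel_rhs_last u c) i) ->
  (forall i c u, (2 * i + (size u).+1 < 2 * e + (size w).+2)%N ->
     cf (W (c :: u)) i = cf (W (rcons u c)) i) ->
  eqe e (peel_rhs W b (rcons w a)) (peel_rhs_last (b :: w) a).
Proof.
move=> IH rot.
pose ga := serC (edge_weight a); pose gb := serC (edge_weight b); pose X := serX K.
(* The possible fates of [b] and [a]: both meet letters of [w] ([A1]), they meet each other ([A2]),
   one meets a letter and the other opens a vertex ([A3], [A4]), they open different vertices
   ([A5]), or they meet the same vertex, whose third dart is separated from [w] ([A6]) or not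
   ([A7]). *)
pose A1 := \sum_(p <- splits (dual b) w) W p.1 *
  \sum_(r <- splits (dual a) p.2) W r.1 * W r.2.
pose A3 := \sum_(p <- splits (dual b) w) W p.1 *
  \sum_(x <- vertices a) serC x.2 * W (p.2 ++ [:: x.1.1; x.1.2]).
pose A4 := \sum_(x <- vertices b) serC x.2 *
  \sum_(p <- splits (dual a) w) W [:: x.1.1, x.1.2 & p.1] * W p.2.
pose A5 := \sum_(x <- vertices b) serC x.2 *
  \sum_(y <- vertices a) serC y.2 * W ([:: x.1.1, x.1.2 & w] ++ [:: y.1.1; y.1.2]).
pose G6 c := W [:: c] * W w.
pose G7 c := W (c :: w).
pose G7' c := W (rcons w c).
pose A2 := if a == dual b then gb * W w else 0.
pose A6 := \sum_(x <- vertices b) serC x.2 * (ga * (if x.1.2 == dual a then G6 x.1.1 else 0)).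
pose A7 := \sum_(x <- vertices a) serC x.2 * (gb * (if x.1.2 == dual b then G7 x.1.1 else 0)).
pose A7' := \sum_(x <- vertices a) serC x.2 * (gb * (if x.1.2 == dual b then G7' x.1.1 else 0)).
have L1 : eqe e (peel_rhs W b (rcons w a))
    (gb * (\sum_(p <- splits (dual b) w) W p.1 * peel_rhs_last p.2 a +
           (if a == dual b then W w else 0))
     + X * \sum_(x <- vertices b) serC x.2 * peel_rhs_last [:: x.1.1, x.1.2 & w] a).
  apply: eqeD; [apply: eqeM => // | apply: eqeX => e' Ee].
    rewrite -cats1 splits_cat big_cat !big_map; apply: eqeD.
      apply: eqe_sum => p /splitsP wp; apply: eqeM => // i ie.
      by rewrite cats1; apply: IH; rewrite wp size_cat /=; lia.
    by rewrite /=; case: ifP => _; rewrite ?big_nil // big_seq1 /= cats0 W_nil mulr1.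
  apply: eqe_sum => x _; apply: eqeM => // i ie.
  by rewrite -!rcons_cons; apply: IH; rewrite /=; lia.
have L2 : gb * (\sum_(p <- splits (dual b) w) W p.1 * peel_rhs_last p.2 a +
           (if a == dual b then W w else 0))
     + X * \sum_(x <- vertices b) serC x.2 * peel_rhs_last [:: x.1.1, x.1.2 & w] a
   = gb * ga * A1 + A2 + X * gb * A3 + X * ga * A4 + X * X * A5 + X * A6 + X * A7.
  rewrite /peel_rhs_last !sum_lin -/ga -/X -/A1 -/A3 -/A5.
  have -> : \sum_(x <- vertices b) serC x.2 * (\sum_(p <- splits (dual a) [:: x.1.1, x.1.2 & w]) W p.1 * W p.2)
      = \sum_(x <- vertices b) serC x.2 * (if x.1.1 == dual a then G7 x.1.2 else 0)
        + \sum_(x <- vertices b) serC x.2 * (if x.1.2 == dual a then G6 x.1.1 else 0) + A4.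
    rewrite -!big_split; apply: eq_bigr => x _ /=; rewrite -!mulrDr; congr (_ * _).
    rewrite sum_splits_cons [splits _ _]/= big_cat !big_map -addrA; congr (_ + _); congr (_ + _).
    by case: ifP => _; rewrite ?big_nil ?big_seq1.
  have -> : X * A7 = X * (ga * \sum_(x <- vertices b) serC x.2 * (if x.1.1 == dual a then G7 x.1.2 else 0)).
    rewrite /A7 vertices_sym; congr (X * _); rewrite mulr_sumr.
    by apply: eq_bigr => x _; rewrite -/ga; ring.
  have -> : A6 = ga * \sum_(x <- vertices b) serC x.2 * (if x.1.2 == dual a then G6 x.1.1 else 0).
    by rewrite /A6 mulr_sumr; apply: eq_bigr => x _; ring.
  by rewrite /A2; case: ifP => _; ring.
(* Seen from [b] or from [a], the third dart comes first or last in the remaining word. The factor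
   [serX] lowers the order, so the rotation invariance at hand applies. *)
have E7 : eqe e (X * A7) (X * A7').
  apply: eqeX => e' Ee; apply: eqe_sum => x _; do 2!apply: eqeM => //; case: ifP => // _ i ie.
  by apply: rot; lia.
apply: (eqe_trans L1); rewrite L2.
apply: (@eqe_trans _ _ (gb * ga * A1 + A2 + X * gb * A3 + X * ga * A4 + X * X * A5 + X * A6 + X * A7')).
  by apply: eqeD.
suff -> : peel_rhs_last (b :: w) a =
  gb * ga * A1 + A2 + X * gb * A3 + X * ga * A4 + X * X * A5 + X * A6 + X * A7' by [].
rewrite /peel_rhs_last sum_splits_cons -/ga -/X.
have -> : \sum_(p <- splits (dual a) w) W (b :: p.1) * W p.2 = gb * A1 + X * A4.
  under eq_bigr => p _ do rewrite W_cons mulrC /peel_rhs.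
  rewrite sum_lin; congr (_ * _ + _ * _).
    rewrite /A1; under [in RHS]eq_bigr => p _ do rewrite mulr_sumr.
    rewrite (splits_assoc _ _ _ (fun u v v' => W u * (W v * W v'))); apply: eq_bigr => p _.
    by rewrite mulr_sumr; apply: eq_bigr => r _; ring.
  rewrite /A4; under [in RHS]eq_bigr => p _ do rewrite mulr_sumr.
  rewrite exchange_big; apply: eq_bigr => p _ /=.
  by rewrite mulr_sumr; apply: eq_bigr => r _; ring.
have -> : \sum_(x <- vertices a) serC x.2 * W ((b :: w) ++ [:: x.1.1; x.1.2])
  = gb * A3 + X * A5 + A6 + A7'.
  under eq_bigr => x _ do rewrite cat_cons W_cons /peel_rhs sum_splits_cat2.
  rewrite sum_lin -/gb -/X.
  have -> : X * A5 = X * (\sum_(x <- vertices a) serC x.2 *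
     \sum_(y <- vertices b) serC y.2 * W [:: y.1.1, y.1.2 & w ++ [:: x.1.1; x.1.2]]).
    rewrite /A5; under eq_bigr => x _ do rewrite mulr_sumr.
    rewrite exchange_big; congr (_ * _); apply: eq_bigr => x _ /=.
    by rewrite mulr_sumr; apply: eq_bigr => r _; ring.
  rewrite /A6 vertices_sym -/gb.
  have -> : gb * A3 = gb * \sum_(x <- vertices a) serC x.2 *
      \sum_(r <- splits (dual b) w) W r.1 * W (r.2 ++ [:: x.1.1; x.1.2]).
    rewrite /A3; under eq_bigr => x _ do rewrite mulr_sumr.
    rewrite exchange_big; congr (_ * _); apply: eq_bigr => x _ /=.
    by rewrite mulr_sumr; apply: eq_bigr => r _; ring.
  rewrite !mulr_sumr -!big_split; apply: eq_bigr => x _ /=.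
  by rewrite /G6 /G7'; case: ifP => _; case: ifP => _; ring.
have -> : (if b == dual a then W w else 0) = if a == dual b then W w else 0.
  by congr (if _ then _ else _); rewrite -(inj_eq (inv_inj dualK)) dualK eq_sym.
rewrite /A2; case: eqP => [E|_]; last by ring.
have Eg : gb = ga by rewrite /ga /gb E edge_weight_dual.
by rewrite Eg; ring.
Qed.

(* Peeling the first letter commutes with peeling the last one ([peel_swap]), so that both peelings
   define the same series. *)
Lemma W_sym N :
  (forall i u c, (2 * i + (size u).+1 < N)%N -> cf (W (rcons u c)) i = cf (peel_rhs_last u c) i) /\
  (forall i c u, (2 * i + (size u).+1 < N)%N -> cf (W (c :: u)) i = cf (W (rcons u c)) i).
Proof.
elim: N => // N [IH1 IH2].
have H1 i u c : (2 * i + (size u).+1 < N.+1)%N -> cf (W (rcons u c)) i = cf (peel_rhs_last u c) i.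
  case: u => [|b w] lt; first by rewrite W_cons /peel_rhs /peel_rhs_last.
  rewrite rcons_cons W_cons; apply: (@peel_swap i) => // j u c' ltj.
    by apply: IH1; apply: leq_trans ltj _; move: lt; rewrite /=; lia.
  by apply: IH2; apply: leq_trans ltj _; move: lt; rewrite /=; lia.
split=> // i c u lt; rewrite H1 // W_cons; suff : eqe i (peel_rhs W c u) (peel_rhs_last u c) by apply.
apply: eqeD => //; apply: eqeX => e' Ee; apply: eqe_sum => x _; apply: eqeM => // j je.
rewrite IH2 /=; last by move: lt; lia.
rewrite -cats1 /= IH2 ?size_cat /=; last by move: lt; lia.
by rewrite -!cats1 -catA.
Qed.

Lemma W_rot1 c u : W (c :: u) = W (rcons u c).
Proof. by apply/seriesP => i; apply: (W_sym (2 * i + (size u).+1).+1).2. Qed.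

Lemma W_rot u v : W (u ++ v) = W (v ++ u).
Proof.
elim: u v => [|a u IH] v; first by rewrite cats0.
by rewrite cat_cons W_rot1 rcons_cat IH cat_rcons.
Qed.

Lemma W_None w : None \notin w ->
  W (None :: w) = serX K * (W [:: Some true, Some false & w] + serC theta * W [:: Some false, Some true & w]).
Proof.
move=> nw; rewrite W_cons /peel_rhs splits_notin // big_nil mulr0 add0r /= !big_cons big_nil addr0.
by rewrite rmorph1 mul1r.
Qed.

(** Peeling a directed letter into a cubic vertex creates one undirected letter. No other one is
    present for it to meet, so it opens a second cubic vertex. Of the three sign patterns, two arise
    once, with weight 1 or [zeta * theta], and the alternating one twice, with weights [zeta] and
    [theta]. *)
Lemma boundary_series_W : boundary_series (fun l : seq bool => W (map Some l)).
Proof.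
split=> [|b w|u v]; first exact: W_nil; last by rewrite !map_cat W_rot.
have nw (l : seq bool) : None \notin map Some l by elim: l.
have z2 : serC zeta ^+ 2 = serC zeta - 1 by rewrite -rmorphXn zeta2 rmorphB rmorph1.
have tE : serC theta = 1 - serC zeta by rewrite rmorphB rmorph1.
rewrite map_cons W_cons /peel_rhs /= (splits_map (~~ b) w (g := @Some bool)); last by move=> ? ? [].
rewrite big_map /= rmorph1 mul1r; congr (_ + _); rewrite expr2 -mulrA; congr (_ * _).
have first c : W [:: Some c, None & map Some w] =
   serX K * (W [:: Some c, Some true, Some false & map Some w]
             + serC theta * W [:: Some c, Some false, Some true & map Some w]).
  rewrite W_rot1 rcons_cons W_None; last by rewrite -map_rcons.
  by rewrite -!rcons_cons -!W_rot1.
case: b; rewrite /= !big_cons !big_nil /= !first !W_None // ?in_cons ?nw // ?rmorph1 tE; ring: z2.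
Qed.

(** Each cubic vertex has one undirected dart, and undirected darts, including those of the
    boundary, are paired by edges. *)
Lemma Wf_parity k e w : odd (e + count_mem None w) -> cf (Wf k w) e = 0.
Proof.
elim: k e w => [|k IH] e [|a w] /= odd_e; rewrite ?cf0 //; first by rewrite cf1; case: e odd_e.
rewrite cfD cf_serCM cf_serXM cf_sum big_seq big1 ?mulr0 ?add0r => [|p /splitsP wp].
  case: e odd_e => // e odd_e; rewrite cf_sum big1_seq // => x /andP [_ xv].
  rewrite cf_serCM IH ?mulr0 //; move: xv odd_e.
  by case: a => [[]|]; rewrite 2!inE => /orP [] /eqP ->; rewrite /= ?add0n ?add1n ?addSn ?addnS /= ?negbK.
rewrite cfM big1 // => i _.
have [oi|oi] := boolP (odd (i + count_mem None p.1)); first by rewrite IH ?mul0r.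
rewrite [X in _ * X]IH ?mulr0 //; move: odd_e; have := ltn_ord i; rewrite ltnS => ie.
have ke := subnKC ie; set k' := (e - i)%N in ke *; have -> : (e + ((a == None) + count_mem None w) =
   (i + count_mem None p.1) + (k' + count_mem None p.2) + (a == None).*2)%N.
  by rewrite wp count_cat /=; move: ke; case: a {wp} => [[]|] /=; clear; lia.
by rewrite oddD odd_double addbF oddD (negPf oi).
Qed.

Lemma W_parity e w : odd (e + count_mem None w) -> cf (W w) e = 0.
Proof. exact: Wf_parity. Qed.

Definition Wd n := W (nseq n None).
Definition Wh m n := W (Some true :: nseq m None ++ Some false :: nseq n None).

Lemma sum_splits_nseq (V : nmodType) (G : nat -> nat -> V) n :
  \sum_(p <- splits None (nseq n (None : letter))) G (size p.1) (size p.2)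
  = \sum_(i < n) G i (n.-1 - i)%N.
Proof.
elim: n G => [|n IH] G; first by rewrite big_nil big_ord0.
rewrite /= big_cons big_map size_nseq big_ord_recl subn0 (IH (fun i j => G i.+1 j)).
congr (_ + _); apply: eq_bigr => i _; rewrite lift0; congr G.
by case: n i {IH} => [[]//|n] i; rewrite !succnK subSS.
Qed.

(** The peeled letter meets another undirected one, or opens a vertex with two directed darts; these
    are adjacent on the boundary, whence the index 0 in [Wh]. At [n = 0] the truncated [n.-1] is
    harmless, the sum being empty. *)
Lemma WdS n : Wd n.+1 = serC theta * \sum_(i < n) Wd i * Wd (n.-1 - i)
  + serX K * (Wh 0 n + serC theta * Wh n 0).
Proof.
rewrite /Wd /= W_cons /peel_rhs -(sum_splits_nseq (fun i j => Wd i * Wd j)).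
congr (_ * _ + _ * _).
  apply: eq_big_seq => p /splitsP E; have nn u : all (pred1 None) u -> u = nseq (size u) None.
    by move/all_pred1P.
  have : all (pred1 None) (nseq n (None : letter)) by apply/all_pred1P; rewrite size_nseq.
  by rewrite E all_cat /= /Wd => /andP [/nn {1}-> /nn {1}->].
rewrite /= !big_cons big_nil addr0 /= rmorph1 mul1r /Wh /=; congr (_ + _ * _).
by rewrite W_rot1 rcons_cons -cats1.
Qed.

(** The letter [true] can only meet the single [false]. A cubic vertex keeps one directed letter and
    adds an undirected one on either side of it, so the number of directed letters stays two and the
    system closes. *)
Lemma WhE m n : Wh m n = Wd m * Wd n + serX K * (Wh m.+1 n + serC zeta * Wh m n.+1).
Proof.
have nd (b : bool) k : Some b \notin nseq k (None : letter) by elim: k.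
rewrite {1}/Wh W_cons /peel_rhs /= rmorph1 mul1r splits_cat splits_notin // /= splits_notin //=.
rewrite big_seq1 cats0 /= !big_cons big_nil addr0 /= rmorph1 mul1r; congr (_ + _ * (_ + _ * _)).
rewrite (W_rot1 None) rcons_cons rcons_cat rcons_cons /Wh.
by congr (W (_ :: _ ++ _ :: _)); elim: n => //= n ->.
Qed.
End Cubic.

(** * Poles and residues of rational functions *)

Section RationalFunctions.
Variable K : fieldType.
Local Notation L := {fraction {poly K}}.
Local Notation "p %:F" := (tofrac p) : ring_scope.
Implicit Types (f g h : L) (p q : {poly K}) (c r v : K).

Definition ratC c : L := (c%:P)%:F.
Fact ratC_additive : zmod_morphism ratC.
Proof. by move=> a b; rewrite /ratC polyCB tofracB. Qed.
HB.instance Definition _ := GRing.isZmodMorphism.Build K L ratC ratC_additive.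
Fact ratC_monoid : monoid_morphism ratC.
Proof. by split=> [|a b]; rewrite /ratC ?polyC1 ?tofrac1 // polyCM tofracM. Qed.
HB.instance Definition _ := GRing.isMonoidMorphism.Build K L ratC ratC_monoid.

Definition ratX : L := ('X : {poly K})%:F.

Lemma divff_eq p q p' q' : q != 0 -> q' != 0 ->
  (p%:F / q%:F == p'%:F / q'%:F) = (p * q' == p' * q).
Proof. by move=> q0 q0'; rewrite eqr_div ?tofrac_eq0 // -!tofracM tofrac_eq. Qed.

Definition regular_at c f := exists p q, q.[c] != 0 /\ f = p%:F / q%:F.

(** Says that [f - v] has a numerator of smaller degree than its denominator. *)
Definition value_at_oo f v :=
  exists p q, [/\ q != 0, f = p%:F / q%:F & (size (p - v *: q)%R < size q)%N].

Lemma horner_neq0 q c : q.[c] != 0 -> q != 0.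
Proof. by apply: contraNneq => ->; rewrite horner0. Qed.

Lemma regular_poly c p : regular_at c p%:F.
Proof. by exists p, 1; rewrite hornerC oner_neq0 tofrac1 divr1. Qed.

Lemma regular_ratC c v : regular_at c (ratC v). Proof. exact: regular_poly. Qed.

Lemma regularD c f g : regular_at c f -> regular_at c g -> regular_at c (f + g).
Proof.
move=> [p [q [qc ->]]] [p' [q' [q'c ->]]]; exists (p * q' + p' * q), (q * q').
rewrite hornerM mulf_neq0 //; split=> //.
by rewrite addf_div ?tofrac_eq0 ?(horner_neq0 (c := c)) // -!tofracM -tofracD.
Qed.

Lemma regularM c f g : regular_at c f -> regular_at c g -> regular_at c (f * g).
Proof.
move=> [p [q [qc ->]]] [p' [q' [q'c ->]]]; exists (p * p'), (q * q').
by rewrite hornerM mulf_neq0 // mulf_div !tofracM.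
Qed.

Lemma regularN c f : regular_at c f -> regular_at c (- f).
Proof. by move=> [p [q [qc ->]]]; exists (- p), q; rewrite tofracN mulNr. Qed.

Lemma regularV c p : p.[c] != 0 -> regular_at c (p%:F)^-1.
Proof. by move=> pc; exists 1, p; rewrite tofrac1 mul1r. Qed.

Lemma value_ratC v : value_at_oo (ratC v) v.
Proof.
exists v%:P, 1; rewrite oner_neq0 tofrac1 divr1; split=> //.
by rewrite -mul_polyC mulr1 subrr size_poly0 size_poly1.
Qed.

Lemma size_valued p q v : (size (p - v *: q)%R < size q)%N -> (size p <= size q)%N.
Proof.
move=> lt; rewrite -(subrK (v *: q) p); apply: leq_trans (size_polyD _ _) _.
by rewrite geq_max (ltnW lt) size_scale_leq.
Qed.

Lemma ltn_size_mul p q q' : (size p < size q)%N -> q' != 0 -> (size (p * q')%R < size (q * q')%R)%N.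
Proof.
move=> lt q0; have [->|p0] := eqVneq p 0.
  rewrite mul0r size_poly0 size_poly_gt0 mulf_neq0 //.
  by rewrite -size_poly_gt0; apply: leq_trans lt.
have qn0 : q != 0 by rewrite -size_poly_gt0; apply: leq_ltn_trans lt.
rewrite !size_mul //; move: q0 lt; rewrite -size_poly_gt0.
by case: (size q') => // m _ lt; rewrite !addnS /= ltn_add2r.
Qed.

Lemma valueD f g v w : value_at_oo f v -> value_at_oo g w -> value_at_oo (f + g) (v + w).
Proof.
move=> [p [q [q0 -> lt]]] [p' [q' [q0' -> lt']]]; exists (p * q' + p' * q), (q * q').
split; first exact: mulf_neq0.
  by rewrite addf_div ?tofrac_eq0 // -!tofracM -tofracD.
have -> : p * q' + p' * q - (v + w) *: (q * q') = (p - v *: q) * q' + (p' - w *: q') * q.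
  by rewrite -!mul_polyC polyCD; ring.
apply: leq_ltn_trans (size_polyD _ _) _; rewrite gtn_max ltn_size_mul //=.
by rewrite [q * q']mulrC ltn_size_mul.
Qed.

Lemma valueM f g v w : value_at_oo f v -> value_at_oo g w -> value_at_oo (f * g) (v * w).
Proof.
move=> [p [q [q0 -> lt]]] [p' [q' [q0' -> lt']]]; exists (p * p'), (q * q').
split; first exact: mulf_neq0.
  by rewrite mulf_div !tofracM.
have -> : p * p' - (v * w) *: (q * q') = (p - v *: q) * p' + (v *: (p' - w *: q')) * q.
  by rewrite -!mul_polyC polyCM; ring.
apply: leq_ltn_trans (size_polyD _ _) _; rewrite gtn_max; apply/andP; split.
  have [->|p0'] := eqVneq p' 0; first by rewrite mulr0 size_poly0 size_poly_gt0 mulf_neq0.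
  apply: leq_trans (ltn_size_mul lt p0') _; rewrite !size_mul //.
  by rewrite -!subn1 leq_sub2r // leq_add2l (size_valued lt').
rewrite [q * q']mulrC ltn_size_mul //; apply: leq_ltn_trans lt'; exact: size_scale_leq.
Qed.

Lemma valueN f v : value_at_oo f v -> value_at_oo (- f) (- v).
Proof.
move=> fv; rewrite -mulN1r -[- v]mulN1r; apply: valueM => //.
by rewrite -(rmorphN1 ratC); apply: value_ratC.
Qed.

Lemma value_div p q v : q != 0 -> (size (p - v *: q)%R < size q)%N -> value_at_oo (p%:F / q%:F) v.
Proof. by move=> q0 lt; exists p, q. Qed.

(** Here [f] is [p / 'X^(k.+1)] plus a function regular at 0, so the coefficient of index [k] of [p]
    belongs to the power -1. The degree of [p] is left free, which allows [k] to be raised at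
    will. *)
Definition residue_at0 f r := exists k p h,
  [/\ f * ratX ^+ k.+1 = p%:F + ratX ^+ k.+1 * h, regular_at 0 h & p`_k = r].

Lemma residue_shift f r : residue_at0 f r -> exists k, forall l, exists p h,
  [/\ f * ratX ^+ (k + l).+1 = p%:F + ratX ^+ (k + l).+1 * h, regular_at 0 h & p`_(k + l) = r].
Proof.
move=> [k [p [h [E hr pk]]]]; exists k => l; exists (p * 'X^l), h; split=> //.
  by rewrite -addSn exprD mulrA E tofracM tofracXn /ratX; ring.
by rewrite coefMXn ltnNge leq_addl /= addnK.
Qed.

Lemma residueD f g r s : residue_at0 f r -> residue_at0 g s -> residue_at0 (f + g) (r + s).
Proof.
move=> /residue_shift [k Hf] /residue_shift [l Hg].
have [p [h [E hr pk]]] := Hf l; have [p' [h' [E' hr' pk']]] := Hg k.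
rewrite addnC in E' pk'; exists (k + l)%N, (p + p'), (h + h'); split.
- by rewrite mulrDl E E' tofracD; ring.
- exact: regularD.
- by rewrite coefD pk pk'.
Qed.

Lemma residueZ c f r : residue_at0 f r -> residue_at0 (ratC c * f) (c * r).
Proof.
move=> [k [p [h [E hr pk]]]]; exists k, (c%:P * p), (ratC c * h); split.
- by rewrite -mulrA E tofracM /ratC; ring.
- by apply: regularM => //; apply: regular_ratC.
- by rewrite coefCM pk.
Qed.

Lemma residue_regular f : regular_at 0 f -> residue_at0 f 0.
Proof. by move=> fr; exists 0%N, 0, f; rewrite tofrac0 add0r mulrC coef0. Qed.

Lemma residue_sum (I : Type) (s : seq I) (F : I -> L) (G : I -> K) :
  (forall i, residue_at0 (F i) (G i)) -> residue_at0 (\sum_(i <- s) F i) (\sum_(i <- s) G i).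
Proof.
move=> FG; elim: s => [|i s IH]; last by rewrite !big_cons; apply: residueD.
by rewrite !big_nil; apply: residue_regular; rewrite -(rmorph0 ratC); apply: regular_ratC.
Qed.

Lemma ratX_neq0 : ratX != 0.
Proof. by rewrite tofrac_eq0 polyX_eq0. Qed.

Lemma residue_Xn n : residue_at0 (ratX ^- n.+1) (n == 0%N)%:R.
Proof.
exists n, 1, 0; rewrite mulVf ?expf_neq0 ?ratX_neq0 // mulr0 addr0 tofrac1 coef1; split=> //.
by rewrite -(rmorph0 ratC); apply: regular_ratC.
Qed.

(** By linearity it suffices to treat the function 0. There ['X^(k.+1)] divides the product of [p]
    with a denominator that is nonzero at 0, hence divides [p]. *)
Lemma residue_uniq f r s : residue_at0 f r -> residue_at0 f s -> r = s.
Proof.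
move=> fr fs; have {fr fs} : residue_at0 0 (r - s).
  rewrite -(subrr f) -mulN1r -[- s]mulN1r -(rmorphN1 ratC); apply: residueD => //.
  by rewrite rmorphN1 -(rmorphN1 ratC); apply: residueZ.
case=> k [p [h [E [a [b [b0 Eh]]] pk]]]; move: E; rewrite {h}Eh mul0r => E; apply/eqP; rewrite -subr_eq0 -pk.
have {}E : p * b = 'X^(k.+1) * - a.
  apply/eqP; rewrite -tofrac_eq !tofracM tofracXn tofracN; apply/eqP.
  have b0' : b%:F != 0 :> L by rewrite tofrac_eq0 (horner_neq0 b0).
  have Ep : p%:F = - (ratX ^+ k.+1 * (a%:F / b%:F)).
    by apply/eqP; rewrite -addr_eq0 -E.
  by rewrite Ep mulNr -mulrA divfK // mulrN.
have cop : coprimep 'X^(k.+1) b.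
  by apply: coprimep_expl; rewrite coprimep_sym -['X]subr0 coprimep_XsubC.
have dv : 'X^(k.+1) %| p by rewrite -(Gauss_dvdpl p cop) E dvdp_mulr.
by rewrite -(divpK dv) coefMXn ltnSn.
Qed.

End RationalFunctions.

Section Liouville.
Variable K : closedFieldType.
Local Notation "p %:F" := (tofrac p) : ring_scope.

(** In lowest terms a non-constant denominator has a root, which would be a pole; and a polynomial
    with a finite value at infinity is constant. *)
Lemma liouville (f : {fraction {poly K}}) v :
  (forall c, regular_at c f) -> value_at_oo f v -> f = ratC v.
Proof.
move=> fr [p1 [q1 [q10 E1 lt1]]].
have [p [q [pq q0 E]]] : exists p q, [/\ coprimep p q, q != 0 & f = p%:F / q%:F].
  pose d := gcdp p1 q1; have d0 : d != 0 by rewrite gcdp_eq0 negb_and q10 orbT.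
  exists (p1 %/ d), (q1 %/ d); split.
  - by apply: coprimep_div_gcd; rewrite q10 orbT.
  - by rewrite dvdp_div_eq0 ?dvdp_gcdr.
  - apply/eqP; rewrite E1 divff_eq ?dvdp_div_eq0 ?dvdp_gcdr //; apply/eqP.
    rewrite -{1}(divpK (dvdp_gcdl p1 q1)) -{4}(divpK (dvdp_gcdr p1 q1)) -/d; ring.
have q1s : size q == 1%N.
  apply: contraT => /closed_rootP [c qc].
  have [p' [q' [q'c E']]] := fr c.
  move/eqP: E; rewrite E' divff_eq ?(horner_neq0 q'c) // => /eqP /(congr1 (horner^~ c)).
  rewrite !hornerM (rootP qc) mulr0 => /esym/eqP; rewrite mulf_eq0 (negPf q'c) orbF => pc.
  by have := coprimep_root pq pc; rewrite (rootP qc) eqxx.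
have [c c0 Ec] := size_poly1P _ q1s.
have Ef : f = (p * (c^-1)%:P)%:F.
  by rewrite E tofracM Ec -[(c^-1)%:P%:F]/(ratC _) fmorphV.
apply/eqP; rewrite Ef /ratC tofrac_eq.
set P := p * _ in Ef *; move: lt1.
have -> : p1 = P * q1.
  apply/eqP; rewrite -tofrac_eq tofracM -Ef E1; apply/eqP.
  by rewrite divfK // tofrac_eq0.
rewrite -mul_polyC -mulrBl; have [P0|nP] := eqVneq (P - v%:P) 0; last first.
  rewrite size_mul //; move: nP; rewrite -size_poly_gt0.
  by case: (size (P - v%:P)) => // m _; rewrite addSn /= ltnNge leq_addl.
by move=> _; rewrite -subr_eq0 P0.
Qed.
End Liouville.

(** * The cubic with constant value *)

Section Curve.
Variables (R : comNzRingType) (z t : R).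
Hypothesis z2 : z ^+ 2 = z - 1.
Local Notation T := ((1 - z) * t).
Local Notation j := (z - 1).
Local Notation j2 := (- z).

(** The factors 1, [j], [j2] are the cube roots of unity. The product relations eliminate [a0] and
    [b0] from the first combination; in the second all [a] and [b] cancel, and the constants add up
    to [T * (1 + j + j2) = 0]. *)
Lemma quadratic_relation w0 w1 w2 a0 a1 a2 b0 b1 b2 u0 u1 u2 :
  u0 * w0 = 1 + (1 - z) * t * w0 ^+ 2 + t * (b0 + (1 - z) * a0) ->
  u1 * w1 = 1 + (1 - z) * t * w1 ^+ 2 + t * (b1 + (1 - z) * a1) ->
  u2 * w2 = 1 + (1 - z) * t * w2 ^+ 2 + t * (b2 + (1 - z) * a2) ->
  w0 * w1 = b1 + z * a0 -> w1 * w2 = b2 + z * a1 -> w2 * w0 = b0 + z * a2 ->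
  let e0 := T * w0 in let e1 := j * T * w1 in let e2 := j2 * T * w2 in
  let v0 := u0 in let v1 := j * u1 in let v2 := j2 * u2 in
  [/\ v0 * e0 - e0 ^+ 2 + e0 * e1 + e0 * e2 = T + T ^+ 2 * (j * b1 + j2 * z * a2) &
      v0 * e0 + v1 * e1 + v2 * e2 - e0 ^+ 2 - e1 ^+ 2 - e2 ^+ 2 + e0 * e1 + e1 * e2 + e2 * e0 = 0].
Proof.
move=> H0 H1 H2 H01 H12 H20 /=; split.
  rewrite (_ : u0 * (T * w0) = T * (u0 * w0)); last by ring.
  rewrite (_ : T * w0 * (j * T * w1) = T ^+ 2 * j * (w0 * w1)); last by ring.
  rewrite (_ : T * w0 * (j2 * T * w2) = T ^+ 2 * j2 * (w2 * w0)); last by ring.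
  rewrite H0 H01 H20; ring: z2.
rewrite (_ : u0 * (T * w0) = T * (u0 * w0)); last by ring.
rewrite (_ : T * w0 * (j * T * w1) = T ^+ 2 * j * (w0 * w1)); last by ring.
rewrite (_ : j2 * T * w2 * (T * w0) = T ^+ 2 * j2 * (w2 * w0)); last by ring.
rewrite (_ : j * T * w1 * (j2 * T * w2) = T ^+ 2 * j * j2 * (w1 * w2)); last by ring.
rewrite (_ : j * u1 * (j * T * w1) = j * j * T * (u1 * w1)); last by ring.
rewrite (_ : j2 * u2 * (j2 * T * w2) = j2 * j2 * T * (u2 * w2)); last by ring.
rewrite H0 H1 H2 H01 H12 H20; ring: z2.
Qed.

(* The three differences of the [e_i - v_i / 3] have zero sum and are permuted by the
   monodromy, so they are the roots of a cubic whose coefficients are polynomials. *)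
Lemma cubic_form (e0 e1 e2 v0 v1 v2 J : R) :
  v0 + v1 + v2 = 0 ->
  v0 * e0 - e0 ^+ 2 + e0 * e1 + e0 * e2 = J ->
  v0 * e0 + v1 * e1 + v2 * e2 - e0 ^+ 2 - e1 ^+ 2 - e2 ^+ 2 + e0 * e1 + e1 * e2 + e2 * e0 = 0 ->
  27%:R * ((e0 - e1) * (e0 - e1 - v0) * (e0 - e1 + v1)) =
  (3 * (e1 - e2) - (v1 - v2)) * (9 * J - 9 * (e1 * e2) - 3 * (e2 * (v0 - v1))
     + 3 * (e1 * (v2 - v0)) + (v2 - v0) * (v0 - v1))
  + (v1 - v2) * (v2 - v0) * (v0 - v1).
Proof.
move=> vs <- P; have -> : v2 = - v0 - v1 by rewrite -[v2](addKr (v0 + v1)) vs; ring.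
have {}P : v0 * e0 + v1 * e1 + (- v0 - v1) * e2 - e0 ^+ 2 - e1 ^+ 2 - e2 ^+ 2 + e0 * e1 + e1 * e2 + e2 * e0 = 0.
  by rewrite -P; have -> : v2 = - v0 - v1 by rewrite -[v2](addKr (v0 + v1)) vs; ring.
apply/eqP; rewrite -subr_eq0; apply/eqP.
(* The difference of the two sides is the vanishing quadratic form times an explicit linear form. *)
transitivity ((- 9) * (3 * (e0 - e1) - (v0 - v1)) * (v0 * e0 + v1 * e1 + (- v0 - v1) * e2 - e0 ^+ 2 - e1 ^+ 2 - e2 ^+ 2 + e0 * e1 + e1 * e2 + e2 * e0)).
  ring.
by rewrite P mulr0.
Qed.

Lemma cubic_rot (e0 e1 e2 v0 v1 v2 : R) :
  v0 + v1 + v2 = 0 ->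
  v0 * e0 + v1 * e1 + v2 * e2 - e0 ^+ 2 - e1 ^+ 2 - e2 ^+ 2 + e0 * e1 + e1 * e2 + e2 * e0 = 0 ->
  (e0 - e1) * (e0 - e1 - v0) * (e0 - e1 + v1) = (e1 - e2) * (e1 - e2 - v1) * (e1 - e2 + v2).
Proof.
move=> vs P; have Ev : v2 = - v0 - v1 by rewrite -[v2](addKr (v0 + v1)) vs; ring.
apply/eqP; rewrite -subr_eq0; apply/eqP; rewrite Ev in P *.
rewrite -[RHS](mulr0 (- (e0 - 2 * e1 + e2 + v1))) -P; ring.
Qed.
End Curve.

Section Sumpow.
Variable R : comNzRingType.
Implicit Types (y : series R) (f g : nat -> series R).

Lemma vanishMl k (f g : series R) : vanish k f -> vanish k (f * g).
Proof. by move=> fk; rewrite mulrC; apply: vanishMr. Qed.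

Lemma vanish_serX : vanish 1 (serX R).
Proof. by case. Qed.

(** The difference of the two sides is [y] times the same difference for the shifted [f], so it
    vanishes to every order. *)
Lemma sumpow_cauchy y f g : vanish 1 y ->
  sumpow y (fun n => \sum_(i < n.+1) f i * g (n - i)%N) = sumpow y f * sumpow y g.
Proof.
move=> y1; apply/eqP; rewrite -subr_eq0; apply/eqP/vanish_eq0 => k.
elim: k f => // k IH f.
have -> : sumpow y (fun n => \sum_(i < n.+1) f i * g (n - i)%N) =
   f 0%N * sumpow y g + y * sumpow y (fun n => \sum_(i < n.+1) f i.+1 * g (n - i)%N).
  rewrite sumpowS // big_ord1 (sumpowS g) // mulrDr -addrA; congr (_ + _).
  rewrite mulrCA -mulrDr -(sumpowM (f 0%N)) // -sumpowD; congr (y * _); apply: eq_sumpow => n /=.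
  rewrite big_ord_recl subn0; congr (_ + _).
rewrite (sumpowS f) // mulrDl -mulrA opprD addrACA subrr add0r -mulrBr.
by apply: (vanishM (k := 1)) => //; exact: IH.
Qed.
End Sumpow.

Section InfinityField.
Variables (E : fieldType) (z u : E).
Hypotheses (z2 : z ^+ 2 = z - 1) (u0 : u != 0) (u1 : 1 - u != 0).
Local Notation v := ((1 - z) * (1 - u)).

Lemma theta_neq0 : 1 - z != 0.
Proof.
apply/eqP => h; have : (1 - z) * z = 1 by ring: z2.
by rewrite h mul0r => /esym/eqP; rewrite oner_eq0.
Qed.

Lemma invf_v : v^-1 = z * (1 - u)^-1.
Proof.
rewrite invfM; congr (_ * _); apply: (mulfI theta_neq0); rewrite divff ?theta_neq0 //; ring: z2.
Qed.

(** At infinity the leading terms of the series at [u] and [v] cancel in this combination, which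
    decays like [u ^- 2]; this cancellation makes the cubic finite there. *)
Lemma first_order : u ^+ 2 * (u^-1 - (z - 1) * v^-1) = u * (1 - u)^-1.
Proof.
rewrite invf_v; have -> : (z - 1) * (z * (1 - u)^-1) = - (1 - u)^-1.
  rewrite mulrA; have -> : (z - 1) * z = -1 by ring: z2.
  by rewrite mulN1r.
by field; rewrite u1 u0.
Qed.

Lemma second_order : u ^+ 2 * (u^-1 ^+ 2 - (z - 1) * v^-1 ^+ 2) = 1 + z * (u * (1 - u)^-1) ^+ 2.
Proof.
rewrite invf_v mulrBr exprVn mulfV ?expf_neq0 //; congr (1 + _).
by move: (1 - u)^-1 => s; ring: z2.
Qed.
End InfinityField.

(** * Series in the catalytic variable *)

Section GeneratingFunctions.
Variables (E : fieldType) (M : nat -> series E) (h : nat -> nat -> series E) (zeta : E).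
Local Notation X := (serX E).
Local Notation z := (serC zeta).
Local Notation theta := (serC (1 - zeta)).
Hypothesis M0 : M 0%N = 1.
Hypothesis MS : forall n, M n.+1 = theta * \sum_(i < n) M i * M (n.-1 - i)%N
  + X * (h 0 n + theta * h n 0%N).
Hypothesis hE : forall m n, h m n = M m * M n + X * (h m.+1 n + z * h m n.+1).

(** The marker of an undirected letter is the inverse of [u] scaled by [X]. The sums over all word
    lengths then converge in powers of [X], for any nonzero [u] in the coefficient field. *)
Definition step u : series E := X * serC u^-1.

Lemma vanish_step u : vanish 1 (step u).
Proof. exact/vanishMl/vanish_serX. Qed.

Definition Gd u := sumpow (step u) M.
Definition Ga u := sumpow (step u) (h^~ 0%N).
Definition Gb u := sumpow (step u) (h 0%N).

Lemma Gd_eq u : Gd u = 1 + theta * step u ^+ 2 * Gd u ^+ 2 + step u * X * (Gb u + theta * Ga u).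
Proof.
have y1 := @vanish_step u.
rewrite {1}/Gd sumpowS // M0 -addrA; congr (_ + _).
have -> : M \o succn = fun n => theta * \sum_(i < n) M i * M (n.-1 - i)%N
    + X * (h 0 n + theta * h n 0%N) by apply/funext.
rewrite sumpowD !sumpowM // sumpowD sumpowM // -/(Ga u) -/(Gb u).
have -> : sumpow (step u) (fun n => \sum_(i < n) M i * M (n.-1 - i)%N) = step u * (Gd u * Gd u).
  rewrite sumpowS // big_ord0 add0r -sumpow_cauchy //.
by ring.
Qed.

(** Kernel method: in the equation of the double series [H] of all [h m n], the coefficient of [H]
    is [1 - u - zeta * v]. Where it vanishes, [H] drops out and a relation between one-variable
    series remains. *)
Lemma Gd_mul u v : u != 0 -> v != 0 -> u + zeta * v = 1 ->
  Gd u * Gd v = serC u * Gb v + z * serC v * Ga u.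
Proof.
move=> u0 v0 uv; have yu := @vanish_step u; have yv := @vanish_step v.
have Xu : serC u * step u = X by rewrite /step mulrCA -rmorphM mulfV // rmorph1 mulr1.
have Xv : serC v * step v = X by rewrite /step mulrCA -rmorphM mulfV // rmorph1 mulr1.
pose e m := sumpow (step v) (h m).
have e_shift m : X * sumpow (step v) (h m \o succn) = serC v * (e m - h m 0%N).
  by rewrite /e (sumpowS (h m)) // addrC addKr mulrA Xv.
have eE m : e m = M m * Gd v + X * e m.+1 + z * (serC v * (e m - h m 0%N)).
  rewrite -e_shift {1}/e (eq_sumpow _ (hE m)) sumpowD !sumpowM // sumpowD sumpowM // -/(Gd v).
  rewrite -/(e m.+1); ring.
pose H := sumpow (step u) e.
have H_shift : X * sumpow (step u) (e \o succn) = serC u * (H - Gb v).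
  by rewrite /H (sumpowS e) // addrC addKr mulrA Xu.
have : H = Gd u * Gd v + serC u * (H - Gb v) + z * serC v * (H - Ga u).
  rewrite -H_shift {1}/H (eq_sumpow _ eE).
  have -> : (fun m => M m * Gd v + X * e m.+1 + z * (serC v * (e m - h m 0%N))) =
     fun m => (Gd v * M m + X * (e \o succn) m) + (z * serC v) * (e m + -1 * h m 0%N).
    by apply/funext => m /=; ring.
  by rewrite !sumpowD !sumpowM // sumpowD sumpowM // -/(Gd u) -/(Ga u) -/H mulN1r [Gd v * _]mulrC.
have : serC u + z * serC v = 1 by rewrite -rmorphM -rmorphD uv rmorph1.
clear H_shift; clearbody H.
move: H (Gd u * Gd v) (Gb v) (Ga u) (serC u) (z * serC v); clear.
move=> H g b a p q E1 E2; have -> : g = H - p * (H - b) - q * (H - a) by rewrite {1}E2; ring.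
by rewrite -[X in X - _ - _]mul1r -E1; ring.
Qed.

Hypothesis zeta2 : zeta ^+ 2 = zeta - 1.
Local Notation T := ((1 - z) * X ^+ 2).
Local Notation j := (z - 1).

Lemma thetaE : theta = 1 - z.
Proof. by rewrite rmorphB rmorph1. Qed.

Lemma z2 : z ^+ 2 = z - 1.
Proof. by rewrite -rmorphXn zeta2 rmorphB rmorph1. Qed.

Definition gd u := serC u^-1 * Gd u.
Definition ga u := serC u^-1 * Ga u.
Definition gb u := serC u^-1 * Gb u.

Lemma gd_eq u : u != 0 ->
  serC u * gd u = 1 + (1 - z) * X ^+ 2 * gd u ^+ 2 + X ^+ 2 * (gb u + (1 - z) * ga u).
Proof.
move=> u0; rewrite /gd mulrA -rmorphM mulfV // rmorph1 mul1r.
rewrite {1}Gd_eq thetaE /step /ga /gb; congr (_ + _ + _).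
  by move: (Gd _) (serC _) (serC _) => a b c; ring.
by move: (Ga _) (Gb _) (serC _) (serC _) => a b c d; ring.
Qed.

Lemma gd_mul u v : u != 0 -> v != 0 -> u + zeta * v = 1 -> gd u * gd v = gb v + z * ga u.
Proof.
move=> u0 v0 uv; rewrite /gd mulrACA (Gd_mul u0 v0 uv) /ga /gb mulrDr.
have iu : serC u^-1 * serC u = 1 :> series E by rewrite -rmorphM mulVf // rmorph1.
have iv : serC v^-1 * serC v = 1 :> series E by rewrite -rmorphM mulVf // rmorph1.
move: (serC u^-1) (serC u) (serC v^-1) (serC v) (Gb v) (Ga u) (z) iu iv.
move=> iu' su iv' sv b a c iu iv.
transitivity ((iu' * su) * (iv' * b) + c * ((iu' * a) * (iv' * sv))); first by ring.
by rewrite iu iv !mul1r mulr1.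
Qed.

Definition curve u v := (T * gd u - j * T * gd v) * (T * gd u - j * T * gd v - serC u)
  * (T * gd u - j * T * gd v + j * serC v).

(* The arguments at which [gd_mul] relates each series to the next one, cyclically. *)
Definition triple (u v x : E) := [/\ u != 0, v != 0, x != 0 &
  [/\ u + zeta * v = 1, v + zeta * x = 1 & x + zeta * u = 1]].

Lemma triple_rot u v x : triple u v x -> triple v x u.
Proof. by case=> ? ? ? []. Qed.

Lemma triple_sum u v x : triple u v x -> serC u + j * serC v + - z * serC x = 0.
Proof.
case=> _ _ _ [uv vx xu].
have -> : x = 1 - zeta * u by rewrite -xu addrK.
have Ev : v = (1 - zeta) * (1 - u).
  have -> : 1 - u = zeta * v by rewrite -uv addrAC subrr add0r.
  by ring: zeta2.
rewrite Ev !(rmorphB, rmorphM, rmorph1) /=; have := z2; move: (serC u) (serC zeta) => a b b2.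
by ring: b2.
Qed.

(* The right-hand side does not involve [gd u], hence has no pole at [u = 0]. *)
Lemma curve_cubic u v x : triple u v x ->
  27%:R * curve u v =
  (3 * (j * T * gd v - (- z) * T * gd x) - (j * serC v - (- z) * serC x)) *
  (9 * (T + T ^+ 2 * (j * gb v + - z * z * ga x)) - 9 * ((j * T * gd v) * ((- z) * T * gd x))
   - 3 * (((- z) * T * gd x) * (serC u - j * serC v))
     + 3 * ((j * T * gd v) * ((- z) * serC x - serC u))
     + ((- z) * serC x - serC u) * (serC u - j * serC v))
  + (j * serC v - (- z) * serC x) * ((- z) * serC x - serC u) * (serC u - j * serC v).
Proof.
move=> tr; have sum0 := triple_sum tr; case: tr => u0 v0 x0 [uv vx xu].
have [HJ HP] := quadratic_relation z2 (gd_eq u0) (gd_eq v0) (gd_eq x0)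
  (gd_mul u0 v0 uv) (gd_mul v0 x0 vx) (gd_mul x0 u0 xu).
exact: cubic_form sum0 HJ HP.
Qed.

Lemma curve_rot u v x : triple u v x -> curve u v = curve v x.
Proof.
move=> tr; have sum0 := triple_sum tr; case: tr => u0 v0 x0 [uv vx xu].
have [_ HP] := quadratic_relation z2 (gd_eq u0) (gd_eq v0) (gd_eq x0)
  (gd_mul u0 v0 uv) (gd_mul v0 x0 vx) (gd_mul x0 u0 xu).
rewrite /curve (cubic_rot sum0 HP).
have zz := z2; move: (gd v) (gd x) (serC v) (serC x) (z) X zz => a b c d w y w2.
ring: w2.
Qed.

Definition gd_tail u := sumpow (step u) (fun n => M n.+2).

Lemma gd_expand u : gd u = serC u^-1 + X * M 1 * serC (u^-1 ^+ 2)
  + X ^+ 2 * serC (u^-1 ^+ 3) * gd_tail u.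
Proof.
rewrite /gd /Gd sumpowS ?M0; last exact: vanish_step.
rewrite sumpowS; last exact: vanish_step.
rewrite -[sumpow _ (_ \o _ \o _)]/(gd_tail u) [(M \o succn) 0%N]/= /step !rmorphXn /=.
move: (gd_tail u) (serC u^-1) (M 1) X => a b c d; ring.
Qed.

(** [A] is [u ^+ 2] times the difference of the two series, in a form where the value at infinity
    can be read off. Each of the other two factors of the cubic is divided by [u] in exchange. *)
Lemma curve_expand u v : u != 0 -> 1 - u != 0 -> v = (1 - zeta) * (1 - u) ->
  let A := T * (serC (u * (1 - u)^-1) + X * M 1 * serC (1 + zeta * (u * (1 - u)^-1) ^+ 2)
    + X ^+ 2 * (serC u^-1 * gd_tail u
        - j * serC (zeta ^+ 3 * (u * (1 - u)^-1) ^+ 2 * (1 - u)^-1) * gd_tail v)) in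
  curve u v = A * (serC (u^-1 ^+ 3) * A - 1) *
    (serC (u^-1 ^+ 3) * A + j * serC ((1 - zeta) * (u^-1 - 1))).
Proof.
move=> u0 u1 Ev A.
have iv : v^-1 = zeta * (1 - u)^-1 by rewrite Ev invf_v.
have h1 : serC u^-1 = serC (u ^+ 2) * serC (u^-1 ^+ 3).
  by rewrite -rmorphM (exprS _ 2) exprVn mulrCA mulfV ?mulr1 // expf_neq0.
have h3 : zeta ^+ 3 * (u * (1 - u)^-1) ^+ 2 * (1 - u)^-1 = u ^+ 2 * v^-1 ^+ 3.
  by rewrite iv; move: (1 - u)^-1 => w; ring.
have EA : A = T * (serC (u ^+ 2) * (gd u - j * gd v)).
  rewrite /A h1 h3 -(second_order zeta2 u0) -(first_order zeta2 u0 u1) -Ev !gd_expand.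
  rewrite !(rmorphM, rmorphB, rmorph1) /=.
  move: (gd_tail u) (gd_tail v) (serC (u ^+ 2)) (serC u^-1) (serC v^-1) => a b d e f.
  move: (serC (u^-1 ^+ 2)) (serC (v^-1 ^+ 2)) (serC (u^-1 ^+ 3)) (serC (v^-1 ^+ 3)) => g k l m.
  by move: z (M 1) X => y n o; ring.
have u2 : serC (u^-1 ^+ 2) * serC (u ^+ 2) = 1 by rewrite -rmorphM exprVn mulVf ?rmorph1 ?expf_neq0.
have eta : serC (u^-1 ^+ 3) * A = serC u^-1 * (T * gd u - j * T * gd v).
  rewrite EA (exprS _ 2) rmorphM /=; move: u2; move: (serC (u ^+ 2)) (serC (u^-1 ^+ 2)) (serC u^-1) (gd u) (gd v).
  move=> a b c d e ab.
  transitivity ((b * a) * (c * (T * d - j * T * e))); first by ring.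
  by rewrite ab mul1r.
have uu : serC u^-1 * serC u = 1 by rewrite -rmorphM mulVf ?rmorph1.
have -> : (1 - zeta) * (u^-1 - 1) = u^-1 * v.
  by rewrite Ev [RHS]mulrCA mulrBr [X in _ = _ * X]mulrBr !mulr1 mulVf // mulrBr mulr1.
rewrite eta rmorphM /=.
have -> : A = serC u ^+ 2 * (T * gd u - j * T * gd v).
  by rewrite EA rmorphXn /=; move: (serC u) (gd u) (gd v) => a b d; ring.
rewrite /curve; move: (T * gd u - j * T * gd v) => e.
move: (serC u^-1) (serC u) (serC v) (j) uu => p a b w pa.
transitivity ((p * a) ^+ 2 * (e * (e - a) * (e + w * b))); first by rewrite pa expr1n mul1r.
transitivity (a ^+ 2 * e * (p * e - p * a) * (p * e + w * (p * b))); first by ring.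
by rewrite pa.
Qed.
End GeneratingFunctions.

(** * Poles and values at infinity, coefficient by coefficient *)

Section SeriesRegularity.
Variable K : fieldType.
Local Notation L := {fraction {poly K}}.
Implicit Types (f g : series L).
Local Notation lift := (ser_map (@ratC K)).

Definition regularS c f := forall e, regular_at c (cf f e).
Definition valueS f (g : series K) := forall e, value_at_oo (cf f e) (cf g e).

Lemma regular_sum c (I : Type) (r : seq I) (F : I -> L) :
  (forall i, regular_at c (F i)) -> regular_at c (\sum_(i <- r) F i).
Proof.
move=> h; apply: (big_ind (regular_at c)) => //; last by move=> *; apply: regularD.
by rewrite -(rmorph0 (@ratC K)); apply: regular_ratC.
Qed.

Lemma value_sum (I : Type) (r : seq I) (F : I -> L) (G : I -> K) :
  (forall i, value_at_oo (F i) (G i)) -> value_at_oo (\sum_(i <- r) F i) (\sum_(i <- r) G i).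
Proof.
move=> h; apply: (big_ind2 (@value_at_oo K)) => //; last by move=> *; apply: valueD.
by rewrite -(rmorph0 (@ratC K)); apply: value_ratC.
Qed.

Lemma regularS_lift c (g : series K) : regularS c (lift g).
Proof. by move=> e; apply: regular_ratC. Qed.
Lemma valueS_lift (g : series K) : valueS (lift g) g.
Proof. by move=> e; apply: value_ratC. Qed.

Lemma regularSD c f g : regularS c f -> regularS c g -> regularS c (f + g).
Proof. by move=> fr gr e; apply: regularD. Qed.
Lemma regularSN c f : regularS c f -> regularS c (- f).
Proof. by move=> fr e; apply: regularN. Qed.
Lemma regularSM c f g : regularS c f -> regularS c g -> regularS c (f * g).
Proof. by move=> fr gr e; rewrite cfM; apply: regular_sum => i; apply: regularM. Qed.
Lemma valueSD f g v w : valueS f v -> valueS g w -> valueS (f + g) (v + w).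
Proof. by move=> fr gr e; apply: valueD. Qed.
Lemma valueSN f v : valueS f v -> valueS (- f) (- v).
Proof. by move=> fr e; apply: valueN. Qed.
Lemma valueSM f g v w : valueS f v -> valueS g w -> valueS (f * g) (v * w).
Proof. by move=> fr gr e; rewrite !cfM; apply: value_sum => i; apply: valueM. Qed.

Lemma regularSX c f n : regularS c f -> regularS c (f ^+ n).
Proof.
move=> fr; elim: n => [|n IH]; last by rewrite exprS; apply: regularSM.
by rewrite expr0 -(rmorph1 lift); apply: regularS_lift.
Qed.

Lemma valueSX f v n : valueS f v -> valueS (f ^+ n) (v ^+ n).
Proof.
move=> fr; elim: n => [|n IH]; last by rewrite !exprS; apply: valueSM.
by rewrite !expr0 -(rmorph1 lift); apply: valueS_lift.
Qed.

Lemma regularS_C c (f : L) : regular_at c f -> regularS c (serC f).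
Proof.
move=> fr [|e] //; rewrite /cf /=.
by rewrite -(rmorph0 (@ratC K)); apply: regular_ratC.
Qed.

Lemma valueS_C (f : L) v : value_at_oo f v -> valueS (serC f) (serC v).
Proof.
move=> fr [|e] //; rewrite /cf /=.
by rewrite -(rmorph0 (@ratC K)); apply: value_ratC.
Qed.

Lemma regularS_serX c : regularS c (serX L).
Proof. by rewrite -(ser_mapX (@ratC K)); apply: regularS_lift. Qed.

Lemma regularS_sumpow c y (g : nat -> series L) : regularS c y -> (forall n, regularS c (g n)) ->
  regularS c (sumpow y g).
Proof.
move=> yr gr e; rewrite cf_sumpow; apply: regular_sum => i.
by apply: regularSM => //; apply: regularSX.
Qed.

Lemma valueS_sumpow y v (g : nat -> series L) (w : nat -> series K) :
  valueS y v -> (forall n, valueS (g n) (w n)) -> valueS (sumpow y g) (sumpow v w).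
Proof.
move=> yr gr e; rewrite !cf_sumpow; apply: value_sum => i.
by apply: valueSM => //; apply: valueSX.
Qed.
End SeriesRegularity.

(** * The cubic does not depend on its argument *)

Section CurveConstant.
Variables (K : numClosedFieldType) (zeta : K).
Hypothesis zeta2 : zeta ^+ 2 = zeta - 1.
Local Notation L := {fraction {poly K}}.
Local Notation lift := (ser_map (@ratC K)).
Local Notation Z := (ratC zeta).
Local Notation X := (serX L).
Local Notation T := ((1 - serC Z) * X ^+ 2).
Local Notation j := (serC Z - 1).

Definition Wd_rat n := lift (Wd zeta n).
Definition Wh_rat m n := lift (Wh zeta m n).

Lemma Z2 : Z ^+ 2 = Z - 1.
Proof. by rewrite -rmorphXn zeta2 rmorphB rmorph1. Qed.

Lemma lift_theta : lift (serC (1 - zeta)) = serC (1 - Z).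
Proof. by rewrite ser_mapC rmorphB rmorph1. Qed.

Lemma Wd_rat0 : Wd_rat 0%N = 1.
Proof. by rewrite /Wd_rat /Wd W_nil rmorph1. Qed.

Lemma Wd_ratS n : Wd_rat n.+1 = serC (1 - Z) * \sum_(i < n) Wd_rat i * Wd_rat (n.-1 - i)%N
  + X * (Wh_rat 0 n + serC (1 - Z) * Wh_rat n 0%N).
Proof.
rewrite /Wd_rat /Wh_rat (WdS zeta2) rmorphD !rmorphM /= lift_theta ser_mapX
  [ser_map _ (_ + _)]rmorphD /= rmorphM /= lift_theta rmorph_sum /=.
by congr (_ * _ + _); apply: eq_bigr => i _; rewrite rmorphM.
Qed.

Lemma Wh_ratE m n : Wh_rat m n = Wd_rat m * Wd_rat n + X * (Wh_rat m.+1 n + serC Z * Wh_rat m n.+1).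
Proof. by rewrite /Wd_rat /Wh_rat (WhE zeta2) rmorphD !rmorphM /= ser_mapX [ser_map _ (_ + _)]rmorphD rmorphM /= ser_mapC. Qed.

Lemma regularS_sumpow_step c (p : {poly K}) (g : nat -> series L) : p.[c] != 0 ->
  (forall n, regularS c (g n)) -> regularS c (serC (tofrac p)^-1 * sumpow (step (tofrac p)) g).
Proof.
move=> pc gr; have pr : regularS c (serC (tofrac p)^-1) by apply/regularS_C/regularV.
apply: regularSM => //; apply: regularS_sumpow => //.
by apply: regularSM => //; apply: regularS_serX.
Qed.

Lemma regularS_gd c (p : {poly K}) : p.[c] != 0 -> regularS c (gd Wd_rat (tofrac p)).
Proof. by move=> pc; apply: regularS_sumpow_step => // n; apply: regularS_lift. Qed.
Lemma regularS_ga c (p : {poly K}) : p.[c] != 0 -> regularS c (ga Wh_rat (tofrac p)).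
Proof. by move=> pc; apply: regularS_sumpow_step => // n; apply: regularS_lift. Qed.
Lemma regularS_gb c (p : {poly K}) : p.[c] != 0 -> regularS c (gb Wh_rat (tofrac p)).
Proof. by move=> pc; apply: regularS_sumpow_step => // n; apply: regularS_lift. Qed.

Lemma regularS1 c : regularS c (1 : series L).
Proof. by rewrite -(rmorph1 lift); apply: regularS_lift. Qed.
Lemma regularS_nat c n : regularS c (n%:R : series L).
Proof. by rewrite -(rmorph_nat lift); apply: regularS_lift. Qed.
Lemma regularS_z c : regularS c (serC Z).
Proof. by apply/regularS_C/regular_ratC. Qed.
Lemma regularS_poly c (p : {poly K}) : regularS c (serC (tofrac p)).
Proof. by apply/regularS_C/regular_poly. Qed.

Ltac regular := lazymatch goal with
  | |- regularS _ (_ + _) => apply: regularSD; regular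
  | |- regularS _ (- _) => apply: regularSN; regular
  | |- regularS _ (_ * _) => apply: regularSM; regular
  | |- regularS _ (_ ^+ _) => apply: regularSX; regular
  | |- regularS _ 1 => exact: regularS1
  | |- regularS _ _%:R => exact: regularS_nat
  | |- regularS _ (serX _) => exact: regularS_serX
  | |- regularS _ (serC (ratC _)) => exact: regularS_z
  | |- regularS _ (serC (tofrac _)) => exact: regularS_poly
  | |- regularS _ (gd _ _) => exact: regularS_gd
  | |- regularS _ (ga _ _) => exact: regularS_ga
  | |- regularS _ (gb _ _) => exact: regularS_gb
  end.

Lemma curve_regular_off c (p q : {poly K}) : p.[c] != 0 -> q.[c] != 0 ->
  regularS c (curve Wd_rat Z (tofrac p) (tofrac q)).
Proof. by move=> pc qc; rewrite /curve; regular. Qed.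

Lemma curve_regular_at c (p q r : {poly K}) :
  triple Z (tofrac p) (tofrac q) (tofrac r) -> q.[c] != 0 -> r.[c] != 0 ->
  regularS c (curve Wd_rat Z (tofrac p) (tofrac q)).
Proof.
move=> tr qc rc.
have n0 : (27%:R : K) != 0 by rewrite Num.Theory.pnatr_eq0.
have -> : curve Wd_rat Z (tofrac p) (tofrac q) =
    lift (serC 27%:R^-1) * (27%:R * curve Wd_rat Z (tofrac p) (tofrac q)).
  rewrite mulrA -(rmorph_nat lift) -rmorphM -(rmorph_nat (@serC K)) -rmorphM mulVf //.
  by rewrite !rmorph1 mul1r.
apply: regularSM; first exact: regularS_lift.
rewrite (curve_cubic Wd_rat0 Wd_ratS Wh_ratE Z2 tr); regular.
Qed.

Definition p0 : {poly K} := 'X.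
Definition p1 : {poly K} := (1 - zeta)%:P * (1 - 'X).
Definition p2 : {poly K} := 1 - zeta%:P * 'X.

Lemma theta_zeta1 : (1 - zeta) * zeta = 1.
Proof. by ring: zeta2. Qed.

Lemma zeta_neq0 : zeta != 0.
Proof.
by apply: contra_eq_neq theta_zeta1 => ->; rewrite mulr0 eq_sym oner_eq0.
Qed.

Lemma p_eval c : [/\ p0.[c] = c, p1.[c] = (1 - zeta) * (1 - c) & p2.[c] = 1 - zeta * c].
Proof. by rewrite /p0 /p1 /p2 !hornerE. Qed.

Lemma p_rel : [/\ p0 + zeta%:P * p1 = 1, p1 + zeta%:P * p2 = 1 & p2 + zeta%:P * p0 = 1].
Proof.
have P2 : zeta%:P ^+ 2 = zeta%:P - 1 :> {poly K} by rewrite -polyC_exp zeta2 polyCB polyC1.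
rewrite /p0 /p1 /p2 polyCB polyC1; split; ring: P2.
Qed.

Lemma triple_p : triple Z (tofrac p0) (tofrac p1) (tofrac p2).
Proof.
have [E0 E1 E2] := p_rel; have th := theta_neq0 zeta2.
split.
- by rewrite tofrac_eq0 polyX_eq0.
- rewrite tofrac_eq0; apply: contraNneq th => /(congr1 (horner^~ 0)).
  by have [_ -> _] := p_eval 0; rewrite horner0 subr0 mulr1 => ->.
- rewrite tofrac_eq0; apply: contraTneq isT => /(congr1 (horner^~ 0)).
  by have [_ _ ->] := p_eval 0; rewrite horner0 mulr0 subr0 => /eqP; rewrite oner_eq0.
- by rewrite /ratC -!tofracM -!tofracD E0 E1 E2 tofrac1.
Qed.

(** The cubic involves only the series at [p0] and [p1], so just the zeros of these polynomials
    matter. At the zero of [p0] the form [curve_cubic] avoids the singular series; at the zero of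
    [p1] a rotation first moves it to that place. *)
Lemma curve_regular c : regularS c (curve Wd_rat Z (tofrac p0) (tofrac p1)).
Proof.
have [e0 e1 e2] := p_eval c; have th := theta_neq0 zeta2; have tz := theta_zeta1.
have tr := triple_p; have tr' := triple_rot tr; have tr'' := triple_rot tr'.
have [c0|c0] := eqVneq p0.[c] 0.
  apply: (curve_regular_at tr); rewrite ?e1 ?e2; move: c0; rewrite e0 => ->.
    by rewrite subr0 mulr1.
  by rewrite mulr0 subr0 oner_neq0.
have [c1|c1] := eqVneq p1.[c] 0; last exact: curve_regular_off.
rewrite (curve_rot Wd_rat0 Wd_ratS Wh_ratE Z2 tr); apply: (curve_regular_at tr') => //.
move/eqP: c1; rewrite e1 mulf_eq0 (negPf th) /= subr_eq0 => /eqP Ec.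
by rewrite e2 -Ec mulr1 th.
Qed.

(* [R] evaluated at the square of the variable. *)
Definition Rs : series K := serX K ^+ 2 - 3%:R * serX K ^+ 4 * Wh zeta 0 0.

Lemma value_ratio : value_at_oo (ratX K * (1 - ratX K)^-1) (-1).
Proof.
have -> : 1 - ratX K = tofrac (1 - 'X) by rewrite tofracB tofrac1.
have s1 : size (1 - 'X : {poly K}) = 2%N.
  by rewrite -opprB size_polyN size_XsubC.
apply: value_div; first by rewrite -size_poly_eq0 s1.
by rewrite s1 scaleN1r opprK addrC subrK size_poly1.
Qed.

Lemma value_inv : value_at_oo (ratX K)^-1 0.
Proof.
rewrite -[_^-1]mul1r -tofrac1; apply: value_div; first by rewrite polyX_eq0.
by rewrite scale0r subr0 size_poly1 size_polyX.
Qed.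

Lemma value_inv1 : value_at_oo (1 - ratX K)^-1 0.
Proof.
have -> : 1 - ratX K = tofrac (1 - 'X) by rewrite tofracB tofrac1.
have s1 : size (1 - 'X : {poly K}) = 2%N.
  by rewrite -opprB size_polyN size_XsubC.
rewrite -[_^-1]mul1r -tofrac1; apply: value_div; first by rewrite -size_poly_eq0 s1.
by rewrite scale0r subr0 size_poly1 s1.
Qed.

Lemma valueS_serX : valueS (serX L) (serX K).
Proof. by rewrite -(ser_mapX (@ratC K)); apply: valueS_lift. Qed.
Lemma valueS_z : valueS (serC Z) (serC zeta).
Proof. by apply/valueS_C/value_ratC. Qed.
Lemma valueS1 : valueS (1 : series L) 1.
Proof. by rewrite -(rmorph1 lift); apply: valueS_lift. Qed.

Lemma p1E : tofrac p1 = (1 - Z) * (1 - ratX K).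
Proof. by rewrite /p1 /ratC /ratX tofracM polyCB polyC1 !tofracB !tofrac1. Qed.

(** Only the existence of a value matters, since the tails occur multiplied by functions that vanish
    at infinity. *)
Lemma valueS_tail u : value_at_oo u^-1 0 -> exists g, valueS (gd_tail Wd_rat u) g.
Proof.
move=> ui; exists (sumpow (serX K * serC 0) (fun n => Wd zeta n.+2)).
apply: valueS_sumpow => [|n]; last exact: valueS_lift.
by apply: valueSM; [exact: valueS_serX | exact: valueS_C].
Qed.

Lemma value_p1 : value_at_oo (tofrac p1)^-1 0.
Proof.
have u1 : 1 - ratX K != 0.
  have -> : 1 - ratX K = tofrac (1 - 'X) by rewrite tofracB tofrac1.
  by rewrite tofrac_eq0 -size_poly_eq0 -opprB size_polyN size_XsubC.
rewrite p1E (invf_v _ Z2); rewrite -(mulr0 zeta).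
by apply: valueM; [exact: value_ratC | exact: value_inv1].
Qed.

Lemma curve_value : valueS (curve Wd_rat Z (ratX K) (tofrac p1)) (- Rs).
Proof.
have u1 : 1 - ratX K != 0.
  have -> : 1 - ratX K = tofrac (1 - 'X) by rewrite tofracB tofrac1.
  by rewrite tofrac_eq0 -size_poly_eq0 -opprB size_polyN size_XsubC.
rewrite (curve_expand Wd_rat0 Z2 (ratX_neq0 K) u1 p1E).
have [g0 v0] := valueS_tail value_inv; have [g1 v1] := valueS_tail value_p1.
set A := T * _.
(* The value of [A] at infinity, obtained by replacing the ratio of [u] and [1 - u] by -1 and the
   inverses of [u] and [1 - u] by 0. *)
pose B := (1 - serC zeta) * serX K ^+ 2 *
   (serC (-1) + serX K * Wd zeta 1 * serC (1 + zeta * (-1) ^+ 2)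
    + serX K ^+ 2 * (serC 0 * g0 - (serC zeta - 1) * serC (zeta ^+ 3 * (-1) ^+ 2 * 0) * g1)).
have vX n : value_at_oo ((ratX K)^-1 ^+ n.+1) 0.
  rewrite exprS -(mul0r ((0 : K) ^+ n)).
  have vXn m : value_at_oo ((ratX K)^-1 ^+ m) (0 ^+ m).
    elim: m => [|m IH]; first by rewrite !expr0 -(rmorph1 (@ratC K)); apply: value_ratC.
    by rewrite !exprS; apply: valueM => //; exact: value_inv.
  by apply: valueM => //; exact: value_inv.
have v1L : value_at_oo (1 : L) 1 by rewrite -(rmorph1 (@ratC K)); apply: value_ratC.
have vr2 : value_at_oo ((ratX K * (1 - ratX K)^-1) ^+ 2) ((-1) ^+ 2).
  by rewrite !expr2; apply: valueM; exact: value_ratio.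
have z1 : valueS (serC Z - 1) (serC zeta - 1).
  by apply: valueSD; [exact: valueS_z | apply: valueSN; exact: valueS1].
have AB : valueS A B.
  apply: valueSM.
    apply: valueSM; last by apply: valueSX; exact: valueS_serX.
    by apply: valueSD; [exact: valueS1 | apply: valueSN; exact: valueS_z].
  apply: valueSD; first apply: valueSD.
  - by apply: valueS_C; exact: value_ratio.
  - apply: valueSM; first by apply: valueSM; [exact: valueS_serX | exact: valueS_lift].
    apply: valueS_C; apply: valueD => //; apply: valueM => //; exact: value_ratC.
  - apply: valueSM; first by apply: valueSX; exact: valueS_serX.
    apply: valueSD; first by apply: valueSM => //; apply: valueS_C; exact: value_inv.
    apply: valueSN; apply: valueSM => //; apply: valueSM => //; apply: valueS_C.
    apply: valueM; last exact: value_inv1.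
    by apply: valueM => //; rewrite -(rmorphXn (@ratC K)); apply: value_ratC.
(* The constant 3 of the theorem arises as [(2 - zeta) * (1 + zeta)]: the first factor comes from
   [Wd zeta 1], the second from the second-order term at infinity. *)
have -> : - Rs = B * (serC 0 * B - 1) * (serC 0 * B + (serC zeta - 1) * serC ((1 - zeta) * (0 - 1))).
  rewrite /B (WdS zeta2) big_ord0 mulr0 add0r sqrrN expr1n !mulr1 !mulr0 sub0r mulrN1 opprB !rmorph0.
  rewrite !(rmorphN, rmorphD, rmorph1) /= /Rs.
  have y2 : (serC zeta) ^+ 2 = serC zeta - 1 by rewrite -rmorphXn zeta2 rmorphB rmorph1.
  by move: (serC zeta) (serX K) (Wh _ _ _) y2 => y x w y2; ring: y2.
apply: valueSM; first apply: valueSM => //.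
  apply: valueSD; last by apply: valueSN; exact: valueS1.
  by apply: valueSM => //; apply: valueS_C; exact: vX.
apply: valueSD; first by apply: valueSM => //; apply: valueS_C; exact: vX.
apply: valueSM => //; apply: valueS_C; apply: valueM.
  by rewrite -(rmorph1 (@ratC K)) -rmorphB; apply: value_ratC.
by apply: valueD; [exact: value_inv | apply: valueN].
Qed.

Lemma curve_const : curve Wd_rat Z (ratX K) (tofrac p1) = lift (- Rs).
Proof.
apply/seriesP => e; apply: liouville => [c|]; last exact: curve_value.
exact: curve_regular.
Qed.
End CurveConstant.

(** * Lagrange inversion *)

Section Lagrange.
Variable E : fieldType.
Implicit Types (f g phi psi eta rho : series E).
Local Notation x := (serX E).

(** The derivation [x d/dx], which preserves degrees. *)
Definition euler f : series E := Series (fun n => n%:R * cf f n).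

Lemma cf_euler f n : cf (euler f) n = n%:R * cf f n. Proof. by []. Qed.

Lemma eulerM f g : euler (f * g) = euler f * g + f * euler g.
Proof.
apply/seriesP => n; rewrite cfD cf_euler !cfM mulr_sumr -big_split; apply: eq_bigr => i _ /=.
rewrite !cf_euler -[n in n%:R](subnKC (_ : i <= n)%N) ?natrD; last by rewrite -ltnS.
by ring.
Qed.

Lemma euler1 : euler 1 = 0.
Proof. by apply/seriesP => n; rewrite cf_euler cf1 cf0; case: n => [|n]; rewrite ?mul0r ?mulr0. Qed.

Lemma eulerX f n : euler (f ^+ n.+1) = n.+1%:R * f ^+ n * euler f.
Proof.
elim: n => [|n IH]; first by rewrite expr1 expr0 !mul1r.
rewrite exprS eulerM IH (exprS _ n) -[n.+2]addn1 natrD; ring.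
Qed.

Definition ev (y : series E) g := sumpow y (fun n => serC (cf g n)).

Lemma ev_add y f g : ev y (f + g) = ev y f + ev y g.
Proof. by rewrite -sumpowD; apply: eq_sumpow => n; rewrite cfD rmorphD. Qed.

Lemma ev_opp y f : vanish 1 y -> ev y (- f) = - ev y f.
Proof.
by move=> y1; rewrite -[RHS]mulN1r /ev -sumpowM //; apply: eq_sumpow => n; rewrite cfN rmorphN mulN1r.
Qed.

Lemma ev_scale y c g : vanish 1 y -> ev y (serC c * g) = serC c * ev y g.
Proof. by move=> y1; rewrite /ev -sumpowM //; apply: eq_sumpow => n; rewrite cf_serCM rmorphM. Qed.

Lemma ev_X y g : vanish 1 y -> ev y (x * g) = y * ev y g.
Proof.
move=> y1; rewrite /ev sumpowS // cf_serXM rmorph0 add0r; congr (_ * _).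
by apply: eq_sumpow => n /=; rewrite cf_serXM.
Qed.

Lemma ev_C y c : vanish 1 y -> ev y (serC c) = serC c.
Proof.
move=> y1; rewrite /ev sumpowS //= -[RHS]addr0; congr (_ + _).
rewrite (@eq_sumpow _ _ _ (fun=> 0 * 0)) => [|n]; last by rewrite /= rmorph0 mul0r.
by rewrite sumpowM // mul0r mulr0.
Qed.

Definition tail f : series E := Series (fun n => cf f n.+1).

Lemma tailE f : f = serC (cf f 0) + x * tail f.
Proof.
apply/seriesP => -[|n]; rewrite cfD cf_serXM ?addr0 //.
by rewrite [cf (serC _) _]/cf /= add0r.
Qed.

(** For [P = x * psi], the derivative of [P] is [psi + euler psi]. The identity compares
    coefficients in [P' / P ^+ n.+2], which is the derivative of [P ^- n.+1] divided by [- n.+1]. *)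
Lemma cf_lagrange phi psi n k : phi * psi = 1 ->
  n.+1%:R * cf (phi ^+ n.+2 * (psi + euler psi)) k = (n.+1%:R - k%:R) * cf (phi ^+ n.+1) k.
Proof.
move=> pp.
have h : n.+1%:R * phi ^+ n.+2 * euler psi = - euler (phi ^+ n.+1).
  have e0 : euler phi * psi + phi * euler psi = 0 by rewrite -eulerM pp euler1.
  have e1 : euler phi = - (phi ^+ 2 * euler psi).
    rewrite -[LHS]mulr1 -pp mulrCA.
    have -> : euler phi * psi = - (phi * euler psi) by apply/eqP; rewrite -addr_eq0 e0.
    by ring.
  by rewrite eulerX e1 !exprS; ring.
have E1 : n.+1%:R * (phi ^+ n.+2 * (psi + euler psi)) = n.+1%:R * phi ^+ n.+1 - euler (phi ^+ n.+1).
  rewrite -h (exprSr phi n.+1).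
  transitivity (n.+1%:R * phi ^+ n.+1 * (phi * psi) + n.+1%:R * (phi ^+ n.+1 * phi) * euler psi).
    by ring.
  by rewrite pp mulr1.
have nE (f : series E) : cf (n.+1%:R * f) k = n.+1%:R * cf f k.
  by rewrite -(rmorph_nat (@serC E)) cf_serCM.
by rewrite -nE E1 cfB cf_euler nE mulrBl.
Qed.

Hypothesis char0 : forall k, k.+1%:R != 0 :> E.

(* Compares two functionals on series in [x]: evaluation at [eta], and the sum of the
   residues of [g * dP / P ^+ n.+1] for [P = x * psi]; both turn multiplication by [P]
   into multiplication by [rho]. *)
Lemma lagrange phi psi eta rho : phi * psi = 1 -> vanish 1 eta -> vanish 1 rho ->
  (forall g, ev eta (x * (psi * g)) = rho * ev eta g) ->
  eta = sumpow rho (fun n => serC (if n is k.+1 then k.+1%:R^-1 * cf (phi ^+ k.+1) k else 0)).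
Proof.
move=> pp e1 r1 evP.
pose D := psi + euler psi.
pose La g := sumpow rho (fun n => serC (cf (g * (phi ^+ n.+1 * D)) n)).
have LaD f g : La (f + g) = La f + La g.
  by rewrite /La -sumpowD; apply: eq_sumpow => n; rewrite mulrDl cfD rmorphD.
have LaZ c g : La (serC c * g) = serC c * La g.
  by rewrite /La -sumpowM //; apply: eq_sumpow => n; rewrite -mulrA cf_serCM rmorphM.
have LaP g : La (x * (psi * g)) = rho * La g.
  rewrite {1}/La sumpowS // -mulrA cf_serXM rmorph0 add0r; congr (_ * _).
  apply: eq_sumpow => n /=; rewrite -mulrA cf_serXM; congr (serC (cf _ _)).
  rewrite exprS; transitivity ((phi * psi) * (g * (phi ^+ n.+1 * D))); first by ring.
  by rewrite pp mul1r.
have cD n : cf (phi ^+ n.+1 * D) n = (n == 0%N)%:R.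
  case: n => [|n].
    rewrite expr1 /D mulrDr pp cfD cf1 cfM big_ord1 cf_euler mul0r mulr0 addr0 //.
  apply: (mulfI (char0 n)); rewrite cf_lagrange // subrr mul0r.
  by rewrite mulr0.
have La1 : La 1 = 1.
  rewrite /La sumpowS // mul1r cD rmorph1 -[RHS]addr0; congr (_ + _).
  rewrite (@eq_sumpow _ _ _ (fun=> 0 * 0)) => [|n]; last by rewrite /= mul1r cD rmorph0 mul0r.
  by rewrite sumpowM // mul0r mulr0.
have ev1 : ev eta 1 = 1 by rewrite -(rmorph1 (@serC E)) ev_C // rmorph1.
(* Every series is a constant plus [P] times another series, and [rho] has no constant term; so
   agreement at 1 propagates to all orders. *)
have EQ k g : vanish k (ev eta g - La g).
  elim: k g => // k IH g.
  have -> : g = serC (cf g 0) * 1 + x * (psi * (phi * tail g)).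
    have -> : psi * (phi * tail g) = tail g by rewrite mulrA [psi * phi]mulrC pp mul1r.
    by rewrite mulr1 -tailE.
  rewrite ev_add LaD ev_scale // LaZ ev1 La1 opprD addrACA subrr add0r evP LaP -mulrBr.
  by apply: (vanishM (k := 1)) => //; exact: IH.
have EQ' g : ev eta g = La g by apply/eqP; rewrite -subr_eq0; apply/eqP/vanish_eq0.
have -> : eta = La x.
  rewrite -EQ' -[x]mulr1 ev_X // -(rmorph1 (@serC E)) ev_C // rmorph1.
  by rewrite [RHS]mulr1.
apply: eq_sumpow => n; congr serC; rewrite cf_serXM; case: n => // n.
apply: (mulfI (char0 n)); rewrite cf_lagrange // mulrA mulfV // -natrB // subSnn.
by rewrite mul1r.
Qed.

(** The expansion of [(1 - a * x) ^- m.+1]. *)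
Definition binser m (a : E) : series E := Series (fun k => 'C(m + k, k)%:R * a ^+ k).

Lemma cf_binser m a k : cf (binser m a) k = 'C(m + k, k)%:R * a ^+ k. Proof. by []. Qed.

Lemma binser0 a : (1 - serC a * x) * binser 0 a = 1.
Proof.
apply/seriesP => k; rewrite mulrBl mul1r -mulrA cfB cf_serCM cf_serXM cf1.
case: k => [|k]; first by rewrite mulr0 subr0 /cf /= bin0 expr0 mulr1.
by rewrite /cf /= !add0n !binn !mul1r exprS subrr.
Qed.

Lemma binserS m a : (1 - serC a * x) * binser m.+1 a = binser m a.
Proof.
apply/seriesP => k; rewrite mulrBl mul1r -mulrA cfB cf_serCM cf_serXM.
case: k => [|k]; first by rewrite mulr0 subr0 /cf /= !bin0.
by rewrite /cf /= !addSn !addnS binS natrD exprS; ring.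
Qed.

Lemma binserX m a : binser 0 a ^+ m.+1 = binser m a.
Proof.
elim: m => [|m IH]; first by rewrite expr1.
rewrite exprS IH -(binserS m a) mulrA [binser 0 a * _]mulrC binser0 mul1r //.
Qed.

Lemma serC_subM (a b : E) : serC ((a - 1) * b) = (serC a - 1) * serC b.
Proof. by rewrite rmorphM rmorphB rmorph1. Qed.

Definition cubic_inv (u v : E) := serC u^-1 * binser 0 u^-1 * (serC v^-1 * binser 0 (- v^-1)).

Lemma cubic_invP u v : u != 0 -> v != 0 -> cubic_inv u v * ((serC u - x) * (serC v + x)) = 1.
Proof.
move=> u0 v0; rewrite /cubic_inv.
have uu : serC u^-1 * serC u = 1 :> series E by rewrite -rmorphM mulVf ?rmorph1.
have vv : serC v^-1 * serC v = 1 :> series E by rewrite -rmorphM mulVf ?rmorph1.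
have bu := binser0 u^-1; have bv := binser0 (- v^-1); rewrite rmorphN /= in bv.
transitivity ((serC u^-1 * serC u - serC u^-1 * x) * binser 0 u^-1 *
   ((serC v^-1 * serC v - - serC v^-1 * x) * binser 0 (- v^-1))); first by ring.
by rewrite uu vv bu bv mulr1.
Qed.

Lemma cf_cubic_inv u v n : cf (cubic_inv u v ^+ n.+1) n =
  \sum_(k < n.+1) 'C(n + k, k)%:R * 'C(n + (n - k), n - k)%:R * (-1) ^+ (n - k) *
    (u^-1 ^+ (n + k).+1 * v^-1 ^+ (n + (n - k)).+1).
Proof.
have -> : cubic_inv u v ^+ n.+1 =
    serC (u^-1 ^+ n.+1 * v^-1 ^+ n.+1) * (binser n u^-1 * binser n (- v^-1)).
  rewrite /cubic_inv !exprMn !binserX rmorphM !rmorphXn /=.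
  by move: (binser _ _) (binser _ _) (serC _ ^+ _) (serC _ ^+ _) => a b c d; ring.
rewrite cf_serCM cfM mulr_sumr; apply: eq_bigr => k _.
rewrite !cf_binser [(- v^-1) ^+ _]exprNn -!addSn !exprD; ring.
Qed.

Lemma cubic_lagrange (u v : E) (eta rho : series E) : u != 0 -> v != 0 ->
  vanish 1 eta -> vanish 1 rho -> eta * (serC u - eta) * (serC v + eta) = rho ->
  eta = sumpow rho (fun n => serC (if n is k.+1
    then k.+1%:R^-1 * cf (cubic_inv u v ^+ k.+1) k else 0)).
Proof.
move=> u0 v0 e1 r1 E0; apply: (lagrange (cubic_invP u0 v0)) => // g.
have ev_lin c f : ev eta ((serC c + x) * f) = (serC c + eta) * ev eta f.
  by rewrite !mulrDl ev_add ev_scale // ev_X.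
have ev_linN c f : ev eta ((serC c - x) * f) = (serC c - eta) * ev eta f.
  by rewrite !mulrBl ev_add ev_opp // ev_scale // ev_X.
by rewrite ev_X // -mulrA ev_linN ev_lin -E0 !mulrA.
Qed.
End Lagrange.

(** Both sides are [(3 * n)!] divided by the product of [k!], [(n - k)!] and the square of [n!]. *)
Lemma bin_trinomial n k : (k <= n)%N ->
  ('C(n + k, k) * 'C(n + (n - k), n - k) * 'C(3 * n, n + k) =
   'C(2 * n, n) * 'C(3 * n, n) * 'C(n, k))%N.
Proof.
move=> kn; pose f := (k`! * n`! * ((n - k)`! * n`!))%N.
have f0 : (0 < f)%N by rewrite !muln_gt0 !fact_gt0.
apply/eqP; rewrite -(eqn_pmul2r f0); apply/eqP.
have b1 : ('C(n + k, k) * (k`! * n`!) = (n + k)`!)%N.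
  by rewrite -(@bin_fact (n + k) k) ?leq_addl // addnK.
have b2 : ('C(n + (n - k), n - k) * ((n - k)`! * n`!) = (n + (n - k))`!)%N.
  by rewrite -(@bin_fact (n + (n - k)) (n - k)) ?leq_addl // addnK.
have b3 : ('C(3 * n, n + k) * ((n + k)`! * (n + (n - k))`!) = (3 * n)`!)%N.
  rewrite -(@bin_fact (3 * n) (n + k)); last by lia.
  by congr (_ * (_ * _`!))%N; lia.
have b4 : ('C(2 * n, n) * (n`! * n`!) = (2 * n)`!)%N.
  by rewrite -(@bin_fact (2 * n) n) ?mul2n -?addnn ?leq_addl // addnK.
have b5 : ('C(3 * n, n) * (n`! * (2 * n)`!) = (3 * n)`!)%N.
  rewrite -(@bin_fact (3 * n) n); last by lia.
  by congr (_ * (_ * _`!))%N; lia.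
have b6 : ('C(n, k) * (k`! * (n - k)`!) = n`!)%N by rewrite bin_fact.
transitivity (3 * n)`!.
  by rewrite -b3 -b1 -b2 /f; move: ('C(_, _)) ('C(_, _)) ('C(_, _)) => p q r; ring.
by rewrite -b5 -b4 -{2}b6 /f; move: ('C(_, _)) ('C(_, _)) ('C(_, _)) => p q r; ring.
Qed.

Lemma split_inv (E : fieldType) (u : E) a b : u != 0 -> 1 - u != 0 ->
  u^-1 ^+ a.+1 * (1 - u)^-1 ^+ b.+1 =
  u^-1 ^+ a.+1 * (1 - u)^-1 ^+ b + u^-1 ^+ a * (1 - u)^-1 ^+ b.+1.
Proof.
move=> u0 u1; rewrite !exprS.
have : u^-1 * (1 - u)^-1 = u^-1 + (1 - u)^-1.
  by field; rewrite u1 u0.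
move: (u^-1 ^+ a) ((1 - u)^-1 ^+ b) => p q; move: (u^-1) ((1 - u)^-1) => i s is_.
transitivity ((i * s) * (p * q)); first by ring.
by rewrite is_; ring.
Qed.

(** * Residues of products of powers of the inverses of u and 1 - u *)

Section Residues.
Variable K : fieldType.
Local Notation L := {fraction {poly K}}.
Local Notation u := (ratX K).

Lemma one_sub_ratX : 1 - u = tofrac (1 - 'X).
Proof. by rewrite tofracB tofrac1. Qed.

Lemma one_sub_ratX_neq0 : 1 - u != 0.
Proof.
by rewrite one_sub_ratX tofrac_eq0 -size_poly_eq0 -opprB size_polyN size_XsubC.
Qed.

Lemma regular_invX b : regular_at 0 ((1 - u)^-1 ^+ b).
Proof.
elim: b => [|b IH]; first by rewrite expr0 -(rmorph1 (@ratC K)); apply: regular_ratC.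
rewrite exprS; apply: regularM => //; rewrite one_sub_ratX; apply: regularV.
by rewrite !hornerE subr0 oner_neq0.
Qed.

(** The partial fractions of [split_inv] turn into Pascal's rule for the residues. *)
Lemma residue_beta a b :
  residue_at0 (u^-1 ^+ a.+1 * (1 - u)^-1 ^+ b.+1) 'C(a + b, a)%:R.
Proof.
have [n] := ubnP (a + b); elim: n a b => // n IH a b ab.
rewrite (split_inv _ _ (ratX_neq0 K) one_sub_ratX_neq0).
have rb : residue_at0 (u^-1 ^+ a.+1 * (1 - u)^-1 ^+ b) (if b is b'.+1 then 'C(a + b', a) else a == 0)%N%:R.
  case: b ab => [|b] ab; last by apply: IH; rewrite addnS in ab.
  by rewrite expr0 mulr1 exprVn; apply: residue_Xn.
have ra : residue_at0 (u^-1 ^+ a * (1 - u)^-1 ^+ b.+1) (if a is a'.+1 then 'C(a' + b, a') else 0)%N%:R.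
  case: a ab {rb} => [|a] ab; last exact: IH.
  by rewrite expr0 mul1r; apply/residue_regular/regular_invX.
have := residueD rb ra; rewrite -natrD; congr residue_at0; congr (_%:R).
case: a {ab rb ra} => [|a]; first by case: b => [|b]; rewrite ?bin0.
case: b => [|b]; first by rewrite !addn0 !binn.
by rewrite !addSn !addnS binS.
Qed.

End Residues.

Definition R_coef (F : fieldType) n : F := n.+1%:R^-1 * 'C(2 * n, n)%:R * 'C(3 * n, n)%:R.

(** * The equation of R, by residues *)

Section AlgebraicEquation.
Variables (K : numClosedFieldType) (zeta : K).
Hypothesis zeta2 : zeta ^+ 2 = zeta - 1.
Local Notation L := {fraction {poly K}}.
Local Notation lift := (ser_map (@ratC K)).
Local Notation Z := (ratC zeta).
Local Notation u := (ratX K).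
Local Notation v := (Z * (1 - u)).

(** With [theta = 1 - zeta] the sum is [theta ^+ n.+1 * (1 - theta) ^+ n], and
    [theta * (1 - theta) = 1]. *)
Lemma binomial_theta n : \sum_(k < n.+1)
    'C(n, k)%:R * (-1) ^+ (n - k) * (1 - zeta) ^+ (n + (n - k)).+1 = 1 - zeta.
Proof.
transitivity ((1 - zeta) ^+ n.+1 * (- (1 - zeta) + 1) ^+ n).
  rewrite [(_ + 1) ^+ _]exprDn mulr_sumr; apply: eq_bigr => k _.
  by rewrite expr1n mulr1 -addSn exprD [(- (1 - zeta)) ^+ _]exprNn -[_ *+ 'C(n, k)]mulr_natl; ring.
rewrite opprB subrK exprS -mulrA -exprMn.
by have -> : (1 - zeta) * zeta = 1 by [ring: zeta2]; rewrite expr1n mulr1.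
Qed.

(** Each term of [cf_cubic_inv] is evaluated by [residue_beta]. Then [bin_trinomial] takes the
    factor independent of [k] out of the sum, and [binomial_theta] evaluates the rest. *)
Lemma residue_lagrange n :
  residue_at0 (n.+1%:R^-1 * cf (cubic_inv u v ^+ n.+1) n) ((1 - zeta) * R_coef K n).
Proof.
have -> : (1 - zeta) * R_coef K n = n.+1%:R^-1 * \sum_(k < n.+1) 'C(n + k, k)%:R *
   'C(n + (n - k), n - k)%:R * (-1) ^+ (n - k) * ((1 - zeta) ^+ (n + (n - k)).+1 * 'C(3 * n, n + k)%:R).
  rewrite /R_coef -{1}(binomial_theta n) -!mulrA mulrCA; congr (_ * _).
  rewrite mulr_suml; apply: eq_bigr => k _.
  have kn : (k <= n)%N by rewrite -ltnS.
  have := congr1 (fun m => m%:R : K) (bin_trinomial kn); rewrite !natrM.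
  move: ('C(n + k, k)%:R) ('C(n + (n - k), n - k)%:R) ('C(3 * n, n + k)%:R) => a b c.
  move: ('C(2 * n, n)%:R) ('C(3 * n, n)%:R) ('C(n, k)%:R) => d e f abc.
  move: ((-1) ^+ _) ((1 - zeta) ^+ _) => p q.
  transitivity ((d * e * f) * p * q); first by ring.
  by rewrite -abc; ring.
have -> : n.+1%:R^-1 = ratC n.+1%:R^-1 :> L by rewrite fmorphV rmorph_nat.
apply: residueZ; rewrite cf_cubic_inv; apply: residue_sum => k.
have kn : (k <= n)%N by rewrite -ltnS.
have iv : v^-1 = ratC (1 - zeta) * (1 - u)^-1.
  have z1 : 1 - zeta = zeta^-1.
    by apply: (mulIf (zeta_neq0 zeta2)); rewrite mulVf ?(zeta_neq0 zeta2) // theta_zeta1.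
  by rewrite invfM z1 fmorphV.
rewrite iv [X in residue_at0 X _]mulrA [X in residue_at0 _ X]mulrA.
set c := 'C(n + k, k)%:R * 'C(n + (n - k), n - k)%:R * (-1) ^+ (n - k).
have -> : c * u^-1 ^+ (n + k).+1 * (ratC (1 - zeta) * (1 - u)^-1) ^+ (n + (n - k)).+1 =
   ratC ('C(n + k, k)%:R * 'C(n + (n - k), n - k)%:R * (-1) ^+ (n - k) * (1 - zeta) ^+ (n + (n - k)).+1)
   * (u^-1 ^+ (n + k).+1 * (1 - u)^-1 ^+ (n + (n - k)).+1).
  rewrite !rmorphM !rmorphXn !rmorph_nat rmorphN1 /= exprMn -/c.
  by move: (u^-1 ^+ _) ((1 - u)^-1 ^+ _) (ratC _ ^+ _) c => p q r w; ring.
apply: residueZ; have -> : (3 * n = (n + k) + (n + (n - k)))%N by lia.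
exact: residue_beta.
Qed.

Definition residueS (f : series L) (r : series K) := forall e, residue_at0 (cf f e) (cf r e).

Lemma residueS_liftM g (f : series L) (r : series K) : residueS f r -> residueS (lift g * f) (g * r).
Proof. by move=> fr e; rewrite !cfM; apply: residue_sum => i; apply: residueZ. Qed.

(** The term of index [n] is a multiple of [u ^- n.+1], so only [n = 0], the empty word,
    contributes. *)
Lemma residueS_gd : residueS (gd (Wd_rat zeta) u) 1.
Proof.
move=> e; rewrite /gd cf_serCM cf_sumpow mulr_sumr.
have -> : cf 1 e = \sum_(n < e.+1) cf (Wd zeta n * serX K ^+ n) e * (n == 0%N :> nat)%:R.
  rewrite big_ord_recl big1 ?addr0 => [|i _]; last by rewrite mulr0.
  by rewrite /Wd /= W_nil expr0 !mulr1.
apply: residue_sum => n.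
have -> : u^-1 * cf (Wd_rat zeta n * step u ^+ n) e =
    ratC (cf (Wd zeta n * serX K ^+ n) e) * u ^- n.+1.
  have -> : Wd_rat zeta n * step u ^+ n = serC (u^-1 ^+ n) * lift (Wd zeta n * serX K ^+ n).
    have -> : lift (Wd zeta n * serX K ^+ n) = Wd_rat zeta n * serX L ^+ n.
      by rewrite rmorphM (rmorphXn lift) /= ser_mapX.
    rewrite (rmorphXn (@serC L)) /= /step exprMn.
    by move: (Wd_rat zeta n) (serX L ^+ n) (serC u^-1 ^+ n) => a b c; rewrite mulrA mulrC.
  by rewrite cf_serCM -exprVn exprS mulrA mulrC; congr (_ * _).
by apply: residueZ; apply: residue_Xn.
Qed.

Local Notation p1f := (tofrac (p1 zeta)).
Local Notation T := ((1 - serC Z) * serX L ^+ 2).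
Definition eta : series L := T * gd (Wd_rat zeta) u - (serC Z - 1) * T * gd (Wd_rat zeta) p1f.

Lemma TE : T = lift ((1 - serC zeta) * serX K ^+ 2).
Proof. by rewrite rmorphM rmorphB rmorph1 rmorphXn /= ser_mapX ser_mapC. Qed.

Lemma jTE : (serC Z - 1) * T = lift ((serC zeta - 1) * ((1 - serC zeta) * serX K ^+ 2)).
Proof.
have E : lift (serC zeta - 1) = serC Z - 1 by rewrite rmorphB rmorph1 /= ser_mapC.
rewrite [RHS](rmorphM lift (serC zeta - 1) ((1 - serC zeta) * serX K ^+ 2)).
by apply: congr2; [exact: esym E | exact: TE].
Qed.

Lemma vanish_X2 (R : comNzRingType) (f : series R) : vanish 1 (serX R ^+ 2 * f).
Proof. by rewrite expr2 -mulrA; apply/vanishMl/vanish_serX. Qed.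

Lemma vanish_eta : vanish 1 eta.
Proof.
have -> : eta = serX L ^+ 2 * ((1 - serC Z) * gd (Wd_rat zeta) u
    - (serC Z - 1) * (1 - serC Z) * gd (Wd_rat zeta) p1f).
  rewrite /eta; move: (gd _ u) (gd _ p1f) (serX L) (serC Z) => a b c d; ring.
exact: vanish_X2.
Qed.

Lemma vanish_Rs : vanish 1 (Rs zeta).
Proof.
have -> : Rs zeta = serX K ^+ 2 * (1 - 3%:R * serX K ^+ 2 * Wh zeta 0 0).
  by rewrite /Rs; move: (Wh _ _ _) => a; ring.
exact: vanish_X2.
Qed.

(** The series at [p1] is regular at 0, so the residue is [T] times that of the series at [u], which
    is 1. *)
Lemma residue_eta e : residue_at0 (cf eta e) ((1 - zeta) * (e == 2)%:R).
Proof.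
rewrite /eta cfB -[_ * _%:R]addr0; apply: residueD; last first.
  apply: residue_regular; apply: regularN.
  suff : regularS 0 ((serC Z - 1) * T * gd (Wd_rat zeta) p1f) by apply.
  apply: regularSM; last first.
    apply: regularS_gd; have [_ -> _] := p_eval zeta 0.
    by rewrite subr0 mulr1 theta_neq0.
  by rewrite jTE; exact: regularS_lift.
have := residueS_liftM ((1 - serC zeta) * serX K ^+ 2) residueS_gd; rewrite -TE mulr1 => /(_ e).
have -> // : cf ((1 - serC zeta) * serX K ^+ 2) e = (1 - zeta) * (e == 2)%:R.
rewrite -(rmorph1 (@serC K)) -rmorphB cf_serCM -[_ ^+ 2]mulr1 cf_serXnM cf1.
by case: e => [|[|[|e]]].
Qed.

(** Lagrange inversion expands [eta] in powers of [Rs], which do not depend on [u]; so residues can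
    be taken term by term. Comparison with [residue_eta] leaves a common factor [1 - zeta] to
    cancel. *)
Lemma series_equation e :
  (e == 2)%:R = \sum_(n < e) R_coef K n * cf (Rs zeta ^+ n.+1) e.
Proof.
have th := theta_neq0 zeta2.
have Z0 : Z != 0 by rewrite fmorph_eq0 (zeta_neq0 zeta2).
have v0 : v != 0 := mulf_neq0 Z0 (one_sub_ratX_neq0 K).
have r1 : vanish 1 (lift (Rs zeta)).
  by move=> i i1; rewrite -(rmorph0 (@ratC K)) -(vanish_Rs i1).
have E0 : eta * (serC u - eta) * (serC v + eta) = lift (Rs zeta).
  have := curve_const zeta2; rewrite /curve -/eta rmorphN => /(congr1 -%R); rewrite opprK => <-.
  have -> : serC v = (serC Z - 1) * serC p1f.
    have <- : (Z - 1) * p1f = v.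
      rewrite p1E mulrA; congr (_ * _); have := Z2 zeta2.
      by move: Z => y y2; ring: y2.
    exact: serC_subM.
  by ring.
have char0 k : k.+1%:R != 0 :> L.
  by rewrite -(rmorph_nat (@ratC K)) fmorph_eq0 Num.Theory.pnatr_eq0.
have El := cubic_lagrange char0 (ratX_neq0 K) v0 vanish_eta r1 E0.
have res : residue_at0 (cf eta e) (\sum_(n < e.+1)
   cf (Rs zeta ^+ n) e * (if n : nat is k.+1 then (1 - zeta) * R_coef K k else 0)).
  rewrite El cf_sumpow; apply: residue_sum => n.
  rewrite cf_serCM -rmorphXn /= [X in residue_at0 X _]mulrC.
  apply: residueZ; case: (nat_of_ord n) => [|k]; last exact: residue_lagrange.
  by apply: residue_regular; rewrite -(rmorph0 (@ratC K)); apply: regular_ratC.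
apply: (mulfI th); rewrite -(residue_uniq res (residue_eta e)).
rewrite big_ord_recl mulr0 add0r mulr_sumr; apply: eq_bigr => n _.
rewrite lift0; move: (R_coef K _) (cf _ _) => a b; ring.
Qed.

End AlgebraicEquation.

(** * The equation of R *)

Section RationalSeries.
Implicit Types f g : fps.

Lemma coefsM f g n : coefs (f * g) n = \sum_(i < n.+1) coefs f i * coefs g (n - i)%N.
Proof. by []. Qed.

Lemma coefsD f g n : coefs (f + g) n = coefs f n + coefs g n. Proof. by []. Qed.
Lemma coefsB f g n : coefs (f - g) n = coefs f n - coefs g n. Proof. by []. Qed.

Lemma coefs1 n : coefs 1 n = (n == 0%N)%:R.
Proof. by rewrite /=; case: eqP. Qed.

Lemma coefs_sum (I : Type) (r : seq I) (P : pred I) (F : I -> fps) n :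
  coefs (\sum_(i <- r | P i) F i) n = \sum_(i <- r | P i) coefs (F i) n.
Proof. by apply: (big_morph (fun f => coefs f n)) => //=; rewrite if_same. Qed.

Lemma coefs_t n : coefs fps_t n = (n == 1%N)%:R.
Proof. by rewrite /coefs /fps_t; case: (n == 1%N). Qed.

Lemma coefs_tM f n : coefs (fps_t * f) n.+1 = coefs f n.
Proof.
rewrite coefsM !big_ord_recl /= mul0r add0r mul1r subn1 /= big1 ?addr0 // => i _.
by rewrite mul0r.
Qed.

Lemma coefs_natM m f n : coefs (m%:R * f) n = m%:R * coefs f n.
Proof.
elim: m => [|m IH]; first by rewrite !mul0r /= if_same.
by rewrite -natr1 mulrDl mul1r -[in RHS]natr1 mulrDl mul1r -IH.
Qed.

Lemma coefsX_small f n k : coefs f 0 = 0 -> (k < n)%N -> coefs (f ^+ n) k = 0.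
Proof.
move=> f0; elim: n k => [//|n IH] k kn; rewrite exprS coefsM big_ord_recl f0 mul0r add0r big1 // => i _.
by rewrite IH ?mulr0 // lift0; have := ltn_ord i; lia.
Qed.

Lemma coefs_exprS f n k : coefs f 0 = 0 ->
  coefs (f ^+ n.+1) k = \sum_(i < k) coefs f i.+1 * coefs (f ^+ n) (k - i.+1).
Proof. by move=> f0; rewrite exprS coefsM big_ord_recl f0 mul0r add0r. Qed.

Lemma eq_coefsX f g n k : (forall i, (i < k)%N -> coefs f i = coefs g i) ->
  forall i, (i < k)%N -> coefs (f ^+ n) i = coefs (g ^+ n) i.
Proof.
move=> fg; elim: n => [//|n IH] i ik; rewrite !exprS !coefsM; apply: eq_bigr => j _.
by rewrite fg ?IH //; have := ltn_ord j; lia.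
Qed.

Lemma eq_coefsXS f g n k : coefs f 0 = 0 -> coefs g 0 = 0 ->
  (forall i, (i < k)%N -> coefs f i = coefs g i) ->
  coefs (f ^+ n.+2) k = coefs (g ^+ n.+2) k.
Proof.
move=> f0 g0 fg; rewrite !(coefs_exprS _ _ f0, coefs_exprS _ _ g0); apply: eq_bigr => i _.
have [ik|ik] := eqVneq i.+1 k.
  by rewrite ik subnn !coefsX_small ?mulr0.
by rewrite fg ?(@eq_coefsX f g _ k) //; have := ltn_ord i; lia.
Qed.

(** Since [f ^+ n.+1] starts at order [n.+1], only the terms with [n < k] reach the coefficient [k],
    and convergence is automatic. *)
Lemma R_equation_coefs f : R_equation f <-> coefs f 0 = 0 /\
  forall k, \sum_(n < k) R_coef rat n * coefs (f ^+ n.+1) k = coefs fps_t k.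
Proof.
have cut k M : coefs f 0 = 0 -> (k <= M)%N ->
  coefs (\sum_(n < M) R_coef rat n *: f ^+ n.+1) k = \sum_(n < k) R_coef rat n * coefs (f ^+ n.+1) k.
  move=> f0 kM; rewrite coefs_sum.
  rewrite (big_ord_widen M (fun n => R_coef rat n * coefs (f ^+ n.+1) k) kM) [RHS]big_mkcond.
  apply: eq_bigr => n _; case: ltnP => // kn.
  by rewrite [LHS]/= coefsX_small ?mulr0.
split=> -[f0 E]; split=> // k.
  have [N EN] := E k; rewrite -(EN (maxn N k)) ?leq_maxl //.
  by rewrite (cut k) ?leq_maxr.
by exists k => M kM; rewrite -(E k) -(cut k M).
Qed.

(** In the coefficient [k] of the equation, powers beyond the first involve only coefficients of
    index below [k]; the linear term has the nonzero factor [R_coef rat 0] and determines the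
    rest. *)
Lemma R_equation_uniq f g : R_equation f -> R_equation g -> f = g.
Proof.
move=> /R_equation_coefs [f0 Ef] /R_equation_coefs [g0 Eg]; apply/fpsP => k.
elim/ltn_ind: k => -[|k] IH; first by rewrite f0.
have := Ef k.+1; rewrite -(Eg k.+1) !big_ord_recl.
rewrite (eq_bigr (fun n : 'I_k => R_coef rat (lift ord0 n) * coefs (g ^+ (lift ord0 n).+1) k.+1)).
  by move/addIr; rewrite !expr1 => /(mulfI (_ : R_coef rat 0 != 0)); apply.
by move=> n _; rewrite !lift0 (eq_coefsXS _ f0 g0 IH).
Qed.

(* Stated for abstract powers [p n k = coefs (f ^+ n) k]: unification is expensive on [fps]. *)
Lemma R_values (p : nat -> nat -> rat) (w : nat -> rat) :
  [/\ w 0%N = 1, w 1%N = 3%:R, w 2%N = 30%:R, w 3%N = 420%:R & w 4%N = (70 * 99)%:R] ->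
  (forall n k, (k < n)%N -> p n k = 0) ->
  (forall n k, p n.+1 k = \sum_(0 <= i < k) p 1%N i.+1 * p n (k - i.+1)%N) ->
  (forall k, \sum_(0 <= n < k) w n * p n.+1 k = (k == 1%N)%:R) ->
  [/\ p 1%N 3%N = - 12%:R, p 1%N 4%N = - 105%:R & p 1%N 5%N = - 1206%:R].
Proof.
case=> w0 w1 w2 w3 w4 z sq E.
pose bigE := (big_cons, big_nil).
have zE := (z 1%N 0%N isT, z 2%N 0%N isT, z 2%N 1%N isT, z 3%N 0%N isT, z 3%N 1%N isT, z 3%N 2%N isT, z 4%N 0%N isT,
            z 4%N 1%N isT, z 4%N 2%N isT, z 4%N 3%N isT).
have r1 : p 1%N 1%N = 1 by have := E 1%N; rewrite /index_iota /= !bigE w0 => H; lra.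
have s2 : p 2%N 2%N = 1.
  by rewrite sq /index_iota /= !bigE !subSS !subn0 r1 !zE; ring.
have r2 : p 1%N 2%N = - 3%:R.
  by have := E 2%N; rewrite /index_iota /= !bigE w0 w1 s2 => H; lra.
have s3 : p 2%N 3%N = - 6%:R.
  by rewrite sq /index_iota /= !bigE !subSS !subn0 r1 r2 !zE; ring.
have c3 : p 3%N 3%N = 1.
  by rewrite sq /index_iota /= !bigE !subSS !subn0 r1 s2 !zE; ring.
have r3 : p 1%N 3%N = - 12%:R.
  by have := E 3%N; rewrite /index_iota /= !bigE w0 w1 w2 s3 c3 => H; lra.
have s4 : p 2%N 4%N = - 15%:R.
  by rewrite sq /index_iota /= !bigE !subSS !subn0 r1 r2 r3 !zE; ring.
have c4 : p 3%N 4%N = - 9%:R.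
  by rewrite sq /index_iota /= !bigE !subSS !subn0 r1 r2 s2 s3 !zE; ring.
have d4 : p 4%N 4%N = 1.
  by rewrite sq /index_iota /= !bigE !subSS !subn0 r1 c3 !zE; ring.
have r4 : p 1%N 4%N = - 105%:R.
  by have := E 4%N; rewrite /index_iota /= !bigE w0 w1 w2 w3 s4 c4 d4 => H; lra.
have s5 : p 2%N 5%N = - 138%:R.
  by rewrite sq /index_iota /= !bigE !subSS !subn0 r1 r2 r3 r4 !zE; ring.
have c5 : p 3%N 5%N = - 9%:R.
  by rewrite sq /index_iota /= !bigE !subSS !subn0 r1 r2 r3 s2 s3 s4 !zE; ring.
have d5 : p 4%N 5%N = - 12%:R.
  by rewrite sq /index_iota /= !bigE !subSS !subn0 r1 r2 c3 c4 !zE; ring.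
have e5 : p 5%N 5%N = 1.
  by rewrite sq /index_iota /= !bigE !subSS !subn0 r1 d4 !zE; ring.
split; [exact: r3 | exact: r4 | have := E 5%N].
rewrite /index_iota /= !bigE w0 w1 w2 w3 w4 s5 c5 d5 e5 natrM => H; lra.
Qed.

(** The three values are -3 times 4, 35 and 402. *)
Lemma R_equation_values f : R_equation f ->
  [/\ coefs f 3 = - 12%:R, coefs f 4 = - 105%:R & coefs f 5 = - 1206%:R].
Proof.
case/R_equation_coefs => f0 E.
apply: (@R_values (fun n k => coefs (f ^+ n) k) (R_coef rat)).
- by split; apply/eqP; vm_compute.
- by move=> n k; apply: coefsX_small.
- by move=> n k; rewrite big_mkord (coefs_exprS _ _ f0).
by move=> k; rewrite big_mkord E coefs_t.
Qed.

End RationalSeries.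

(** * From the square of the series variable back to t *)

Section SquareSubstitution.
Variables (K : numClosedFieldType) (zeta : K).
Hypothesis zeta2 : zeta ^+ 2 = zeta - 1.

(* Substitutes the square of the variable for [t]. *)
Definition subst_square (f : fps) : series K :=
  Series (fun e => if odd e then 0 else ratr (coefs f e./2)).
Local Notation psi := subst_square.

Lemma cf_subst_double f k : cf (psi f) k.*2 = ratr (coefs f k).
Proof. by rewrite /cf /= odd_double doubleK. Qed.

Lemma cf_subst_odd f e : odd e -> cf (psi f) e = 0.
Proof. by rewrite /cf /= => ->. Qed.

Lemma sum_even (G : nat -> K) k :
  \sum_(i < k.*2.+1) (if odd i then 0 else G i./2) = \sum_(i < k.+1) G i.
Proof.
elim: k => [|k IH]; first by rewrite !big_ord1.
rewrite doubleS 2!big_ord_recr IH [RHS]big_ord_recr /= odd_double /= addr0.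
by rewrite doubleK.
Qed.

Fact subst_square_additive : zmod_morphism psi.
Proof.
move=> f g; apply/seriesP => e; rewrite cfB.
have [oe|ee] := boolP (odd e); first by rewrite !cf_subst_odd ?subr0.
by rewrite -(even_halfK ee) !cf_subst_double -rmorphB.
Qed.

HB.instance Definition _ := GRing.isZmodMorphism.Build fps (series K) psi subst_square_additive.

Fact subst_square_monoid : monoid_morphism psi.
Proof.
split=> [|f g]; apply/seriesP => e.
  have [oe|ee] := boolP (odd e); first by rewrite cf_subst_odd ?cf1 //; case: e oe.
  by rewrite -(even_halfK ee) cf_subst_double coefs1 cf1 rmorph_nat; case: (e./2).
have [oe|ee] := boolP (odd e).
  rewrite cf_subst_odd // cfM big1 // => i _.
  have [oi|ei] := boolP (odd i); first by rewrite cf_subst_odd ?mul0r.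
  by rewrite [X in _ * X]cf_subst_odd ?mulr0 // oddB ?oe ?(negPf ei) // -ltnS.
rewrite -(even_halfK ee); move: (e./2) => k.
rewrite cf_subst_double cfM coefsM rmorph_sum -(sum_even (fun i => ratr (coefs f i * coefs g (k - i)%N))); apply: eq_bigr => i _.
case: ifPn => [oi|ei]; first by rewrite cf_subst_odd ?mul0r.
have [h ->] : exists h, nat_of_ord i = h.*2 by exists (i./2); rewrite even_halfK.
by rewrite -doubleB !cf_subst_double doubleK rmorphM.
Qed.

HB.instance Definition _ := GRing.isMonoidMorphism.Build fps (series K) psi subst_square_monoid.

Lemma subst_square_t : psi fps_t = serX K ^+ 2.
Proof.
apply/seriesP => e; rewrite -[_ ^+ 2]mulr1 cf_serXnM cf1.
have [oe|ee] := boolP (odd e); first by rewrite cf_subst_odd //; case: e oe => [|[|[|]]].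
by rewrite -(even_halfK ee) cf_subst_double coefs_t rmorph_nat; case: (e./2) => [|[|]].
Qed.

(** The added 1 accounts for the map without vertices, in which the two boundary darts form an edge.
    Parity kills the odd coefficients. *)
Lemma subst_square_Q : psi (1 + Q_series) = Wh zeta 0 0.
Proof.
apply/seriesP => e.
have [oe|ee] := boolP (odd e).
  by rewrite cf_subst_odd // [RHS]W_parity // addn0.
rewrite -(even_halfK ee); move: (e./2) => k; rewrite cf_subst_double.
have -> : Wh zeta 0 0 = W zeta (map Some [:: false; true]).
  by rewrite /Wh /= -(W_rot zeta2 [:: Some false] [:: Some true]).
have bF := boundary_series_W zeta2.
case: k => [|k]; last first.
  by rewrite -muln2 mulnC -(quartic_peo_countE k bF) /= add0r ratr_nat.
rewrite (boundary_cons bF) /= big_cons big_nil addr0 /= W_nil mulr1 cfD expr2 -mulrA cf_serXM.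
by rewrite !addr0 cf1 rmorph1.
Qed.

(** Defined from [Q_series]; the existence of a solution then comes from the enumeration itself,
    with no inversion of the power series. *)
Definition R_series : fps := fps_t - 3%:R * fps_t ^+ 2 - 3%:R * fps_t ^+ 2 * Q_series.

Lemma subst_square_R : psi R_series = Rs zeta.
Proof.
have -> : R_series = fps_t - 3%:R * (fps_t ^+ 2) * (1 + Q_series) by rewrite /R_series; ring.
rewrite rmorphB !rmorphM /= rmorph_nat subst_square_Q !subst_square_t /Rs.
by move: (Wh _ _ _) => w; ring.
Qed.

Lemma R_series_equation : R_equation R_series.
Proof.
have R0 : coefs R_series 0 = 0.
  apply/eqP; rewrite -(fmorph_eq0 (@ratr K)) -[X in X == 0](cf_subst_double _ 0) subst_square_R.
  exact/eqP/(@vanish_Rs K zeta 0).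
apply/R_equation_coefs; split=> // k; apply: (@fmorph_inj _ _ (@ratr K)).
rewrite coefs_t rmorph_sum rmorph_nat.
have -> : (k == 1%N)%:R = (k.*2 == 2)%:R :> K by case: k => [|[|]].
rewrite (series_equation zeta2).
(* The bound coming from the squared variable is [k.*2]; the terms beyond [k] vanish for reasons of
   order. *)
rewrite (big_ord_widen k.*2 (fun n => ratr (R_coef rat n * coefs (R_series ^+ n.+1) k))); last first.
  by rewrite -addnn leq_addr.
rewrite [LHS]big_mkcond; apply: eq_bigr => n _.
rewrite -subst_square_R -rmorphXn /= cf_subst_double.
case: ltnP => kn; last by rewrite coefsX_small ?rmorph0 ?mulr0.
by rewrite /R_coef !rmorphM fmorphV !rmorph_nat.
Qed.

End SquareSubstitution.

Theorem theorem2 :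
  exists R : fps,
    [/\ unique R_equation R,
        3%:R * fps_t ^+ 2 * Q_series = fps_t - 3%:R * fps_t ^+ 2 - R
      & [/\ coefs Q_series 1 = 4%:R,
            coefs Q_series 2 = 35%:R
          & coefs Q_series 3 = 402%:R]].
Proof.
have [zeta zeta2] : exists zeta : algC, zeta ^+ 2 = zeta - 1.
  (* The list holds the coefficients of [z ^+ 2 = -1 + z], by increasing degree. *)
  have [z E] := @solve_monicpoly algC 2 (nth 0 [:: -1; 1]) isT.
  by exists z; rewrite E !big_ord_recl big_ord0 /= expr0; ring.
have RE := R_series_equation zeta2.
exists R_series; split; first by split=> // f; apply: R_equation_uniq.
  by rewrite /R_series; ring.
(* The terms in [t] and [t ^+ 2] reach the indices 1 and 2 only; from index 3 on, [R] is -3 times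
   [Q] shifted by two. *)
have Q k : coefs R_series k.+3 = - (3%:R * coefs Q_series k.+1).
  have -> : R_series = fps_t - 3%:R * (fps_t * (fps_t * (1 + Q_series))).
    by rewrite /R_series; ring.
  by rewrite coefsB coefs_t coefs_natM !coefs_tM coefsD coefs1 !add0r.
have [] := R_equation_values RE; rewrite !Q => q1 q2 q3.
by split; lra.
Qed.
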